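(* Let $K$ be a field. Suppose $f_1,f_2\in K[x]$ satisfy $\deg(f_1)\ge\deg(f_2)>1$ and $\mathrm{char}(K)\nmid\deg(f_1)\deg(f_2)$. Then $f_1$ and $f_2$ have a common composite of degree not divisible by $\mathrm{char}(K)$ if and only if there are degree-$1$ polynomials $\ell_1,\ell_2\in K[x]$ and a polynomial $h(x)\in K[x]$ of degree $\gcd(\deg(f_1),\deg(f_2))$ such that either 1. $f_1=\ell_1\circ x^r P(x^n)\circ h(x)$ and $f_2=\ell_2\circ x^n\circ h(x)$, where $r,n>0$ are integers and $P\in K[x]$; or 2. $f_1=\ell_1\circ D_m(x,\alpha)\circ h(x)$ and $f_2=\ell_2\circ D_n(x,\alpha)\circ h(x)$, where $\alpha\in K$ and $m,n>0$ are integers.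
   Context: Nonconstant polynomials $f_1,f_2\in K[x]$ have a common composite (over $K$) if there are nonconstant $u,v\in K[x]$ such that $u(f_1(x))=v(f_2(x))$; any such polynomial $u(f_1(x))$ is called a common composite of $f_1$ and $f_2$. When $\mathrm{char}(K)=0$, the condition that a positive integer is not divisible by $\mathrm{char}(K)$ is vacuous. The symbol $\circ$ denotes composition of polynomials in $x$. For $\alpha\in K$ and $n>0$, the Dickson polynomial $D_n(x,\alpha)\in K[x]$ is $$D_n(x,\alpha)=\sum_{i=0}^{\lfloor n/2\rfloor}\frac{n}{n-i}\binom{n-i}{i}(-\alpha)^i x^{n-2i},$$ where the coefficients $\frac{n}{n-i}\binom{n-i}{i}$ are integers; it satisfies $D_n(x+\alpha/x,\alpha)=x^n+(\alpha/x)^n$. *)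

(* Defs.v *)
From mathcomp Require Import all_boot all_order all_algebra.

Set Implicit Arguments.
Unset Strict Implicit.
Unset Printing Implicit Defensive.

Import GRing.Theory.
Local Open Scope ring_scope.

(* Natural-number degree, with the junk value [deg 0 = 0]: [p] is nonconstant
   exactly when [0 < deg p]. *)
Definition deg (K : fieldType) (p : {poly K}) : nat := (size p).-1.

(* [[pchar K]] is the set of prime characteristics of [K]; it is empty in
   characteristic 0, so the condition is then vacuous. *)
Definition char_ndvd (K : fieldType) (n : nat) : Prop :=
  forall p : nat, p \in [pchar K] -> ~~ (p %| n)%N.

Definition common_composite (K : fieldType) (f1 f2 g : {poly K}) : Prop :=
  exists u v : {poly K},
    [/\ (0 < deg u)%N, (0 < deg v)%N, g = u \Po f1 & g = v \Po f2].

(* n / (n - i) * binomial(n - i, i); the division is exact. *)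
Definition dickson_coef (n i : nat) : nat := ((n * 'C(n - i, i)) %/ (n - i))%N.

Lemma dickson_coef_exact (n i : nat) :
  (i <= n)%N -> (dickson_coef n i * (n - i) = n * 'C(n - i, i))%N.
Proof.
move=> le_in; apply: divnK.
have ->: (n * 'C(n - i, i) = (n - i) * 'C(n - i, i) + i * 'C(n - i, i))%N.
  by rewrite -mulnDl subnK.
apply: dvdn_add; first exact: dvdn_mulr.
case: i le_in => [|i] _; first by rewrite mul0n dvdn0.
by rewrite -mul_bin_diag dvdn_mulr.
Qed.

Definition dickson (K : fieldType) (n : nat) (a : K) : {poly K} :=
  \sum_(i < (n./2).+1)
     ((dickson_coef n i)%:R * (- a) ^+ i) *: 'X^(n - i.*2).

(* Main.v *)
From HB Require Import structures.
Require Import Defs.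
From mathcomp Require Import all_boot all_order all_algebra.
From mathcomp Require Import polyXY.
From mathcomp Require Import closed_field.
From mathcomp Require boolp.
From mathcomp Require Import zify ring.

(** Two polynomials with a common composite of degree prime to the characteristic
    behave as in Ritt's second theorem, but the characteristic may divide
    ramification indices. The proof is a count of ramification.

    Reduction to coprime degrees. Let [u \Po f1 = v \Po f2]. When the degree of the
    composite is nonzero in [K], approximate roots give [U \Po f1 = V \Po f2] where the
    composite has degree the least common multiple ([minimal_composite]). Over an
    algebraically closed field the resultant of [f1(x) - X] and [f2(x) - Y] is a power
    of [U(X) - V(Y)] ([fibre_polyE]); hence for generic [c] the polynomials
    [f1(x) - f1(c)] and [f2(x) - f2(c)] have [gcd (deg f1) (deg f2)] common roots, and
    an argument as in Lueroth's theorem yields a common right factor [h] of that degree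
    ([common_right_factor]). It is an approximate root up to a constant, so it
    is defined over [K] ([descend_right_factor]).

    Counting. Let now [f1], [f2] have coprime degrees [m > n > 1]. If [U(u) = V(v)], the
    indices of [f2] at the points over [(u, v)] sum to the index of [U] at [u], those
    of [f1] to the index of [V] at [v], and there are at most as many points as the
    greatest common divisor of these two indices. As the degrees are prime to the
    characteristic, [U'], [V'], [f1'], [f2'] have degrees [n - 1], [m - 1], [m - 1],
    [n - 1]. These constraints leave few possibilities ([ramification_types]):
    - [U] or [V] has a single root over some value. Then [f2] or [f1] is a translate
      of a power ([power_of_single]).
    - There are two critical values, over which all points are double except one
      or two. Then [f1] and [f2] satisfy a Pell equation with the same
      quadratic polynomial, so they are Dickson polynomials
      ([lucas_of_dickson_type]).
    - All ramification lies over one value, where all points but one of [U] and one of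
      [V] are wild. There are then points [x0], [u0] with [(x - x0) f1' = m (f1 - u0)]
      ([euler_equation]) and similarly for [f2]. Comparing expansions at a point shows
      that all wild indices are [2] ([wild_index_le2]), so that the characteristic is
      [2]. Here [f1 - u0] is [(x - x0) H ^ 2] where [H] satisfies a Riccati equation,
      which becomes a Pell equation with Dickson polynomials as only solutions
      ([lucas_of_wild_pair]).

    If [f2] is a power of [x], comparing the coefficients of [U \Po f1 = V \Po x ^ n]
    shows that, up to a constant, all exponents of [f1] are congruent to [m] modulo [n]
    ([cyclic_support]). The parameters of these normal forms are read off
    coefficients, hence lie in [K] ([coprime_shapes]). An algebraic closure is needed
    only of the countable subfield generated by the coefficients of all polynomials
    involved ([countable_subfield]).

    Conversely, powers [x ^ n] and [x ^ r P(x ^ n)] have a common composite, and Dickson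
    polynomials commute up to a change of parameter ([dickson_comp]). *)

Set Implicit Arguments.
Unset Strict Implicit.
Unset Printing Implicit Defensive.

Import GRing.Theory.

(** * Combinatorics of ramification *)

Lemma half_of_proper_gcd a b : (0 < b)%N -> ~~ (b %| a) -> b <= 2 * (b - gcdn a b).
Proof.
move=> b0 nd; have /dvdnP[q eq] := dvdn_gcdr a b.
have g0 : 0 < gcdn a b by rewrite gcdn_gt0 b0 orbT.
have q1 : q != 1.
  apply: contra nd => /eqP q1; rewrite eq q1 mul1n; exact: dvdn_gcdl.
move: eq g0 q1; move: (gcdn a b) => g; case: q => [|[|q]] //= eq; nia.
Qed.

Lemma gcd_gap a b : 1 < a -> 1 < b -> a != b -> 2 * gcdn a b + 2 <= a + b.
Proof.
move=> a1 b1 ne.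
have /dvdnP[p ep] := dvdn_gcdl a b; have /dvdnP[q eq] := dvdn_gcdr a b.
have g0 : 0 < gcdn a b by rewrite gcdn_gt0 (ltnW a1).
move: ep eq g0; move: (gcdn a b) => g ep eq g0.
have : p != q by apply: contra ne => /eqP e; rewrite ep eq e.
case: p ep => [|p] ep; first by move: a1; rewrite ep.
case: q eq => [|q] eq; first by move: b1; rewrite eq.
by move=> npq; have [->|g1] := eqVneq g 1; nia.
Qed.

(** Were the sum smaller, the only possible divisors would force
    [f0 %| e0 %| fv %| ew]. *)
Lemma gcd_budget e0 f0 ew fv : 0 < e0 -> 0 < f0 -> 0 < fv -> 1 < gcdn e0 f0 ->
  ~~ (f0 %| ew) ->
  gcdn e0 f0 <= (e0 - gcdn e0 fv) + (f0 - gcdn ew f0) + (fv - gcdn ew fv).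
Proof.
move=> e0_gt0 f0_gt0 fv_gt0 g2 nd; rewrite leqNgt; apply/negP => tot.
have h1 := half_of_proper_gcd f0_gt0 nd.
have fg : f0 = gcdn e0 f0.
  have /dvdnP[q eq] := dvdn_gcdr e0 f0; move: tot h1 g2 eq.
  move: (e0 - _) (fv - _) (gcdn ew f0) (gcdn e0 f0) f0_gt0; clear.
  by move=> x y z g; case: q => [|[|q]]; nia.
have df : f0 %| e0 by rewrite fg dvdn_gcdl.
have le := dvdn_leq e0_gt0 df.
have [dev|nev] := boolP (e0 %| fv); last first.
  have := half_of_proper_gcd e0_gt0 nev; rewrite gcdnC; move: tot h1 le; rewrite -fg.
  by move: (gcdn e0 fv) (gcdn ew f0) (fv - _) g2; rewrite -fg; clear; lia.
have nfw : ~~ (fv %| ew).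
  by apply: contra nd; apply: dvdn_trans; apply: dvdn_trans dev.
have := half_of_proper_gcd fv_gt0 nfw; have := dvdn_leq fv_gt0 dev.
move: tot h1 le g2; rewrite -fg.
by move: (gcdn ew fv) (gcdn ew f0) (e0 - gcdn e0 fv); clear; lia.
Qed.

Lemma leq_gcdl a b : 0 < a -> gcdn a b <= a.
Proof. by move=> a0; apply: dvdn_leq (dvdn_gcdl a b). Qed.

Lemma leq_gcdr a b : 0 < b -> gcdn a b <= b.
Proof. by move=> b0; apply: dvdn_leq (dvdn_gcdr a b). Qed.

Lemma leq_sum_seq_in (T : eqType) (s : seq T) (F G : T -> nat) :
  {in s, forall x, F x <= G x} -> \sum_(x <- s) F x <= \sum_(x <- s) G x.
Proof.
move=> h; rewrite big_seq [leqRHS]big_seq; apply: leq_sum => x xs; exact: h.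
Qed.

Lemma sum_const_seq (T : eqType) (s : seq T) c : \sum_(x <- s) c = size s * c.
Proof. by rewrite big_const_seq count_predT iter_addn_0 mulnC. Qed.

Lemma leq_sum_seq1 (T : eqType) (s : seq T) (F : T -> nat) x : x \in s ->
  F x <= \sum_(y <- s) F y.
Proof.
elim: s => // y s IH; rewrite inE big_cons => /orP[/eqP ->|/IH h].
  exact: leq_addr.
by apply: leq_trans h _; apply: leq_addl.
Qed.

(** The ramification of [U] and [V] over one critical value: [e u], [f v] are the
    multiplicities of the points, [d u], [g v] the multiplicities of the derivatives
    there, [c u v] and [c' u v] the total multiplicities of the derivatives of [f2]
    and [f1] at the points over [(u, v)], of which there are at most
    [gcdn (e u) (f v)]; [X] and [Y] count the ramification of [U] and [V] over the
    other critical values. The balance [rp_bal] is the chain rule for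
    [U \Po f1 = V \Po f2]. In [rp_sumc], the term [(m - 2 * Y) * X] comes from the
    other critical values: [V] has at least [m - 2 * Y] simple points over each, and
    above a simple point [f2] inherits the ramification of [U]. *)
Record ramified_pair (T1 T2 : eqType) (n m : nat) (RU : seq T1) (RV : seq T2)
    (e d : T1 -> nat) (f g : T2 -> nat) (c c' : T1 -> T2 -> nat) (X Y : nat) : Prop :=
  RamifiedPair {
    rp_uniqU : uniq RU; rp_uniqV : uniq RV;
    rp_sume : \sum_(u <- RU) e u = n; rp_sumf : \sum_(v <- RV) f v = m;
    rp_e : {in RU, forall u, [/\ 0 < e u, e u <= (d u).+1 & e u = 1 -> d u = 0]};
    rp_f : {in RV, forall v, [/\ 0 < f v, f v <= (g v).+1 & f v = 1 -> g v = 0]};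
    rp_c : {in RU & RV, forall u v, e u <= c u v + gcdn (e u) (f v)};
    rp_c' : {in RU & RV, forall u v, f v <= c' u v + gcdn (e u) (f v)};
    rp_bal : {in RU & RV, forall u v, c' u v + f v * d u = c u v + e u * g v};
    rp_d : \sum_(u <- RU) d u + X + 1 = n; rp_g : \sum_(v <- RV) g v + Y + 1 = m;
    rp_X : 2 * X + 2 <= n; rp_Y : 2 * Y + 2 <= m;
    rp_sumc : \sum_(u <- RU) \sum_(v <- RV) c u v + (m - 2 * Y) * X + 1 <= n;
    rp_sumc' : \sum_(u <- RU) \sum_(v <- RV) c' u v + (n - 2 * X) * Y + 1 <= m }.

Lemma ramified_pair_sym T1 T2 n m RU RV e d f g c c' X Y :
  @ramified_pair T1 T2 n m RU RV e d f g c c' X Y ->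
  ramified_pair m n RV RU f g e d (fun v u => c' u v) (fun v u => c u v) Y X.
Proof.
case=> *; split=> //.
- by move=> v u hv hu; rewrite gcdnC; auto.
- by move=> v u hv hu; rewrite gcdnC; auto.
- by move=> v u hv hu; symmetry; auto.
- by rewrite exchange_big.
- by rewrite exchange_big.
Qed.

Definition tame_pts (T : eqType) (e d : T -> nat) (s : seq T) :=
  [seq u <- s | e u == (d u).+1].
Definition wild_pts (T : eqType) (e d : T -> nat) (s : seq T) :=
  [seq u <- s | e u != (d u).+1].

Section OneValue.
Variables (T1 T2 : eqType) (n m : nat) (RU : seq T1) (RV : seq T2).
Variables (e d : T1 -> nat) (f g : T2 -> nat) (c c' : T1 -> T2 -> nat) (X Y : nat).
Hypothesis H : ramified_pair n m RU RV e d f g c c' X Y.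
Let Hs := ramified_pair_sym H.
(* The points are split into tame (t) and wild (w) ones; [kap] is the excess of the
   derivative at the wild points, [Gam] bounds the number of points over tame pairs. *)
Local Notation tU := (tame_pts e d RU).
Local Notation wU := (wild_pts e d RU).
Local Notation tV := (tame_pts f g RV).
Local Notation wV := (wild_pts f g RV).
Local Notation G u v := (gcdn (e u) (f v)).
Local Notation a := (size tU).
Local Notation b := (size tV).
Local Notation nt := (\sum_(u <- tU) e u).
Local Notation mt := (\sum_(v <- tV) f v).
Local Notation E := (\sum_(u <- wU) e u).
Local Notation kap := (\sum_(u <- wU) (d u - e u)).
Local Notation Gam := (\sum_(u <- tU) \sum_(v <- tV) G u v).
Local Notation Rwt := (\sum_(u <- wU) \sum_(v <- tV) (f v - G u v)).
Local Notation Ptw := (\sum_(u <- tU) \sum_(v <- wV) (e u - G u v)).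
Local Notation Pww := (\sum_(u <- wU) \sum_(v <- wV) (e u - G u v)).
Local Notation A := (\sum_(u <- RU) \sum_(v <- RV) c u v).

Lemma split_tame (T : eqType) (p q w : T -> nat) s :
  \sum_(u <- s) w u = \sum_(u <- tame_pts p q s) w u + \sum_(u <- wild_pts p q s) w u.
Proof. by rewrite !big_filter [LHS](bigID (fun u => p u == (q u).+1)). Qed.

Lemma tU_P u : u \in tU -> u \in RU /\ e u = (d u).+1.
Proof. by rewrite mem_filter => /andP[/eqP]. Qed.

Lemma tV_P v : v \in tV -> v \in RV /\ f v = (g v).+1.
Proof. by rewrite mem_filter => /andP[/eqP]. Qed.

Lemma wU_P u : u \in wU -> [/\ u \in RU, e u <= d u & 1 < e u].
Proof.
rewrite mem_filter => /andP[ne uR]; have [e0 e1 e2] := rp_e H uR.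
split=> //; first by move: ne e1; lia.
rewrite ltn_neqAle e0 andbT eq_sym; apply/eqP => e3.
by move: ne; rewrite (e2 e3) e3.
Qed.

Lemma wV_P v : v \in wV -> [/\ v \in RV, f v <= g v & 1 < f v].
Proof.
rewrite mem_filter => /andP[ne uR]; have [e0 e1 e2] := rp_f H uR.
split=> //; first by move: ne e1; lia.
rewrite ltn_neqAle e0 andbT eq_sym; apply/eqP => e3.
by move: ne; rewrite (e2 e3) e3.
Qed.

Lemma n_split : n = nt + E. Proof. by rewrite -(rp_sume H) -split_tame. Qed.

(** The multiplicities sum to the degree and those of the derivative to the degree
    minus one, so a wild excess requires more tame points. *)
Lemma a_eq : a = X + kap + 1.
Proof.
have := rp_d H; rewrite n_split (split_tame e d).
have -> : \sum_(u <- wU) d u = E + kap.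
  rewrite -big_split /= !big_seq; apply: eq_bigr => u /wU_P[_ le _].
  by rewrite subnKC.
have : \sum_(u <- tU) d u + a = nt.
  rewrite -[size tU]muln1 -sum_const_seq -big_split /= !big_seq.
  by apply: eq_bigr => u /tU_P[_ ->]; rewrite addn1.
lia.
Qed.

(** The sum of a lower bound of each [c u v]. For [u] wild and [v] tame, the balance
    improves on [rp_c] and gives [e u + (d u - e u) * f v + (f v - G u v)]. *)
Lemma tame_bound : b * nt + b * E + kap * mt + Rwt + Ptw + Pww <= A + Gam.
Proof.
rewrite [A](split_tame e d).
have -> : \sum_(u <- tU) \sum_(v <- RV) c u v =
  \sum_(u <- tU) \sum_(v <- tV) c u v + \sum_(u <- tU) \sum_(v <- wV) c u v.
  by rewrite -big_split; apply: eq_bigr => u _; rewrite (split_tame f g).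
have -> : \sum_(u <- wU) \sum_(v <- RV) c u v =
  \sum_(u <- wU) \sum_(v <- tV) c u v + \sum_(u <- wU) \sum_(v <- wV) c u v.
  by rewrite -big_split; apply: eq_bigr => u _; rewrite (split_tame f g).
have h1 : b * nt <= \sum_(u <- tU) \sum_(v <- tV) c u v + Gam.
  rewrite mulnC big_distrl /= -big_split /=; apply: leq_sum_seq_in => u uT.
  rewrite mulnC -sum_const_seq -big_split /=; apply: leq_sum_seq_in => v vT.
  by apply: (rp_c H); [case: (tU_P uT)|case: (tV_P vT)].
have h2 : Ptw <= \sum_(u <- tU) \sum_(v <- wV) c u v.
  apply: leq_sum_seq_in => u uT; apply: leq_sum_seq_in => v vT.
  by rewrite leq_subLR addnC; apply: (rp_c H); [case: (tU_P uT)|case: (wV_P vT)].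
have h3 : Pww <= \sum_(u <- wU) \sum_(v <- wV) c u v.
  apply: leq_sum_seq_in => u uT; apply: leq_sum_seq_in => v vT.
  by rewrite leq_subLR addnC; apply: (rp_c H); [case: (wU_P uT)|case: (wV_P vT)].
have h4 : b * E + kap * mt + Rwt <= \sum_(u <- wU) \sum_(v <- tV) c u v.
  rewrite mulnC !big_distrl /= -!big_split /=; apply: leq_sum_seq_in => u uW.
  rewrite mulnC -sum_const_seq big_distrr /= -!big_split /=; apply: leq_sum_seq_in => v vT.
  have [uR le _] := wU_P uW; have [vR ev] := tV_P vT.
  have := rp_bal H uR vR; have := rp_c' H uR vR; rewrite ev.
  by move: (gcdn _ _) (c u v) (c' u v) le => x y z; move: (d u) (e u) (g v) => p q r; nia.
lia.
Qed.

Lemma size_split_tame (T : eqType) (p q : T -> nat) s :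
  size s = size (tame_pts p q s) + size (wild_pts p q s).
Proof. by rewrite !size_filter -(count_predC (fun u => p u == (q u).+1)). Qed.

Lemma wild_nonempty : wU != [::] -> 1 < E.
Proof.
case Ew : wU => [|w s] // _; rewrite -Ew.
have wW : w \in wU by rewrite Ew inE eqxx.
by have [_ _ w1] := wU_P wW; apply: leq_trans w1 (leq_sum_seq1 e wW).
Qed.

(** The conclusion of the count over one critical value: [U] or [V] has a single
    root there, or each has a single tame one, with coprime multiplicities, and the
    derivative vanishes at every wild one exactly to the order of [U] or [V]. *)
Definition pure_or_wild : Prop :=
  [\/ size RU = 1, size RV = 1 |
   [/\ X = 0, Y = 0 & exists u0 v0, [/\ u0 \in RU, v0 \in RV,
     e u0 = (d u0).+1 /\ {in RU, forall u, u != u0 -> d u = e u},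
     f v0 = (g v0).+1 /\ {in RV, forall v, v != v0 -> g v = f v} &
     coprime (e u0) (f v0)]]].

Lemma single_tame : a = 1 -> exists2 u0, tU = [:: u0] &
  u0 \in RU /\ e u0 = (d u0).+1 /\ (X = 0 -> {in RU, forall u, u != u0 -> d u = e u}).
Proof.
move=> a1; case Et : tU a1 => [|u0 [|]] // _; exists u0 => //.
have [u0R eu0] : u0 \in RU /\ e u0 = (d u0).+1 by apply: tU_P; rewrite Et inE.
split=> //; split=> // X0 u uR ne.
have uW : u \in wU.
  rewrite mem_filter uR andbT; apply: contra ne => /eqP eu.
  by have : u \in tU; [rewrite mem_filter eu eqxx | rewrite Et inE].
have := a_eq; rewrite Et X0 /= => k0.
have [_ le _] := wU_P uW.
have := leq_sum_seq1 (fun u => d u - e u) uW; lia.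
Qed.

End OneValue.

Section OneValueBounds.
Variables (T1 T2 : eqType) (n m : nat) (RU : seq T1) (RV : seq T2).
Variables (e d : T1 -> nat) (f g : T2 -> nat) (c c' : T1 -> T2 -> nat) (X Y : nat).
Hypothesis H : ramified_pair n m RU RV e d f g c c' X Y.
Let Hs := ramified_pair_sym H.
Local Notation tU := (tame_pts e d RU).
Local Notation wU := (wild_pts e d RU).
Local Notation tV := (tame_pts f g RV).
Local Notation wV := (wild_pts f g RV).
Local Notation G u v := (gcdn (e u) (f v)).
Local Notation a := (size tU).
Local Notation b := (size tV).
Local Notation nt := (\sum_(u <- tU) e u).
Local Notation mt := (\sum_(v <- tV) f v).
Local Notation E := (\sum_(u <- wU) e u).
Local Notation F := (\sum_(v <- wV) f v).
Local Notation kap := (\sum_(u <- wU) (d u - e u)).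
Local Notation kap' := (\sum_(v <- wV) (g v - f v)).
Local Notation Gam := (\sum_(u <- tU) \sum_(v <- tV) G u v).
Local Notation Rwt := (\sum_(u <- wU) \sum_(v <- tV) (f v - G u v)).
Local Notation Ptw := (\sum_(u <- tU) \sum_(v <- wV) (e u - G u v)).
Local Notation Pww := (\sum_(u <- wU) \sum_(v <- wV) (e u - G u v)).
Local Notation A := (\sum_(u <- RU) \sum_(v <- RV) c u v).
Local Notation B := (\sum_(u <- RU) \sum_(v <- RV) c' u v).

Lemma tame_bound_sym : a * mt + a * F + kap' * nt +
  \sum_(v <- wV) \sum_(u <- tU) (e u - G u v) +
  \sum_(v <- tV) \sum_(u <- wU) (f v - G u v) +
  \sum_(v <- wV) \sum_(u <- wU) (f v - G u v) <= B + Gam.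
Proof.
have := tame_bound Hs; rewrite [X in _ <= X + _]exchange_big /=.
have q0 : \sum_(v <- tV) \sum_(u <- tU) gcdn (f v) (e u) = Gam.
  by rewrite exchange_big; apply: eq_bigr => u _; apply: eq_bigr => v _; apply: gcdnC.
have q1 : \sum_(v <- wV) \sum_(u <- tU) (e u - gcdn (f v) (e u)) =
    \sum_(v <- wV) \sum_(u <- tU) (e u - G u v).
  by apply: eq_bigr => v _; apply: eq_bigr => u _; rewrite gcdnC.
have q2 : \sum_(v <- tV) \sum_(u <- wU) (f v - gcdn (f v) (e u)) =
    \sum_(v <- tV) \sum_(u <- wU) (f v - G u v).
  by apply: eq_bigr => v _; apply: eq_bigr => u _; rewrite gcdnC.
have q3 : \sum_(v <- wV) \sum_(u <- wU) (f v - gcdn (f v) (e u)) =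
    \sum_(v <- wV) \sum_(u <- wU) (f v - G u v).
  by apply: eq_bigr => v _; apply: eq_bigr => u _; rewrite gcdnC.
by rewrite q0 q1 q2 q3.
Qed.

Lemma pure_or_wild_single : a = 1 -> b = 1 ->
  {in tU & tV, forall u v, coprime (e u) (f v)} ->
  pure_or_wild RU RV e d f g X Y.
Proof.
move=> a1 b1 co; have [u0 Eu [u0R [eu0 hu]]] := single_tame H a1.
have [v0 Ev [v0R [ev0 hv]]] := single_tame Hs b1.
have := a_eq H; have := a_eq Hs; rewrite a1 b1 => ky kx.
apply: Or33; split; [lia|lia|]; exists u0, v0; split=> //.
- by split=> //; apply: hu; lia.
- by split=> //; apply: hv; lia.
- by apply: co; rewrite ?Eu ?Ev inE.
Qed.

Lemma no_wild_X0 : X = 0 -> wU = [::] -> size RU = 1.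
Proof.
by move=> X0 w0; rewrite (size_split_tame e d) (a_eq H) w0 X0 big_nil.
Qed.

(** The points above a simple point of [V] already exhaust the degree of the
    derivative of [f2], so all other contributions [c u v] vanish. *)
Lemma simple_point v1 : v1 \in RV -> f v1 = 1 -> pure_or_wild RU RV e d f g X Y.
Proof.
move=> v1R fv1; have gv1 : g v1 = 0 by have [_ _] := rp_f H v1R; apply.
have cv1 : {in RU, forall u, d u <= c u v1}.
  by move=> u uR; have := rp_bal H uR v1R; rewrite fv1 gv1; lia.
have spl : A = \sum_(u <- RU) c u v1 + \sum_(u <- RU) \sum_(v <- RV | v != v1) c u v.
  by rewrite -big_split; apply: eq_bigr => u _; rewrite (bigD1_seq v1) ?(rp_uniqV H).
have le1 : \sum_(u <- RU) d u <= \sum_(u <- RU) c u v1 by apply: leq_sum_seq_in.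
have hA := rp_sumc H; have hd := rp_d H; rewrite spl in hA.
have hY := rp_Y H; have mu : 2 <= m - 2 * Y by lia.
have X0 : X = 0 by move: mu hA; move: (m - 2 * Y) => mu *; nia.
have c0 : {in RU & RV, forall u v, v != v1 -> c u v = 0}.
  move=> u v uR vR ne.
  have s0 : \sum_(u <- RU) \sum_(v <- RV | v != v1) c u v = 0 by lia.
  have := leq_sum_seq1 (fun u => \sum_(v <- RV | v != v1) c u v) uR; rewrite s0 leqn0.
  rewrite -big_filter => /eqP s1.
  have := @leq_sum_seq1 _ [seq v <- RV | v != v1] (c u) v.
  by rewrite s1 mem_filter ne vR => /(_ isT); rewrite leqn0 => /eqP.
have [w0|] := eqVneq wU [::]; first by apply: Or31; apply: no_wild_X0.
case Ew : wU => [|w ws] // _; have wW : w \in wU by rewrite Ew inE eqxx.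
have [wR wd w1] := wU_P H wW.
have tV1 : tV = [:: v1].
  have v1T : v1 \in tV by rewrite mem_filter v1R fv1 gv1 eqxx.
  have all1 v : v \in tV -> v = v1.
    move=> vT; apply/eqP; apply: contraTT isT => ne; have [vR fv] := tV_P vT.
    have := rp_bal H wR vR; rewrite (c0 _ _ wR vR ne) fv.
    by move: (c' w v) w1 wd; move: (d w) (e w) (g v); nia.
  have uT : uniq tV by apply: filter_uniq; apply: rp_uniqV H.
  case Et : tV v1T uT all1 => [|x [|y s]] // ; rewrite ?inE.
    by move=> /eqP ->.
  move=> _ /andP[+ _] al; rewrite inE (al x) ?inE ?eqxx // (al y) ?inE ?eqxx ?orbT //.
have := a_eq Hs; rewrite tV1 /= => kY.
have bd := tame_bound_sym; have hB := rp_sumc' H.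
have Y0 : Y = 0 by lia.
rewrite Y0 muln0 addn0 in hB.
have G1 : Gam = a.
  rewrite -[RHS]muln1 -sum_const_seq; apply: eq_bigr => u _.
  by rewrite tV1 big_seq1 fv1 gcdn1.
have mF : m = 1 + F by rewrite (n_split Hs) tV1 big_seq1 fv1.
have a1 : a = 1.
  have F0 : 0 < F by have := rp_Y H; rewrite mF Y0; lia.
  have := a_eq H; rewrite X0.
  by move: bd; rewrite G1 tV1 big_seq1 fv1; move: hB; rewrite mF; nia.
apply: pure_or_wild_single; rewrite ?tV1 //.
by move=> u v _; rewrite inE => /eqP ->; rewrite fv1 coprimen1.
Qed.

Lemma sum_pairs_two (w : T1 -> T2 -> nat) u v u' v' :
  u \in tU -> v \in tV -> u' \in tU -> v' \in tV -> (u, v) != (u', v') ->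
  w u v + w u' v' <= \sum_(x <- tU) \sum_(y <- tV) w x y.
Proof.
move=> uT vT u'T v'T ne.
have uq : uniq [seq (x, y) | x <- tU, y <- tV].
  apply: allpairs_uniq; [apply: filter_uniq; exact: rp_uniqU H| |].
    apply: filter_uniq; exact: rp_uniqV H.
  by move=> [x y] [x' y'] _ _ [-> ->].
have -> : \sum_(x <- tU) \sum_(y <- tV) w x y =
   \sum_(p <- [seq (x, y) | x <- tU, y <- tV]) w p.1 p.2 by rewrite big_allpairs.
rewrite (bigD1_seq (u, v)) //=; last by apply: allpairs_f.
rewrite leq_add2l -big_filter.
apply: (leq_sum_seq1 (fun p => w p.1 p.2) (x := (u', v'))).
by rewrite mem_filter eq_sym ne; apply: allpairs_f.
Qed.

Hypothesis no_simpleU : {in RU, forall u, 1 < e u}.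
Hypothesis no_simpleV : {in RV, forall v, 1 < f v}.

(** [tame_bound] when all multiplicities are at least two. As [2 * G u v <= e u + f v],
    the greatest common divisors are almost as large as possible. *)
Lemma gcd_count : 1 < a -> 1 < b ->
  \sum_(u <- tU) \sum_(v <- tV) (e u + f v) + 2 * E * (b - 1) <= 2 * Gam + 2.
Proof.
move=> a2 b2.
have -> : \sum_(u <- tU) \sum_(v <- tV) (e u + f v) = b * nt + a * mt.
  under eq_bigr do rewrite big_split /= sum_const_seq.
  by rewrite big_split /= sum_const_seq -big_distrr.
have n2 : 2 * a <= nt.
  rewrite mulnC -sum_const_seq; apply: leq_sum_seq_in => u uT.
  by apply: no_simpleU; case: (tU_P uT).
have m2 : 2 * b <= mt.
  rewrite mulnC -sum_const_seq; apply: leq_sum_seq_in => u uT.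
  by apply: no_simpleV; case: (tV_P uT).
have bd := tame_bound H; have hA := rp_sumc H; have ha := a_eq H; have hb := a_eq Hs.
have en := n_split H; have em := n_split Hs.
have hY := rp_Y H.
move: bd hA ha hb en em hY n2 m2 a2 b2.
move: Gam A E mt nt F kap (\sum_(v <- wV) (g v - f v)) Rwt Ptw Pww.
move: a b => p q Ga S E M N F k l R1 R2 R3 bd hA ha hb en em hY n2 m2 a2 b2.
have [mu emu] : exists mu, m - 2 * Y = mu by exists (m - 2 * Y).
have mu1 : M - 2 * q + 2 <= mu by lia.
have mu2 : 2 <= M - 2 * q + 2 by lia.
have h1 : (p - 1) * (M - 2 * q + 2) <= k * M + mu * X.
  have -> : p - 1 = k + X by lia.
  rewrite mulnDl leq_add //; first by rewrite leq_mul2l; apply/orP; right; lia.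
  by rewrite mulnC leq_mul2r mu1 orbT.
rewrite emu in hA.
have h2 : q * N + q * E + (p - 1) * (M - 2 * q + 2) + 1 <= N + E + Ga by lia.
have [p' ep] : exists p', p = p'.+2 by exists (p - 2); lia.
have [q' eq] : exists q', q = q'.+2 by exists (q - 2); lia.
have [N' eN] : exists N', N = 2 * p + N' by exists (N - 2 * p); lia.
have [M' eM] : exists M', M = 2 * q + M' by exists (M - 2 * q); lia.
have e1 : M - 2 * q + 2 = M' + 2 by lia.
rewrite e1 in h2; clear -h2 ep eq eN eM; subst N M; subst p q.
rewrite !(_ : forall x, x.+2 - 1 = x.+1) in h2 *; try by move=> x; lia.
nia.
Qed.

Lemma gcd_count_wild : 1 < a -> 1 < b -> wU = [::].
Proof.
move=> a2 b2; have := gcd_count a2 b2.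
have le : 2 * Gam <= \sum_(u <- tU) \sum_(v <- tV) (e u + f v).
  rewrite big_distrr /=; apply: leq_sum_seq_in => u uT; rewrite big_distrr /=.
  apply: leq_sum_seq_in => v vT; have [uR _] := tU_P uT; have [vR _] := tV_P vT.
  have := leq_gcdl (f v) (ltnW (no_simpleU uR)); have := leq_gcdr (e u) (ltnW (no_simpleV vR)).
  lia.
move: le; have [//|/(wild_nonempty H)] := eqVneq wU [::].
by move: b2 E; case: (b) => [|[|q]] // _ x; nia.
Qed.

(** The bounds force [E < G u0 v] for every tame [v], where [E] is the total wild
    multiplicity; then [f v] divides no wild [e u], and each such pair costs at least
    [f v / 2] in the derivative of [f1], which is too much. *)
Lemma one_tame_many : a = 1 -> 1 < b -> wU != [::] -> False.
Proof.
move=> a1 b2 wN; have [u0 Eu _] := single_tame H a1.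
have E1 := wild_nonempty H wN.
have u0T : u0 \in tU by rewrite Eu inE.
have [u0R _] := tU_P u0T.
have bd := tame_bound H; have bd' := tame_bound_sym.
have hA := rp_sumc H; have hB := rp_sumc' H.
have ha := a_eq H; have hb := a_eq Hs.
have en := n_split H; have em := n_split Hs.
rewrite a1 in ha bd'.
have X0 : X = 0 by lia.
have k0 : kap = 0 by lia.
have eG : Gam = \sum_(v <- tV) G u0 v by rewrite Eu big_seq1.
have eN : nt = e u0 by rewrite Eu big_seq1.
have gle v : v \in tV -> G u0 v <= e u0.
  by move=> _; apply: leq_gcdl; exact: ltnW (no_simpleU u0R).
have hG1 : (b - 1) * n + 1 <= Gam.
  move: bd hA b2; rewrite k0 X0 en.
  by move: (b) Gam A nt E Rwt Ptw Pww => q; case: q => [|q] // *; rewrite subn1 /=; nia.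
have hgE v : v \in tV -> E < G u0 v.
  move=> vT; have uqV : uniq tV by apply: filter_uniq; apply: rp_uniqV H.
  move: hG1; rewrite eG (bigD1_seq v) //= -big_filter.
  have : \sum_(i <- [seq i <- tV | i != v]) G u0 i <= (b - 1) * e u0.
    have -> : b - 1 = size [seq i <- tV | i != v].
      by rewrite -rem_filter // size_rem // subn1.
    rewrite -sum_const_seq; apply: leq_sum_seq_in => i.
    by rewrite mem_filter => /andP[_ /gle].
  rewrite en eN; move: b2; move: (b) (\sum_(i <- [seq i <- tV | i != v]) _) (G u0 v) => q.
  case: q => [|[|q]] // s gg _; rewrite subn1 /= mulnDr.
  have : E <= q.+1 * E by rewrite leq_pmull.
  by move: (q.+1 * E) (q.+1 * e u0) E; clear; lia.
set R := \sum_(v <- tV) \sum_(u <- wU) (f v - G u v) in bd'.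
have hR : Gam <= 2 * R.
  rewrite eG /R big_distrr /=; apply: leq_sum_seq_in => v vT.
  case Ew : wU wN => [|w ws] // _.
  have wW : w \in wU by rewrite Ew inE eqxx.
  have [wR _ _] := wU_P H wW; have [vR _] := tV_P vT.
  rewrite -Ew; have := leq_sum_seq1 (fun u => f v - G u v) wW.
  have := leq_sum_seq1 e wW; have := hgE v vT; rewrite -?Ew.
  have gf : G u0 v <= f v by apply: leq_gcdr; exact: ltnW (no_simpleV vR).
  have nd : ~~ (f v %| e w).
    apply/negP => /dvdn_leq h; have := h (ltnW (no_simpleU wR)).
    have := leq_sum_seq1 e wW; have := hgE v vT; lia.
  have := half_of_proper_gcd (ltnW (no_simpleV vR)) nd; lia.
have hle : Gam <= b * e u0.
  by rewrite eG -sum_const_seq; apply: leq_sum_seq_in => v /gle.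
have ltn : e u0 <= n by rewrite en eN leq_addr.
rewrite eN in bd'.
move: bd' hB hR hle hb b2 ltn em; rewrite X0 muln0 subn0 !mul1n.
move: (b) Gam B mt F kap' R (e u0) (\sum_(_ <- wV) \sum_(_ <- tU) _) (\sum_(_ <- wV) \sum_(_ <- wU) _).
move=> q Ga S M F' l R' e0 s1 s2 bd1 hB1 hR1 hle1 hb1 b21 len em1.
have h1 : l * e0 + R' + n * Y + 1 <= Ga by lia.
have h2 : 2 * (l * e0) + 2 * (n * Y) + 2 <= q * e0 by lia.
have eq : q = Y + l + 1 by lia.
have h3 : e0 * Y <= n * Y by rewrite leq_mul2r len orbT.
have : e0 <= (Y + l) * e0 by rewrite leq_pmull //; lia.
by move: h2 h3; rewrite eq !mulnDl mul1n [e0 * Y]mulnC; clear; lia.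
Qed.

(** The three pairs [(u0, v)], [(w, v0)], [(w, v)] with a wild [v] must not exceed
    the budget that [gcd_budget] bounds from below. *)
Lemma wild_not_dvd u0 v0 w : tU = [:: u0] -> tV = [:: v0] -> wV != [::] ->
  w \in wU -> ~~ (f v0 %| e w) -> 1 < G u0 v0 -> False.
Proof.
move=> Eu Ev wN wW nd g2.
have bd := tame_bound_sym; have hB := rp_sumc' H; have em := n_split Hs.
rewrite Eu Ev !big_seq1 /= !mul1n in bd em.
case Ew : wV wN => [|v vs] // _; have vW : v \in wV by rewrite Ew inE eqxx.
have u0T : u0 \in tU by rewrite Eu inE.
have v0T : v0 \in tV by rewrite Ev inE.
have [vR _ _] := wU_P Hs vW; have [u0R _] := tU_P u0T; have [v0R _] := tU_P v0T.
have [e0 _ _] := rp_e H u0R; have [f0 _ _] := rp_f H v0R; have [fv0 _ _] := rp_f H vR.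
have s1 := leq_sum_seq1 (fun v => \sum_(u <- [:: u0]) (e u - G u v)) vW.
have s2 := leq_sum_seq1 (fun u => f v0 - G u v0) wW.
have s3 := leq_sum_seq1 (fun v => \sum_(u <- wU) (f v - G u v)) vW.
have s4 := leq_sum_seq1 (fun u => f v - G u v) wW.
rewrite /= big_seq1 in s1.
move: hB bd; move: ((n - 2 * X) * Y) (kap' * e u0) => P1 P2 hB bd.
have := gcd_budget e0 f0 fv0 g2 nd; lia.
Qed.

End OneValueBounds.

Section OneValueCases.
Variables (T1 T2 : eqType) (n m : nat) (RU : seq T1) (RV : seq T2).
Variables (e d : T1 -> nat) (f g : T2 -> nat) (c c' : T1 -> T2 -> nat) (X Y : nat).
Hypothesis H : ramified_pair n m RU RV e d f g c c' X Y.
Let Hs := ramified_pair_sym H.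
Local Notation tU := (tame_pts e d RU).
Local Notation wU := (wild_pts e d RU).
Local Notation tV := (tame_pts f g RV).
Local Notation wV := (wild_pts f g RV).
Local Notation G u v := (gcdn (e u) (f v)).
Local Notation a := (size tU).
Local Notation b := (size tV).
Local Notation Gam := (\sum_(u <- tU) \sum_(v <- tV) G u v).

Hypothesis no_simpleU : {in RU, forall u, 1 < e u}.
Hypothesis no_simpleV : {in RV, forall v, 1 < f v}.
Hypothesis co : coprime n m.

(** The sum over the pairs of tame points of [e u + f v - 2 * gcdn (e u) (f v)] is at
    most [2], and each term with [e u <> f v] is at least [2]. So at most one pair
    has distinct multiplicities, hence none, and the common multiplicity divides
    both degrees. *)
Lemma not_two_tame : 1 < a -> 1 < b -> False.
Proof.
move=> a2 b2; have cnt := gcd_count H no_simpleU no_simpleV a2 b2.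
have wU0 := gcd_count_wild H no_simpleU no_simpleV a2 b2.
have wV0 := gcd_count_wild Hs no_simpleV no_simpleU b2 a2.
pose w u v := e u + f v - 2 * G u v.
have wP u v : u \in tU -> v \in tV -> (2 * G u v <= e u + f v) /\ (e u != f v -> 2 <= w u v).
  move=> uT vT; have [uR _] := tU_P uT; have [vR _] := tV_P vT.
  have h1 := leq_gcdl (f v) (ltnW (no_simpleU uR)).
  have h2 := leq_gcdr (e u) (ltnW (no_simpleV vR)).
  split; first lia.
  move=> ne; have := gcd_gap (no_simpleU uR) (no_simpleV vR) ne; rewrite /w; lia.
have sw : \sum_(u <- tU) \sum_(v <- tV) w u v <= 2.
  have : \sum_(u <- tU) \sum_(v <- tV) w u v + 2 * Gam =
     \sum_(u <- tU) \sum_(v <- tV) (e u + f v).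
    rewrite big_distrr -big_split /=; rewrite !big_seq; apply: eq_bigr => u uT.
    rewrite big_distrr -big_split /=; rewrite !big_seq; apply: eq_bigr => v vT.
    by rewrite /w subnK //; case: (wP u v uT vT).
  move: cnt; rewrite wU0 big_nil; lia.
have eqp u v u' v' : u \in tU -> v \in tV -> u' \in tU -> v' \in tV -> (u, v) != (u', v') ->
    e u != f v -> e u' = f v'.
  move=> uT vT u'T v'T ne n1; apply/eqP; apply: contraTT isT => n2.
  have := sum_pairs_two H w uT vT u'T v'T ne.
  have := (wP u v uT vT).2 n1; have := (wP u' v' u'T v'T).2 n2; lia.
have ex (T : eqType) (s : seq T) (x : T) : uniq s -> 1 < size s -> exists2 y, y \in s & y != x.
  case: s => [|y [|z s]] //= /andP[nyz _] _; have [e1|ne] := eqVneq y x.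
    exists z; first by rewrite !inE eqxx orbT.
    by apply: contra nyz => /eqP ->; rewrite -e1 inE eqxx.
  by exists y; rewrite // inE eqxx.
have uqU : uniq tU by apply: filter_uniq; apply: rp_uniqU H.
have uqV : uniq tV by apply: filter_uniq; apply: rp_uniqV H.
have alleq u v : u \in tU -> v \in tV -> e u = f v.
  move=> uT vT; apply/eqP; apply: contraTT isT => ne.
  have [u' u'T nu] := ex _ _ u uqU a2; have [v' v'T nv] := ex _ _ v uqV b2.
  have e1 : e u = f v' by apply: (eqp u v) => //; rewrite xpair_eqE eqxx eq_sym.
  have e2 : e u' = f v by apply: (eqp u v) => //; rewrite xpair_eqE eqxx andbT eq_sym.
  have e3 : e u' = f v'.
    by apply: (eqp u v) => //; rewrite xpair_eqE [u == _]eq_sym (negPf nu).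
  by rewrite e1 -e3 e2 eqxx in ne.
case Et : tU a2 alleq => [|u0 s] // _ alleq.
case Ev : tV b2 alleq => [|v0 s'] // _ alleq.
have u0T : u0 \in tU by rewrite Et inE eqxx.
have v0T : v0 \in tV by rewrite Ev inE eqxx.
rewrite -Et -Ev in alleq.
have dn : f v0 %| n.
  rewrite (n_split H) wU0 big_nil addn0 big_seq; apply: dvdn_sum => u uT.
  by rewrite (alleq u v0).
have dm : f v0 %| m.
  rewrite (n_split Hs) wV0 big_nil addn0 big_seq; apply: dvdn_sum => v vT.
  by rewrite -(alleq u0 v) // (alleq u0 v0).
have : f v0 %| gcdn n m by rewrite dvdn_gcd dn dm.
rewrite (eqP co) dvdn1 => /eqP f1.
by have [vR _] := tV_P v0T; have := no_simpleV vR; rewrite f1.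
Qed.

Lemma one_tame : a = 1 -> pure_or_wild RU RV e d f g X Y.
Proof.
move=> a1; have ha := a_eq H; have hb := a_eq Hs; rewrite a1 in ha.
have X0 : X = 0 by lia.
have [w0|wN] := eqVneq wU [::]; first by apply: Or31; apply: (no_wild_X0 H).
have b1 : b = 1.
  apply/eqP; rewrite eqn_leq [1 <= _](_ : _ = true) ?andbT; last by rewrite hb addn1.
  rewrite leqNgt; apply/negP => b2.
  exact: (one_tame_many H no_simpleU no_simpleV a1 b2 wN).
rewrite b1 in hb; have Y0 : Y = 0 by lia.
have [w0|wN'] := eqVneq wV [::]; first by apply: Or32; apply: (no_wild_X0 Hs).
have [u0 Eu _] := single_tame H a1; have [v0 Ev _] := single_tame Hs b1.
apply: (pure_or_wild_single H) => // u v; rewrite Eu Ev !inE => /eqP -> /eqP ->.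
rewrite /coprime eqn_leq gcdn_gt0; apply/andP; split; last first.
  have u0T : u0 \in tU by rewrite Eu inE.
  by have [u0R _] := tU_P u0T; rewrite ltnW ?no_simpleU.
rewrite leqNgt; apply/negP => g2.
have du : {in wU, forall w, f v0 %| e w}.
  move=> w wW; apply: contraT => nd.
  by case: (wild_not_dvd H Eu Ev wN' wW nd g2).
have dv : {in wV, forall w, e u0 %| f w}.
  move=> w wW; apply: contraT => nd.
  by case: (wild_not_dvd Hs Ev Eu wN wW nd); rewrite gcdnC.
have : G u0 v0 %| gcdn n m.
  rewrite dvdn_gcd (n_split H) (n_split Hs) Eu Ev !big_seq1.
  rewrite !dvdn_addr ?dvdn_gcdl ?dvdn_gcdr //; apply/andP; split.
    rewrite big_seq; apply: dvdn_sum => w /du; apply: dvdn_trans; exact: dvdn_gcdr.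
  rewrite big_seq; apply: dvdn_sum => w /dv; apply: dvdn_trans; exact: dvdn_gcdl.
by rewrite (eqP co) dvdn1; move: g2; case: eqP => // ->.
Qed.

End OneValueCases.

Lemma pure_or_wild_sym (T1 T2 : eqType) (RU : seq T1) (RV : seq T2) e d f g X Y :
  pure_or_wild RU RV e d f g X Y -> pure_or_wild RV RU f g e d Y X.
Proof.
case=> [s1|s1|[X0 Y0 [u [v [uR vR hu hv cuv]]]]]; [exact: Or32|exact: Or31|].
by apply: Or33; split=> //; exists v, u; split=> //; rewrite coprime_sym.
Qed.

Theorem ramified_pair_pure_or_wild (T1 T2 : eqType) (n m : nat) (RU : seq T1)
    (RV : seq T2) e d f g c c' X Y :
  ramified_pair n m RU RV e d f g c c' X Y -> coprime n m ->
  pure_or_wild RU RV e d f g X Y.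
Proof.
move=> H co; have Hs := ramified_pair_sym H.
have [/hasP[v vR /eqP fv]|nV] := boolP (has (fun v => f v == 1) RV).
  exact: (simple_point H vR fv).
have [/hasP[u uR /eqP eu]|nU] := boolP (has (fun u => e u == 1) RU).
  by apply/pure_or_wild_sym/(simple_point Hs uR eu).
have noU : {in RU, forall u, 1 < e u}.
  move=> u uR; have [e0 _ _] := rp_e H uR; move/hasPn: nU => /(_ u uR); lia.
have noV : {in RV, forall u, 1 < f u}.
  move=> u uR; have [e0 _ _] := rp_f H uR; move/hasPn: nV => /(_ u uR); lia.
have ha := a_eq H; have hb := a_eq Hs.
have [a1|a1] := eqVneq (size (tame_pts e d RU)) 1; first exact: (one_tame H).
have [b1|b1] := eqVneq (size (tame_pts f g RV)) 1.
  by apply/pure_or_wild_sym/(one_tame Hs) => //; rewrite coprime_sym.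
by case: (not_two_tame H noU noV co); lia.
Qed.

(** The ramification of [U] and [V] over all their critical values, with the
    conventions of [ramified_pair]; [rm_d] and [rm_g] say that [U] and [V] have
    derivatives of degree [n - 1] and [m - 1]. *)
Record ramification (L T1 T2 : eqType) (n m : nat) (S : seq L)
    (RU : L -> seq T1) (RV : L -> seq T2)
    (e d : T1 -> nat) (f g : T2 -> nat) (c c' : T1 -> T2 -> nat) : Prop :=
  Ramification {
    rm_uniq : uniq S; rm_n : 1 < n; rm_m : 1 < m;
    rm_uniqU : {in S, forall l, uniq (RU l)}; rm_uniqV : {in S, forall l, uniq (RV l)};
    rm_sume : {in S, forall l, \sum_(u <- RU l) e u = n};
    rm_sumf : {in S, forall l, \sum_(v <- RV l) f v = m};
    rm_e : {in S, forall l, {in RU l, forall u, [/\ 0 < e u, e u <= (d u).+1 & e u = 1 -> d u = 0]}};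
    rm_f : {in S, forall l, {in RV l, forall v, [/\ 0 < f v, f v <= (g v).+1 & f v = 1 -> g v = 0]}};
    rm_c : {in S, forall l, {in RU l & RV l, forall u v, e u <= c u v + gcdn (e u) (f v)}};
    rm_c' : {in S, forall l, {in RU l & RV l, forall u v, f v <= c' u v + gcdn (e u) (f v)}};
    rm_bal : {in S, forall l, {in RU l & RV l, forall u v, c' u v + f v * d u = c u v + e u * g v}};
    rm_d : \sum_(l <- S) \sum_(u <- RU l) d u + 1 = n;
    rm_g : \sum_(l <- S) \sum_(v <- RV l) g v + 1 = m;
    rm_sumc : \sum_(l <- S) \sum_(u <- RU l) \sum_(v <- RV l) c u v + 1 <= n;
    rm_sumc' : \sum_(l <- S) \sum_(u <- RU l) \sum_(v <- RV l) c' u v + 1 <= m }.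

Lemma ramification_sym L T1 T2 n m S RU RV e d f g c c' :
  @ramification L T1 T2 n m S RU RV e d f g c c' ->
  ramification m n S RV RU f g e d (fun v u => c' u v) (fun v u => c u v).
Proof.
case=> uS n1 m1 uU uV se sf he hf hc hc' hb sd sg sc sc'; split=> //.
- by move=> l lS v u hv hu; rewrite gcdnC; apply: (hc' l).
- by move=> l lS v u hv hu; rewrite gcdnC; apply: (hc l).
- by move=> l lS v u hv hu; symmetry; apply: (hb l).
- by under eq_bigr do rewrite exchange_big.
- by under eq_bigr do rewrite exchange_big.
Qed.

Lemma leq_sum_seq_cond (T : eqType) (s : seq T) (P : pred T) (F G : T -> nat) :
  (forall x, x \in s -> P x -> F x <= G x) ->
  \sum_(x <- s | P x) F x <= \sum_(x <- s | P x) G x.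
Proof.
move=> h; rewrite big_seq_cond [leqRHS]big_seq_cond; apply: leq_sum => x /andP[xs Px].
exact: h.
Qed.

Lemma leq_sum_seq1_cond (T : eqType) (s : seq T) (P : pred T) (F : T -> nat) x :
  x \in s -> P x -> F x <= \sum_(y <- s | P y) F y.
Proof.
by move=> xs Px; rewrite -big_filter; apply: leq_sum_seq1; rewrite mem_filter Px.
Qed.

Lemma count_sum (T : eqType) (P : pred T) (s : seq T) :
  count P s = \sum_(u <- s) (if P u then 1 else 0).
Proof. by rewrite -sum1_count big_mkcond. Qed.

Section Global.
Variables (L T1 T2 : eqType) (n m : nat) (S : seq L).
Variables (RU : L -> seq T1) (RV : L -> seq T2).
Variables (e d : T1 -> nat) (f g : T2 -> nat) (c c' : T1 -> T2 -> nat).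
Hypothesis H : ramification n m S RU RV e d f g c c'.
Let Hs := ramification_sym H.

Local Notation xs l := (\sum_(u <- RU l) d u).
Local Notation M l := (count (fun u => e u == 1) (RU l)).
Local Notation N l := (count (fun v => f v == 1) (RV l)).
Local Notation A l := (\sum_(u <- RU l) \sum_(v <- RV l) c u v).

Lemma simple_bound l : l \in S -> n <= M l + 2 * xs l.
Proof.
move=> lS; rewrite -(rm_sume H lS) count_sum big_distrr -big_split /=.
apply: leq_sum_seq_in => u uR; have [] := rm_e H lS uR.
by case: eqP => [->|] //; lia.
Qed.

Lemma simple_bound_eq l : l \in S -> M l + 2 * xs l <= n ->
  {in RU l, forall u, e u = 1 \/ e u = 2 /\ d u = 1}.
Proof.
move=> lS; rewrite -(rm_sume H lS) count_sum big_distrr -big_split /=.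
move=> le u uR; have [e0 e1 e2] := rm_e H lS uR.
have tw v : v \in RU l -> e v <= (if e v == 1 then 1 else 0) + 2 * d v.
  by move=> /(rm_e H lS) []; case: eqP => [->|] //; lia.
have [->|ne] := eqVneq (e u) 1; first by left.
right; suff : (if e u == 1 then 1 else 0) + 2 * d u <= e u.
  by rewrite (negPf ne); lia.
rewrite leqNgt; apply/negP => lt.
move: le; rewrite (bigD1_seq u) ?(rm_uniqU H) //= [leqRHS](bigD1_seq u) ?(rm_uniqU H) //= => le.
have s2 : \sum_(i <- RU l | i != u) e i <=
    \sum_(i <- RU l | i != u) ((if e i == 1 then 1 else 0) + 2 * d i).
  by apply: leq_sum_seq_cond => v /tw.
by have := leq_trans (leq_add lt s2) le; rewrite addSn ltnn.
Qed.

(** Above a simple point of [V], [f2] inherits the ramification of [U]. *)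
Lemma c_bound l : l \in S -> N l * xs l <= A l.
Proof.
move=> lS; rewrite big_distrr /=; apply: leq_sum_seq_in => u uR.
rewrite count_sum big_distrl /=; apply: leq_sum_seq_in => v vR.
case: eqP => [fv|]; rewrite ?mul0n // mul1n.
have [_ _ /(_ fv) gv] := rm_f H lS vR.
by have := rm_bal H lS uR vR; rewrite fv gv; lia.
Qed.

Lemma c_bound_total : \sum_(l <- S) N l * xs l <= \sum_(l <- S) xs l.
Proof.
have := rm_sumc H; have := rm_d H.
have : \sum_(l <- S) N l * xs l <= \sum_(l <- S) A l.
  by apply: leq_sum_seq_in => l; apply: c_bound.
lia.
Qed.

Lemma unramified_simple l : l \in S -> xs l = 0 -> n <= M l.
Proof. by move=> lS x0; have := simple_bound lS; rewrite x0 muln0 addn0. Qed.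

Lemma quadratic_single l : l \in S -> n = 2 -> 0 < xs l -> size (RU l) = 1.
Proof.
move=> lS n2 x0.
have [u uR du] : exists2 u, u \in RU l & 0 < d u.
  apply/hasP; apply: contraTT x0; rewrite -all_predC => /allP h.
  by rewrite -leqNgt leqn0 big_seq big1 // => u /h /=; rewrite -leqNgt leqn0 => /eqP.
have e2 : 1 < e u.
  have [e0 _ e1] := rm_e H lS uR.
  rewrite ltn_neqAle e0 andbT eq_sym; apply/eqP => /e1 d0; by rewrite d0 in du.
have := rm_sume H lS; rewrite n2 (bigD1_seq u) ?(rm_uniqU H) //= -big_filter.
have : size [seq i <- RU l | i != u] <= \sum_(i <- [seq i <- RU l | i != u]) e i.
  rewrite -[size _]muln1 -sum_const_seq; apply: leq_sum_seq_in => v.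
  by rewrite mem_filter => /andP[_ vR]; have [] := rm_e H lS vR.
rewrite -rem_filter ?(rm_uniqU H) // size_rem //.
have : 0 < size (RU l) by case: (RU l) uR.
lia.
Qed.

(** The ramification of the Dickson polynomials [dickson n a] and [dickson m a] in
    odd or zero characteristic, [n] and [m] not both even: two critical values, with
    double points only, but for one or two simple ones. *)
Definition dickson_type : Prop := exists l1 l2, [/\ l1 \in S, l2 \in S, l1 != l2,
   [/\ N l1 = 1, N l2 = 1 & M l1 + M l2 = 2] &
   forall l, l = l1 \/ l = l2 ->
     {in RU l, forall u, e u = 1 \/ e u = 2 /\ d u = 1} /\
     {in RV l, forall v, f v = 1 \/ f v = 2 /\ g v = 1}].

End Global.

Section Global2.
Variables (L T1 T2 : eqType) (n m : nat) (S : seq L).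
Variables (RU : L -> seq T1) (RV : L -> seq T2).
Variables (e d : T1 -> nat) (f g : T2 -> nat) (c c' : T1 -> T2 -> nat).
Hypothesis H : ramification n m S RU RV e d f g c c'.
Let Hs := ramification_sym H.

Local Notation xs l := (\sum_(u <- RU l) d u).
Local Notation ys l := (\sum_(v <- RV l) g v).
Local Notation M l := (count (fun u => e u == 1) (RU l)).
Local Notation N l := (count (fun v => f v == 1) (RV l)).
Local Notation A l := (\sum_(u <- RU l) \sum_(v <- RV l) c u v).

(** If every value has a simple point of [V], every ramified value of [U] has just
    one; there are then at most two of them. *)
Lemma two_values : {in S, forall l, 2 * ys l < m} ->
  (exists2 l, l \in S & size (RU l) = 1) \/ dickson_type S RU RV e d f g.
Proof.
move=> hy.
have N1 l : l \in S -> 0 < N l.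
  by move=> lS; have := simple_bound Hs lS; have := hy l lS; lia.
have key l : l \in S -> 0 < xs l -> N l = 1.
  move=> lS x0; apply/eqP; rewrite eqn_leq N1 // andbT leqNgt; apply/negP => N2.
  have := c_bound_total H; rewrite leqNgt => /negP; apply.
  rewrite (bigD1_seq l) ?(rm_uniq H) //= [ltnRHS](bigD1_seq l) ?(rm_uniq H) //=.
  have s1 : \sum_(i <- S | i != l) xs i <= \sum_(i <- S | i != l) N i * xs i.
    by apply: leq_sum_seq_cond => i /N1 h _; rewrite leq_pmull.
  have s2 : xs l < N l * xs l by rewrite ltn_Pmull.
  lia.
have yk l : l \in S -> 0 < xs l -> 2 * ys l + 1 = m.
  move=> lS x0; have := simple_bound Hs lS; rewrite (key l lS x0).
  by have := hy l lS; lia.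
have [l1 l1S x1] : exists2 l, l \in S & 0 < xs l.
  apply/hasP; apply: contraTT (rm_n H); rewrite -all_predC => /allP h.
  rewrite -leqNgt -(rm_d H) big_seq big1 // => l /h /=.
  by rewrite -leqNgt leqn0 => /eqP.
have y1 := yk _ l1S x1.
have hM := c_bound_total Hs; have hg := rm_g H; have m1 := rm_m H.
have [/hasP[l2 l2S /andP[ne x2]]|no] := boolP (has (fun l => (l != l1) && (0 < xs l)) S).
  right; have y2 := yk _ l2S x2; exists l1, l2.
  have ne' : l1 != l2 by rewrite eq_sym.
  have l2S' : l2 \in [seq l <- S | l != l1] by rewrite mem_filter ne.
  have us : uniq [seq l <- S | l != l1] by apply: filter_uniq; apply: rm_uniq H.
  have split (w : L -> nat) : \sum_(l <- S) w l =
      w l1 + (w l2 + \sum_(l <- [seq l <- S | l != l1] | l != l2) w l).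
    rewrite (bigD1_seq l1) ?(rm_uniq H) //= -big_filter.
    by rewrite (bigD1_seq l2) ?us.
  have b1 := simple_bound H l1S; have b2 := simple_bound H l2S.
  have hd := rm_d H; rewrite split in hd.
  rewrite (split (fun l => ys l)) in hg.
  rewrite !(split (fun l => _)) /= in hM.
  have M2 : M l1 + M l2 <= 2.
    move: hM hg y1 y2 m1; move: (\sum_(_ <- _ | _) (_ * _)) => r1.
    move: (ys l1) (ys l2) (M l1) (M l2) => p q r s *.
    have epq : p = q by lia.
    subst q; have : (r + s) * p <= 2 * p by nia.
    rewrite leq_pmul2r //; lia.
  have eq1 : M l1 + 2 * xs l1 <= n by lia.
  have eq2 : M l2 + 2 * xs l2 <= n by lia.
  split=> //; first by split; [exact: key|exact: key|lia].
  move=> l [] ->; split.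
  - exact: (simple_bound_eq H).
  - by apply: (simple_bound_eq Hs) => //; rewrite key //; lia.
  - exact: (simple_bound_eq H).
  - by apply: (simple_bound_eq Hs) => //; rewrite key //; lia.
left; exists l1 => //; apply: (quadratic_single H) => //.
have x0 l : l \in S -> l != l1 -> xs l = 0.
  move=> lS ne; move/hasPn: no => /(_ l lS); rewrite ne /= -leqNgt leqn0 => /eqP //.
move: hM; rewrite (bigD1_seq l1) ?(rm_uniq H) //= => hM.
have h1 : n * \sum_(l <- S | l != l1) ys l <= \sum_(l <- S | l != l1) M l * ys l.
  rewrite big_distrr /=; apply: leq_sum_seq_cond => l lS ne.
  by rewrite leq_mul2r (unramified_simple H lS) ?orbT // x0.
move: hg hM; rewrite (bigD1_seq l1) ?(rm_uniq H) //=.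
have n1 := rm_n H; move: h1 y1 m1; move: (\sum_(_ <- _ | _) (_ * _)) => r1.
move: (\sum_(_ <- _ | _) _) (ys l1) (M l1) => p q r *.
have epq : p = q by lia.
subst q; have : n * p <= 2 * p by nia.
by rewrite leq_pmul2r //; lia.
Qed.

(** If [V] has few simple points over [l0] and [U] has few over [l0'], then
    [l0' = l0]: over a different value [V] would have many simple points. The
    contributions of the other values are estimated in the same way. *)
Lemma common_value l0 l0' : coprime n m -> l0 \in S -> l0' \in S ->
  m <= 2 * ys l0 -> n <= 2 * xs l0' ->
  pure_or_wild (RU l0) (RV l0) e d f g (n - 1 - xs l0) (m - 1 - ys l0).
Proof.
move=> co lS l'S hy hx.
have hd := rm_d H; have hg := rm_g H; have hA := rm_sumc H; have hB := rm_sumc' H.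
have NY l : l \in S -> l != l0 -> m - 2 * (m - 1 - ys l0) <= N l.
  move=> lS' ne; have := simple_bound Hs lS'.
  move: hg; rewrite (bigD1_seq l0) ?(rm_uniq H) //=.
  have := leq_sum_seq1_cond (P := fun i => i != l0) (fun l => ys l) lS' ne; lia.
have eql : l0' = l0.
  apply/eqP; apply: contraTT isT => ne.
  have := c_bound H l'S; have := NY l0' l'S ne; have h := leq_sum_seq1 (fun l => A l) l'S.
  have m2 : 2 <= m - 2 * (m - 1 - ys l0).
    by have := leq_sum_seq1 (fun l => ys l) lS; lia.
  move=> h1 h2; have : 2 * xs l0' <= N l0' * xs l0'.
    by rewrite leq_mul2r (leq_trans m2 h1) orbT.
  lia.
rewrite eql in hx.
have MX l : l \in S -> l != l0 -> n - 2 * (n - 1 - xs l0) <= M l.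
  move=> lS' ne; have := simple_bound H lS'.
  move: hd; rewrite (bigD1_seq l0) ?(rm_uniq H) //=.
  have := leq_sum_seq1_cond (P := fun i => i != l0) (fun l => xs l) lS' ne; lia.
apply: (ramified_pair_pure_or_wild (n := n) (m := m) (c := c) (c' := c')) => //.
have lx := leq_sum_seq1 (fun l => xs l) lS; have ly := leq_sum_seq1 (fun l => ys l) lS.
split; try by [apply: (rm_uniqU H) | apply: (rm_uniqV H) | apply: (rm_sume H)
  | apply: (rm_sumf H) | apply: (rm_e H) | apply: (rm_f H) | apply: (rm_c H)
  | apply: (rm_c' H) | apply: (rm_bal H) | lia].
- move: hA; rewrite (bigD1_seq l0) ?(rm_uniq H) //=.
  suff : (m - 2 * (m - 1 - ys l0)) * (n - 1 - xs l0) <= \sum_(i <- S | i != l0) A i by lia.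
  have -> : n - 1 - xs l0 = \sum_(i <- S | i != l0) xs i.
    by move: hd; rewrite (bigD1_seq l0) ?(rm_uniq H) //=; lia.
  rewrite big_distrr /=; apply: leq_sum_seq_cond => l lS' ne; apply: leq_trans (c_bound H lS').
  by rewrite leq_mul2r NY ?orbT.
- move: hB; rewrite (bigD1_seq l0) ?(rm_uniq H) //=.
  suff : (n - 2 * (n - 1 - xs l0)) * (m - 1 - ys l0) <=
     \sum_(i <- S | i != l0) \sum_(u <- RU i) \sum_(v <- RV i) c' u v by lia.
  have -> : m - 1 - ys l0 = \sum_(i <- S | i != l0) ys i.
    by move: hg; rewrite (bigD1_seq l0) ?(rm_uniq H) //=; lia.
  rewrite big_distrr /=; apply: leq_sum_seq_cond => l lS' ne.
  have := c_bound Hs lS'; rewrite exchange_big /=; apply: leq_trans.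
  by rewrite leq_mul2r MX ?orbT.
Qed.

Definition wild_type : Prop := exists l u0 v0, [/\ l \in S,
     u0 \in RU l /\ v0 \in RV l,
     e u0 = (d u0).+1 /\ {in RU l, forall u, u != u0 -> d u = e u},
     f v0 = (g v0).+1 /\ {in RV l, forall v, v != v0 -> g v = f v} &
     coprime (e u0) (f v0)].

End Global2.

Theorem ramification_types (L T1 T2 : eqType) (n m : nat) (S : seq L)
  (RU : L -> seq T1) (RV : L -> seq T2) e d f g c c' :
  ramification n m S RU RV e d f g c c' -> coprime n m ->
  [\/ (exists2 l, l \in S & size (RU l) = 1) \/ (exists2 l, l \in S & size (RV l) = 1),
      dickson_type S RU RV e d f g, dickson_type S RV RU f g e d |
      wild_type S RU RV e d f g].
Proof.
move=> H co; have Hs := ramification_sym H.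
have [/hasP[l0 lS hy]|no] := boolP (has (fun l => m <= 2 * \sum_(v <- RV l) g v) S); last first.
  case: (two_values H) => [l lS||]; [|by move=> h; apply: Or41; left|by move=> h; apply: Or42].
  by move/hasPn: no => /(_ l lS); rewrite -ltnNge.
have [/hasP[l1 l1S hx]|no] := boolP (has (fun l => n <= 2 * \sum_(v <- RU l) d v) S); last first.
  case: (two_values Hs) => [l lS'||]; [|by move=> h; apply: Or41; right|by move=> h; apply: Or43].
  by move/hasPn: no => /(_ l lS'); rewrite -ltnNge.
have hd := rm_d H; have hg := rm_g H.
have lx := leq_sum_seq1 (fun l => \sum_(v <- RU l) d v) lS.
have ly := leq_sum_seq1 (fun l => \sum_(v <- RV l) g v) lS.
case: (common_value H co lS l1S hy hx) => [s1|s1|[X0 Y0 [u0 [v0 [uR vR h1 h2 cuv]]]]].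
- by apply: Or41; left; exists l0.
- by apply: Or41; right; exists l0.
by apply: Or44; exists l0, u0, v0.
Qed.

Local Open Scope ring_scope.

(** * Lucas sequences and Dickson polynomials *)

Section Lucas.
Variable R : comNzRingType.
Implicit Types (x a : R).

(** The Lucas sequences, characterised by
    [lucasV (y + a / y) a n = y ^ n + (a / y) ^ n] and
    [lucasW (y + a / y) a n = (y ^ n - (a / y) ^ n) / (y - a / y)]. *)
Fixpoint lucasV x a n : R :=
  if n is n1.+1 then
    if n1 is n2.+1 then x * lucasV x a n1 - a * lucasV x a n2 else x
  else 2.

Lemma lucasVS x a n :
  lucasV x a n.+2 = x * lucasV x a n.+1 - a * lucasV x a n.
Proof. by []. Qed.

Fixpoint lucasW x a n : R :=
  if n is n1.+1 then
    if n1 is n2.+1 then x * lucasW x a n1 - a * lucasW x a n2 else 1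
  else 0.

Lemma lucasWS x a n :
  lucasW x a n.+2 = x * lucasW x a n.+1 - a * lucasW x a n.
Proof. by []. Qed.

Lemma lucasV_sqr x a n :
  lucasV x a n * lucasV x a n = lucasV x a n.*2 + a ^+ n *+ 2 /\
  lucasV x a n * lucasV x a n.+1 = lucasV x a n.*2.+1 + a ^+ n * x.
Proof.
elim: n {-2}n (leqnn n) => [|N IH] [|[|n]] leN //; try by rewrite /=; split; ring.
have [h1 h2] := IH n.+1 leN.
have [h3 h4] := IH n (ltnW leN).
have e1 : lucasV x a n.+2 * lucasV x a n.+2 =
    lucasV x a n.+2.*2 + a ^+ n.+2 *+ 2.
  have := lucasVS x a n.*2.+2; rewrite -!doubleS => ->.
  have e3 : lucasV x a n.+1.*2 = x * lucasV x a n.*2.+1 - a * lucasV x a n.*2.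
    by rewrite doubleS lucasVS.
  have e4 : lucasV x a n.+2 * lucasV x a n =
      x * (lucasV x a n * lucasV x a n.+1) - a * (lucasV x a n * lucasV x a n).
    by rewrite lucasVS; ring.
  have e5 : lucasV x a n.+2 * lucasV x a n.+2 =
     x * (lucasV x a n.+1 * lucasV x a n.+2) - a * (lucasV x a n.+2 * lucasV x a n).
    by rewrite {1}lucasVS; ring.
  by rewrite e5 h2 e4 h3 h4 e3 !exprS; ring.
split=> //.
have -> : lucasV x a n.+2 * lucasV x a n.+3 =
    x * (lucasV x a n.+2 * lucasV x a n.+2) - a * (lucasV x a n.+1 * lucasV x a n.+2).
  by rewrite (lucasVS _ _ n.+1); ring.
rewrite e1 h2 (lucasVS _ _ n.+1.*2.+1) -doubleS !exprS; ring.
Qed.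

Lemma lucasV_mul x a n k :
  lucasV x a n * lucasV x a (n + k) =
  lucasV x a (n.*2 + k) + a ^+ n * lucasV x a k.
Proof.
elim: k {-2}k (leqnn k) => [|N IH] [|[|k]] lek //.
- by rewrite !addn0 (lucasV_sqr x a n).1 /=; ring.
- by rewrite !addn0 (lucasV_sqr x a n).1 /=; ring.
- by rewrite !addn1 (lucasV_sqr x a n).2 /=; ring.
have h1 := IH k.+1 lek; have h2 := IH k (ltnW lek).
rewrite !addnS in h1 *; rewrite !lucasVS mulrBr.
have -> : lucasV x a n * (x * lucasV x a (n + k).+1) =
   x * (lucasV x a n * lucasV x a (n + k).+1) by ring.
have -> : lucasV x a n * (a * lucasV x a (n + k)) =
   a * (lucasV x a n * lucasV x a (n + k)) by ring.
rewrite h1 h2; ring.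
Qed.

(** Both sides are [y ^ (k n) + (a / y) ^ (k n)] at [x = y + a / y]. *)
Lemma lucasV_comp x a n k :
  lucasV (lucasV x a n) (a ^+ n) k = lucasV x a (k * n).
Proof.
elim: k {-2}k (leqnn k) => [|N IH] [|[|k]] lek //; first by rewrite mul1n.
rewrite lucasVS !IH //; last exact: ltnW.
rewrite [(k.+1 * n)%N]mulSn lucasV_mul.
by rewrite (_ : (n.*2 + k * n = k.+2 * n)%N); [ring | lia].
Qed.

Lemma lucasVW x a n : lucasV x a n.+1 = x * lucasW x a n.+1 - a * lucasW x a n *+ 2.
Proof.
elim: n {-2}n (leqnn n) => [|N IH] [|[|k]] lek //; try by rewrite /=; ring.
rewrite lucasVS !IH //; last exact: ltnW.
rewrite !lucasWS; ring.
Qed.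
End Lucas.

Lemma rmorph_lucasV (R S : comNzRingType) (f : {rmorphism R -> S}) x a n :
  f (lucasV x a n) = lucasV (f x) (f a) n.
Proof.
elim: n {-2}n (leqnn n) => [|N IH] [|[|k]] lek //; try by rewrite /= rmorph_nat.
by rewrite !lucasVS rmorphB !rmorphM !IH //; apply: ltnW.
Qed.

Section DicksonLucas.
Variable K : fieldType.
Implicit Types (a c : K) (p q : {poly K}).

Lemma dickson_coef0 n : (0 < n)%N -> dickson_coef n 0 = 1%N.
Proof. by move=> n0; rewrite /dickson_coef subn0 bin0 muln1 divnn n0. Qed.

Lemma dickson_coefS n i : (1 < n)%N ->
  dickson_coef n i.+1 = ('C(n - i.+1, i.+1) + 'C(n - i.+2, i))%N.
Proof.
move=> n1; have [le_n|lt_n] := leqP n i.+1.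
  rewrite /dickson_coef; have -> : (n - i.+1 = 0)%N by lia.
  have -> : (n - i.+2 = 0)%N by lia.
  by rewrite divn0 !bin0n; case: i le_n => // le_n; lia.
have h := dickson_coef_exact (ltnW lt_n).
have d0 : (0 < n - i.+1)%N by lia.
apply/eqP; rewrite -(eqn_pmul2r d0) h; apply/eqP.
have -> : (n - i.+1 = (n - i.+2).+1)%N by lia.
move: (mul_bin_diag (n - i.+2).+1 i) => /= {}h.
rewrite mulnDl [X in (_ + X)%N]mulnC h.
by move: ('C(_, i.+1)) => b; have -> : (n = (n - i.+2).+1 + i.+1)%N; [lia|nia].
Qed.

Lemma dickson_coef_rec n i : (0 < n)%N ->
  dickson_coef n.+2 i.+1 = (dickson_coef n.+1 i.+1 + dickson_coef n i)%N.
Proof.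
move=> n0; rewrite !dickson_coefS //.
have [->|n1] := eqVneq n 1%N.
  by case: i => [|[|[|i]]] //; rewrite /dickson_coef !bin_small //; lia.
case: i => [|i].
  by rewrite dickson_coef0 // !bin1 !bin0; lia.
rewrite dickson_coefS; last by lia.
have [le_n|lt_n] := leqP n i.+1.
  by rewrite !bin_small //; lia.
have -> : (n.+2 - i.+2 = (n - i.+1).+1)%N by lia.
have -> : (n.+1 - i.+2 = n - i.+1)%N by lia.
have -> : (n.+2 - i.+3 = (n - i.+2).+1)%N by lia.
have -> : (n.+1 - i.+3 = n - i.+2)%N by lia.
by rewrite !binS; lia.
Qed.

Lemma dickson_coef_eq0 n i : (n < i.*2)%N -> dickson_coef n i = 0%N.
Proof. by move=> h; rewrite /dickson_coef bin_small ?muln0 ?div0n //; lia. Qed.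

Lemma dickson_widen n a N : (n./2 < N)%N -> dickson n a =
  \sum_(i < N) ((dickson_coef n i)%:R * (- a) ^+ i) *: 'X^(n - i.*2).
Proof.
move=> hN; rewrite /dickson.
rewrite (big_ord_widen _ (fun i => ((dickson_coef n i)%:R * (- a) ^+ i)
   *: 'X^(n - i.*2) : {poly K}) hN).
rewrite [RHS](bigID (fun i : 'I_N => (i < n./2.+1)%N)) /=.
rewrite [X in _ = _ + X]big1 ?addr0 // => i hi.
by rewrite dickson_coef_eq0 ?mul0r ?scale0r //; lia.
Qed.

Lemma dickson_rec n a : (0 < n)%N ->
  dickson n.+2 a = 'X * dickson n.+1 a - a%:P * dickson n a.
Proof.
move=> n0.
rewrite (@dickson_widen n.+2 _ n.+3); last by lia.
rewrite (@dickson_widen n.+1 _ n.+3); last by lia.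
rewrite (@dickson_widen n _ n.+2); last by lia.
rewrite !(big_ord_recl n.+2) /= !subn0 !dickson_coef0 // mulrDr -addrA; congr (_ + _).
  by rewrite !mul1r -scalerAr -exprS.
rewrite !big_distrr /= -sumrB; apply: eq_bigr => i _.
rewrite /bump /= add1n dickson_coef_rec //.
have -> : (n.+2 - i.+1.*2 = n - i.*2)%N by lia.
rewrite mul_polyC scalerA -scalerAr -exprS.
have [h|h] := leqP i.+1.*2 n.+1.
  have -> : ((n.+1 - i.+1.*2).+1 = n - i.*2)%N by lia.
  by rewrite -scalerBl natrD exprS; congr (_ *: _); ring.
rewrite (dickson_coef_eq0 h) add0n mul0r scale0r sub0r -scaleNr exprS.
by congr (_ *: _); ring.
Qed.

Lemma dickson_lucasV n a : (0 < n)%N -> dickson n a = lucasV 'X a%:P n.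
Proof.
elim: n {-2}n (leqnn n) => [|N IH] [|[|[|n]]] leN // _.
- by rewrite /dickson big_ord1 /= dickson_coef0 // subn0 mul1r scale1r.
- rewrite /dickson !big_ord_recl big_ord0 /= dickson_coef0 // dickson_coefS //.
  rewrite /= addr0 mul1r scale1r /bump /= (_ : ('C(2 - 1, 1) + 'C(2 - 2, 0) = 2)%N) //.
  rewrite subn0 subnn expr1 expr2 expr0.
  by rewrite -mul_polyC polyCM polyCN polyC_natr; ring.
by rewrite dickson_rec // !IH //; apply: ltnW.
Qed.

Lemma dickson_comp m n a : (0 < m)%N -> (0 < n)%N ->
  dickson m (a ^+ n) \Po dickson n a = dickson (m * n) a.
Proof.
move=> m0 n0; rewrite !dickson_lucasV ?muln_gt0 ?m0 //.
rewrite rmorph_lucasV /= comp_polyX comp_polyC -lucasV_comp.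
by rewrite rmorphXn.
Qed.
End DicksonLucas.

(** * Approximate roots *)

Section ApproxRoots.
Variable K : fieldType.
Implicit Types (p q u v f g h A B : {poly K}).

Definition monic_deg n p := (p \is monic) && (size p == n.+1).

Lemma monic_degP n p : reflect (p \is monic /\ size p = n.+1) (monic_deg n p).
Proof. by apply: (iffP andP) => -[-> /eqP]. Qed.

Lemma monic_deg_monic n p : monic_deg n p -> p \is monic.
Proof. by case/andP. Qed.

Lemma monic_deg_size n p : monic_deg n p -> size p = n.+1.
Proof. by case/andP=> _ /eqP. Qed.

Lemma monic_deg_neq0 n p : monic_deg n p -> p != 0.
Proof. by move/monic_deg_monic/monic_neq0. Qed.

Lemma monic_degM m n p q :
  monic_deg m p -> monic_deg n q -> monic_deg (m + n) (p * q).
Proof.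
move=> /monic_degP[mp sp] /monic_degP[mq sq]; apply/monic_degP.
by rewrite monicMl // size_monicM ?monic_neq0 // sp sq addnS addSn.
Qed.

Lemma monic_degXn m n p : monic_deg m p -> monic_deg (m * n) (p ^+ n).
Proof.
move=> hp; elim: n => [|n IH]; last by rewrite mulnS exprS monic_degM.
by rewrite muln0 expr0; apply/monic_degP; rewrite monic1 size_poly1.
Qed.

Lemma monic_deg_comp m n p q :
  (0 < n)%N -> monic_deg m p -> monic_deg n q -> monic_deg (m * n) (p \Po q).
Proof.
move=> n0 /monic_degP[mp sp] /monic_degP[mq sq]; apply/monic_degP.
have h : p \Po q \is monic.
  by rewrite monicE lead_coef_comp ?sq // (monicP mp) (monicP mq) expr1n mul1r.
split=> //; have := size_comp_poly p q; rewrite sp sq /= => <-.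
by rewrite prednK // size_poly_gt0 monic_neq0.
Qed.

Lemma monic_degB m p c : (0 < m)%N -> monic_deg m p -> monic_deg m (p - c%:P).
Proof.
move=> m0 /monic_degP[mp sp].
have lt : (size (- c%:P) < size p)%N.
  by rewrite sp size_polyN (leq_ltn_trans (size_polyC_leq1 _)).
apply/monic_degP; rewrite size_polyDl // sp; split=> //.
by rewrite monicE lead_coefDl // (monicP mp).
Qed.

Lemma monic_deg_XsubC c : monic_deg 1 ('X - c%:P).
Proof. by apply/monic_degP; rewrite monicXsubC size_XsubC. Qed.

Lemma monic_degD m p q : (size q <= m)%N -> monic_deg m p -> monic_deg m (p + q).
Proof.
move=> sq /monic_degP[mp sp]; apply/monic_degP.
by rewrite size_polyDl ?sp // monicE lead_coefDl ?sp // (monicP mp).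
Qed.

(** The cofactor of [A - B] in [A ^+ k - B ^+ k] has leading coefficient [k]. If
    [k] is not zero in the field, a monic polynomial is therefore determined by the
    top coefficients of its [k]-th power. *)
Lemma size_sum_XX n k A B : monic_deg n A -> monic_deg n B -> k%:R != 0 :> K ->
  let S := \sum_(i < k) A ^+ (k.-1 - i) * B ^+ i in
  size S = (n * k.-1).+1 /\ S`_(n * k.-1) = k%:R.
Proof.
move=> hA hB k0 S.
have hi (i : 'I_k) : monic_deg (n * k.-1) (A ^+ (k.-1 - i) * B ^+ i).
  have := monic_degM (monic_degXn (k.-1 - i) hA) (monic_degXn i hB).
  by rewrite -mulnDr subnK //; case: (k) i => [[]|k' i] //=; rewrite -ltnS.
have cS : S`_(n * k.-1) = k%:R.
  rewrite coef_sum -[RHS](_ : \sum_(i < k) 1 = _); last first.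
    by rewrite sumr_const card_ord.
  apply: eq_bigr => i _; have /monic_degP[/monicP ml sz] := hi i.
  by rewrite -[RHS]ml lead_coefE sz.
split=> //; apply/eqP; rewrite eqn_leq; apply/andP; split; last first.
  by apply: contraR k0; rewrite -leqNgt => /leq_sizeP h; rewrite -cS h.
apply: (leq_trans (size_sum _ _ _)); apply/bigmax_leqP => i _.
by rewrite (monic_deg_size (hi i)).
Qed.

Lemma monic_root_uniq n k A B : monic_deg n A -> monic_deg n B -> k%:R != 0 :> K ->
  (size (A ^+ k - B ^+ k)%R <= n * k.-1)%N -> A = B.
Proof.
move=> hA hB k0; have [sS _] := size_sum_XX hA hB k0.
rewrite subrXX; set S := \sum_(_ < _) _ in sS * => le; apply/eqP.
rewrite -subr_eq0; apply: contraTT le => nAB.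
have nS : S != 0 by rewrite -size_poly_gt0 sS.
rewrite size_mul // sS -ltnNge addnS /=.
by rewrite -addn1 addnC leq_add2r // size_poly_gt0.
Qed.

(** Each further coefficient of [U] affects the next coefficient of [U ^+ k] by [k]
    times itself, so the coefficients can be chosen one after the other. *)
Lemma approx_root n k u : (0 < k)%N -> k%:R != 0 :> K -> monic_deg (n * k) u ->
  exists2 U, monic_deg n U & (size (u - U ^+ k)%R <= n * k.-1)%N.
Proof.
move=> k0 kN0 hu.
suff h j : (j <= n)%N -> exists2 U, monic_deg n U & (size (u - U ^+ k)%R <= n * k - j)%N.
  by have [U hU sU] := h n (leqnn n); exists U => //; rewrite -subn1 mulnBr muln1.
elim: j => [|j IH] lej.
  have hX : monic_deg n 'X^n by apply/monic_degP; rewrite monicXn size_polyXn.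
  exists 'X^n => //; rewrite subn0 -ltnS; have /monic_degP[mu su] := hu.
  have /monic_degP[mX sX] := (monic_degXn k hX).
  apply/leq_sizeP => i; rewrite leq_eqVlt => /orP[/eqP <-|lti]; rewrite coefB.
    have := monicP mu; have := monicP mX; rewrite !lead_coefE su sX /= => -> ->.
    by rewrite subrr.
  by rewrite !nth_default ?subr0 // ?su ?sX //; lia.
have [U hU sU] := IH (ltnW lej).
set t := (n * k - j.+1)%N; pose i := (n - j.+1)%N.
have ti : t = (i + n * k.-1)%N.
  by rewrite /t /i; case: (k) k0 => // k' _; rewrite mulnS /=; lia.
pose b := (u - U ^+ k)`_t / k%:R.
have hU' : monic_deg n (U + b *: 'X^i).
  apply: monic_degD => //; apply: leq_trans (size_scale_leq _ _) _.
  by rewrite size_polyXn /i; lia.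
exists (U + b *: 'X^i) => //.
have [sS cS] := size_sum_XX hU' hU kN0.
have e : u - (U + b *: 'X^i) ^+ k =
    (u - U ^+ k) - ((U + b *: 'X^i) ^+ k - U ^+ k) by ring.
rewrite e subrXX; set S := \sum_(_ < _) _ in sS cS *.
rewrite (_ : U + b *: 'X^i - U = b *: 'X^i); last by rewrite addrC addKr.
rewrite -scalerAl mulrC -/t.
have tt : (n * k - j = t.+1)%N.
  by rewrite /t; case: (k) k0 => // k' _; rewrite mulnS /=; lia.
rewrite tt in sU.
apply/leq_sizeP => l; rewrite leq_eqVlt => /orP[/eqP <-|ltl].
  rewrite coefB coefZ coefMXn ti ltnNge leq_addr /= addKn cS -ti /b.
  by rewrite divfK // subrr.
rewrite coefB coefZ coefMXn nth_default; last exact: leq_trans sU ltl.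
case: ifP => [|_]; first by rewrite mulr0 subr0.
by rewrite nth_default ?mulr0 ?subr0 // sS; lia.
Qed.

Lemma size_comp_le (r : {poly K}) f j d : (0 < d)%N -> monic_deg d f -> (size r <= j)%N ->
  (size (r \Po f) <= j * d)%N.
Proof.
move=> d0 hf sr; have [->|rN0] := eqVneq r 0; first by rewrite comp_poly0 size_poly0.
have := size_comp_poly r f; rewrite (monic_deg_size hf) /= => e1.
have : (0 < size r)%N by rewrite size_poly_gt0.
by move: (size _) (size _) e1 sr => a b; case: d d0 hf => // d _ _; nia.
Qed.

(** Both sides of [U \Po f1 = V \Po f2] are the unique approximate [k]-th root of
    the given composite, so a tame composite can be replaced by one of degree
    [lcm (deg f1) (deg f2)]. *)
Lemma minimal_composite n1 n2 m n k f1 f2 u v : (0 < k)%N -> k%:R != 0 :> K ->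
  (0 < n1)%N -> (0 < n2)%N -> (n * n1 = m * n2)%N ->
  monic_deg n1 f1 -> monic_deg n2 f2 ->
  monic_deg (n * k) u -> monic_deg (m * k) v -> u \Po f1 = v \Po f2 ->
  exists U V, [/\ monic_deg n U, monic_deg m V & U \Po f1 = V \Po f2].
Proof.
move=> k0 kN0 n10 n20 e h1 h2 hu hv euv.
have [U hU sU] := approx_root k0 kN0 hu.
have [V hV sV] := approx_root k0 kN0 hv.
exists U, V; split=> //.
apply: (@monic_root_uniq (n * n1) k) => //; first exact: monic_deg_comp.
  by rewrite e; apply: monic_deg_comp.
have -> : (U \Po f1) ^+ k - (V \Po f2) ^+ k =
    ((v - V ^+ k) \Po f2) - ((u - U ^+ k) \Po f1).
  by rewrite !comp_polyB !rmorphXn /= -euv; ring.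
apply: leq_trans (size_polyD _ _) _; rewrite size_polyN geq_max; apply/andP; split.
  have -> : (n * n1 * k.-1 = m * k.-1 * n2)%N by rewrite e mulnAC.
  exact: size_comp_le.
have -> : (n * n1 * k.-1 = n * k.-1 * n1)%N by rewrite mulnAC.
exact: size_comp_le.
Qed.

Lemma comp_poly_inj p q f : (1 < size f)%N -> p \Po f = q \Po f -> p = q.
Proof.
move=> sf e; apply/eqP; rewrite -subr_eq0 -(comp_poly_eq0 _ sf) comp_polyB e subrr.
by [].
Qed.

End ApproxRoots.

Section Descent.
Variables (K k : fieldType) (i : {rmorphism K -> k}).

Lemma monic_deg_map n (p : {poly K}) : monic_deg n (map_poly i p) = monic_deg n p.
Proof. by rewrite /monic_deg map_monic size_map_poly. Qed.

(** The digits of [f] in base [h] are defined over the smaller field. *)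
Lemma descend_left_factor (f h : {poly K}) (F : {poly k}) : (1 < size h)%N ->
  map_poly i f = F \Po map_poly i h -> exists2 F0, F = map_poly i F0 & f = F0 \Po h.
Proof.
move=> sh e; suff [F0 eF] : exists F0, F = map_poly i F0.
  exists F0 => //; apply: (map_poly_inj i).
  by rewrite map_comp_poly -eF.
elim/poly_ind: F f e => [|p c IH] f e; first by exists 0; rewrite rmorph0.
have hN0 : map_poly i h != 0 by rewrite map_poly_eq0 -size_poly_gt0 ltnW.
have sc : (size (c%:P : {poly k}) < size (map_poly i h))%N.
  by rewrite size_map_poly (leq_ltn_trans (size_polyC_leq1 _)).
have e' : map_poly i f = (p \Po map_poly i h) * map_poly i h + c%:P.
  by rewrite e comp_polyD comp_polyM comp_polyX comp_polyC.
have eq : map_poly i (f %/ h) = p \Po map_poly i h.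
  by rewrite map_divp e' divp_addl_mul_small.
have er : map_poly i (f %% h) = c%:P.
  by rewrite map_modp e' modp_addl_mul_small.
have [p0 ->] := IH _ eq.
exists (p0 * 'X + ((f %% h)`_0)%:P).
rewrite rmorphD rmorphM /= map_polyX map_polyC /=; congr (_ + _%:P).
by rewrite -coef_map er coefC.
Qed.

(** The right factor of a tame composition, normalised to be monic without
    constant term, is an approximate root of the composite up to a constant, and
    approximate roots are defined over the field of the composite. *)
Lemma descend_right_factor (f : {poly K}) (F h : {poly k}) n d :
  (0 < n)%N -> (0 < d)%N -> n%:R != 0 :> K -> monic_deg (n * d) f ->
  monic_deg n F -> monic_deg d h -> h`_0 = 0 -> map_poly i f = F \Po h ->
  exists2 h0, monic_deg d h0 & h = map_poly i h0.
Proof.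
move=> n0 d0 nN0 hf hF hh h00 e; rewrite mulnC in hf.
have [h1 hh1 sh1] := approx_root n0 nN0 hf.
have nN0' : n%:R != 0 :> k by rewrite -(rmorph_nat i) fmorph_eq0.
have [|U hU sU] := @approx_root _ 1 n F n0 nN0'; first by rewrite mul1n.
rewrite mul1n in sU.
have [c eU] : exists c, U = 'X + c%:P.
  have /monic_degP[mU s2] := hU.
  exists (U`_0); apply/polyP => -[|[|j]]; rewrite coefD coefX coefC ?add0r ?addr0 //=.
    by have := monicP mU; rewrite lead_coefE s2.
  by rewrite nth_default // s2.
have eh : h + c%:P = map_poly i h1.
  apply: (@monic_root_uniq _ d n) => //; [|by rewrite monic_deg_map|].
    by rewrite -[c]opprK polyCN; apply: monic_degB.
  have -> : (h + c%:P) ^+ n - map_poly i h1 ^+ n =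
      map_poly i (f - h1 ^+ n) - ((F - U ^+ n) \Po h).
    by rewrite !rmorphB !rmorphXn /= e eU comp_polyD comp_polyX comp_polyC; ring.
  apply: leq_trans (size_polyD _ _) _; rewrite size_polyN geq_max size_map_poly sh1.
  by rewrite mulnC size_comp_le.
have c0 : c = i h1`_0.
  by have := congr1 (fun p : {poly k} => p`_0) eh; rewrite coefD h00 add0r coefC coef_map.
exists (h1 - (h1`_0)%:P); first exact: monic_degB.
by rewrite rmorphB /= map_polyC /= -eh c0 addrK.
Qed.

End Descent.

(** * The values of one polynomial on a fibre of another *)

Section Closed.
Variable k : closedFieldType.
Implicit Types (p q f g h A B U V : {poly k}) (c v x y z : k).

Definition rootseq p : seq k := sval (closed_field_poly_normal p).

Lemma rootsE p : p \is monic -> p = \prod_(z <- rootseq p) ('X - z%:P).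
Proof.
rewrite /rootseq; case: closed_field_poly_normal => r /= e /monicP mp.
by rewrite {1}e mp scale1r.
Qed.

Lemma size_roots n p : monic_deg n p -> size (rootseq p) = n.
Proof.
by case/monic_degP=> mp sp; apply/eqP; rewrite -eqSS -sp {2}(rootsE mp) size_prod_XsubC.
Qed.

Lemma mem_roots p x : p \is monic -> (x \in rootseq p) = root p x.
Proof. by move=> mp; rewrite {2}(rootsE mp) root_prod_XsubC. Qed.

Lemma horner_roots p x : p \is monic -> p.[x] = \prod_(z <- rootseq p) (x - z).
Proof.
move=> mp; rewrite {1}(rootsE mp) horner_prod; apply: eq_bigr => z _.
by rewrite hornerXsubC.
Qed.

Lemma mem_roots_sub n p c x : (0 < n)%N -> monic_deg n p ->
  (x \in rootseq (p - c%:P)) = (p.[x] == c).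
Proof.
move=> n0 hp; rewrite mem_roots ?(monic_deg_monic (monic_degB c n0 hp)) //.
by rewrite rootE !hornerE subr_eq0.
Qed.

Lemma poly_eq0_everywhere p : (forall x, p.[x] = 0) -> p = 0.
Proof.
move=> h; apply/eqP; apply: contraTT isT => pN0.
have : size (p * 'X + 1) != 1%N.
  rewrite size_polyDl ?size_mulX ?size_poly1 ?ltnS ?size_poly_gt0 //.
  by rewrite eqSS size_poly_eq0.
move/closed_rootP => [x]; rewrite /root !hornerE h mul0r add0r.
by rewrite oner_eq0.
Qed.

(** A nonzero polynomial is not a zero divisor; facts about generic points give
    polynomial identities through this. *)
Lemma poly_eq0_generic p q : q != 0 -> (forall x, q.[x] != 0 -> p.[x] = 0) -> p = 0.
Proof.
move=> qN0 h; suff /eqP : q * p = 0 by rewrite mulf_eq0 (negPf qN0) => /eqP.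
apply: poly_eq0_everywhere => x; rewrite hornerM.
by have [->|/h ->] := eqVneq q.[x] 0; rewrite ?mul0r ?mulr0.
Qed.

Lemma generic_point q : q != 0 -> exists x, q.[x] != 0.
Proof.
move=> qN0; have : size (q * 'X + 1) != 1%N.
  rewrite size_polyDl ?size_mulX ?size_poly1 ?ltnS ?size_poly_gt0 //.
  by rewrite eqSS size_poly_eq0.
move/closed_rootP => [x]; rewrite /root !hornerE => /eqP e.
by exists x; apply: contra_eq_neq e => ->; rewrite mul0r add0r oner_eq0.
Qed.

Lemma ex_uniq_seq n : exists2 s : seq k, uniq s & size s = n.
Proof.
elim: n => [|n [s us ss]]; first by exists [::].
have [|x hx] := @generic_point (\prod_(z <- s) ('X - z%:P)).
  exact: monic_neq0 (monic_prod_XsubC _ _ _).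
exists (x :: s) => /=; last by rewrite ss.
by rewrite us andbT -root_prod_XsubC.
Qed.

Lemma lagrange_basis (s : seq k) : uniq s -> exists L : k -> {poly k},
  forall c, c \in s -> (size (L c) <= size s)%N /\
    forall c', c' \in s -> (L c).[c'] = (c == c')%:R.
Proof.
move=> us; pose P c := \prod_(z <- rem c s) ('X - z%:P).
exists (fun c => (P c).[c]^-1 *: P c) => c cs; split=> [|c' c's].
  apply: leq_trans (size_scale_leq _ _) _.
  by rewrite size_prod_XsubC size_rem // prednK // -has_predT; apply/hasP; exists c.
have rP z : root (P c) z = (z \in rem c s) by rewrite root_prod_XsubC.
rewrite hornerZ; have [<-|ne] := eqVneq c c'.
  rewrite mulVf //; have := rP c; rewrite /root => ->.
  by rewrite mem_rem_uniqF.
have /eqP -> : root (P c) c' by rewrite rP (mem_rem_uniq _ us) !inE eq_sym ne.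
by rewrite mulr0.
Qed.

Lemma eq_poly_uniq_points (s : seq k) p q : uniq s -> (size p <= size s)%N ->
  (size q <= size s)%N -> {in s, forall c, p.[c] = q.[c]} -> p = q.
Proof.
move=> us sp sq e; apply/eqP; rewrite -subr_eq0; apply: contraTT isT => nz.
have := max_poly_roots nz _ us; rewrite ltnNge.
suff -> : (size (p - q)%R <= size s)%N.
  by apply; apply/allP => c cs; rewrite /root !hornerE e // subrr.
by apply: leq_trans (size_polyD _ _) _; rewrite size_polyN geq_max sp sq.
Qed.

Lemma prod_sub_swap (r1 r2 : seq k) :
  \prod_(x <- r1) \prod_(y <- r2) (x - y) =
  (-1) ^+ (size r1 * size r2) * \prod_(y <- r2) \prod_(x <- r1) (y - x).
Proof.
rewrite exchange_big exprM /=; elim: r2 => [|y r2 IH]; first by rewrite !big_nil mulr1.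
rewrite !big_cons IH /= exprS.
suff -> : \prod_(x <- r1) (x - y) = (-1) ^+ size r1 * \prod_(x <- r1) (y - x).
  ring.
elim: r1 {IH} => [|x r1 IH]; first by rewrite !big_nil mulr1.
by rewrite !big_cons IH /= exprS; ring.
Qed.

(** Up to sign, both products run over the differences of a root of [f] and a root
    of [q]. *)
Lemma norm_reciprocity f q : f \is monic -> q \is monic ->
  \prod_(x <- rootseq f) q.[x] =
  (-1) ^+ (size (rootseq f) * size (rootseq q)) * \prod_(y <- rootseq q) f.[y].
Proof.
move=> mf mq; under eq_bigr do rewrite (horner_roots _ mq).
rewrite prod_sub_swap; congr (_ * _).
by apply: eq_bigr => y _; rewrite (horner_roots _ mf).
Qed.

Section Fibre.
Variables (n1 n2 : nat) (f1 f2 : {poly k}).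
Hypotheses (n10 : (0 < n1)%N) (n20 : (0 < n2)%N).
Hypotheses (hf1 : monic_deg n1 f1) (hf2 : monic_deg n2 f2).

Definition fibre_poly v := \prod_(x <- rootseq (f2 - v%:P)) ('X - (f1.[x])%:P).

Let hB v : monic_deg n2 (f2 - v%:P). Proof. exact: monic_degB. Qed.

Lemma fibre_poly_monic v : monic_deg n2 (fibre_poly v).
Proof.
apply/monic_degP; rewrite /fibre_poly -(big_map _ predT (fun z => 'X - z%:P)).
by rewrite monic_prod_XsubC size_prod_XsubC size_map (size_roots (hB v)).
Qed.

Lemma root_fibre_poly v c : root (fibre_poly v) c ->
  exists2 x, f1.[x] = c & f2.[x] = v.
Proof.
rewrite /fibre_poly -(big_map _ predT (fun z => 'X - z%:P)) root_prod_XsubC.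
by case/mapP => x; rewrite (mem_roots_sub _ _ n20 hf2) => /eqP <- ->; exists x.
Qed.

(** The coefficients of [fibre_poly v] are polynomials in [v]: by reciprocity each
    value of [fibre_poly v] is one, and the coefficients are obtained from the
    values by interpolation. *)
Lemma fibre_poly_family : exists Phi : {poly {poly k}},
  forall v, map_poly (horner_eval v) Phi = fibre_poly v.
Proof.
have [s us ss] := ex_uniq_seq n2.+1.
have [L hL] := lagrange_basis us.
pose e := (-1) ^+ n2 * (-1) ^+ (n2 * n1) : k.
pose Psi c := e *: \prod_(y <- rootseq (f1 - c%:P)) ((f2.[y])%:P - 'X).
have hPsi c v : (Psi c).[v] = (fibre_poly v).[c].
  rewrite /Psi hornerZ !horner_prod.
  transitivity ((-1) ^+ n2 * \prod_(x <- rootseq (f2 - v%:P)) (f1 - c%:P).[x]).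
    have hm1 := monic_deg_monic (monic_degB c n10 hf1).
    have hm2 := monic_deg_monic (monic_degB v n20 hf2).
    rewrite (norm_reciprocity hm2 hm1) (size_roots (hB v)).
    rewrite (size_roots (monic_degB c n10 hf1)) mulrA; congr (_ * _).
    by apply: eq_bigr => y _; rewrite !hornerE.
  rewrite -{1}(size_roots (hB v)); elim: (rootseq _) => [|x r IH].
    by rewrite !big_nil mulr1.
  by rewrite !big_cons -IH /= exprS !(hornerD, hornerN, hornerX, hornerC); ring.
exists (\sum_(c <- s) (map_poly polyC (L c)) * (Psi c)%:P) => v.
rewrite rmorph_sum /=.
have -> : \sum_(c <- s) map_poly (horner_eval v) (map_poly polyC (L c) * (Psi c)%:P) =
    \sum_(c <- s) (fibre_poly v).[c] *: L c.
  apply: eq_bigr => c _; rewrite rmorphM /= map_polyC /= -hPsi.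
  rewrite mulrC mul_polyC -map_poly_comp map_poly_id // => z _ /=.
  by rewrite /horner_eval hornerC.
apply: (eq_poly_uniq_points us).
- rewrite big_seq; elim/big_rec: _ => [|c p cs IH]; first by rewrite size_poly0.
  apply: leq_trans (size_polyD _ _) _; rewrite geq_max IH andbT.
  by apply: leq_trans (size_scale_leq _ _) _; have [] := hL c cs.
- by rewrite (monic_deg_size (fibre_poly_monic v)) ss.
move=> c cs; rewrite horner_sum (bigD1_seq c) //= hornerZ.
rewrite (hL c cs).2 // eqxx mulr1 big_seq_cond big1 ?addr0 // => c' /andP[c's ne].
by rewrite hornerZ (hL c' c's).2 // (negPf ne) mulr0.
Qed.

End Fibre.

Lemma eq0_sum_distinct_size (n : nat) (T : 'I_n -> {poly k}) :
  (forall i j, T i != 0 -> T j != 0 -> size (T i) = size (T j) -> i = j) ->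
  \sum_i T i = 0 -> forall i, T i = 0.
Proof.
move=> inj e i; apply/eqP; apply: contraTT isT => nz.
pose i0 := [arg max_(j > i) size (T j)]; have : (size (T i) <= size (T i0))%N.
  by rewrite /i0; case: arg_maxnP => // j _; apply.
have hmax j : (size (T j) <= size (T i0))%N.
  by rewrite /i0; case: arg_maxnP => // j0 _; apply.
move=> le0; have nz0 : T i0 != 0.
  by rewrite -size_poly_gt0 (leq_trans _ le0) // size_poly_gt0.
have := congr1 (fun p : {poly k} => p`_(size (T i0)).-1) e.
rewrite coef0 coef_sum (bigD1 i0) //= big1 ?addr0 => [|j ne].
  by move/eqP; rewrite -lead_coefE lead_coef_eq0 (negPf nz0).
have [->|nzj] := eqVneq (T j) 0; first by rewrite coef0.
rewrite nth_default //; have : size (T j) != size (T i0).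
  by apply: contra ne => /eqP /(inj _ _ nzj nz0) ->.
have := hmax j; have : (0 < size (T i0))%N by rewrite size_poly_gt0.
by move: (size _) (size _); lia.
Qed.

Section FibrePower.
Variables (d m n : nat) (f1 f2 U V : {poly k}).
Hypotheses (d0 : (0 < d)%N) (m0 : (0 < m)%N) (n0 : (0 < n)%N) (co : coprime m n).
Hypotheses (hf1 : monic_deg (d * m) f1) (hf2 : monic_deg (d * n) f2).
Hypotheses (hU : monic_deg n U) (hV : monic_deg m V).
Hypothesis (eUV : U \Po f1 = V \Po f2).

Let dm0 : (0 < d * m)%N. Proof. by rewrite muln_gt0 d0. Qed.
Let dn0 : (0 < d * n)%N. Proof. by rewrite muln_gt0 d0. Qed.

Definition eval_pair (R : {poly {poly k}}) : {poly k} :=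
  (map_poly (comp_poly f2) R).[f1].

Implicit Types (R S : {poly {poly k}}).

Lemma eval_pairD R S : eval_pair (R + S) = eval_pair R + eval_pair S.
Proof. by rewrite /eval_pair rmorphD hornerD. Qed.

Lemma eval_pairM R S : eval_pair (R * S) = eval_pair R * eval_pair S.
Proof. by rewrite /eval_pair rmorphM hornerM. Qed.

Lemma horner_eval_pair R x :
  (eval_pair R).[x] = (map_poly (horner_eval f2.[x]) R).[f1.[x]].
Proof.
rewrite /eval_pair; elim/poly_ind: R => [|R c IH]; first by rewrite !rmorph0 !horner0.
rewrite !rmorphD !rmorphM /= !map_polyX !map_polyC /= !hornerE IH.
by rewrite horner_comp.
Qed.

(** The degrees [m * i + n * j] with [i < n] are pairwise distinct, so the powers of
    [f1] below the [n]-th are independent over the polynomials in [f2]. *)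
Lemma eval_pair_inj R : (size R <= n)%N -> eval_pair R = 0 -> R = 0.
Proof.
move=> sR; rewrite /eval_pair.
rewrite (@horner_coef_wide _ n); last by apply: leq_trans (size_poly _ _) sR.
under eq_bigr do rewrite coef_map /=.
move=> /eq0_sum_distinct_size h; apply/polyP => i; rewrite coef0.
have [le|lt] := leqP n i; first by rewrite nth_default // (leq_trans sR).
have sf2 : (1 < size f2)%N by rewrite (monic_deg_size hf2).
have comp0 (r : {poly k}) : r \Po f2 = 0 -> r = 0.
  by move=> e; apply: (comp_poly_inj sf2); rewrite e comp_poly0.
have f1i j : f1 ^+ j != 0 by rewrite expf_neq0 // (monic_deg_neq0 hf1).
have := h _ (Ordinal lt); rewrite /= => {}h.
suff /eqP : (R`_i \Po f2) * f1 ^+ i = 0.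
  by rewrite mulf_eq0 (negPf (f1i i)) orbF => /eqP /comp0.
apply: h => a b.
have nzc (r : {poly k}) j : (r \Po f2) * f1 ^+ j != 0 -> r \Po f2 != 0.
  by apply: contra_neq => ->; rewrite mul0r.
have sz (r : {poly k}) j : r \Po f2 != 0 ->
    size ((r \Po f2) * f1 ^+ j) = ((size r).-1 * (d * n) + d * m * j).+1.
  move=> nz; have /monic_degP[_ s2] := monic_degXn j hf1.
  rewrite size_mul // s2 addnS /=; have := size_comp_poly r f2.
  rewrite (monic_deg_size hf2) /= => <-.
  by rewrite -addSn prednK // size_poly_gt0.
move=> /nzc na /nzc nb; rewrite !sz // => -[].
move: (size _).-1 (size _).-1 => v u e.
apply: val_inj => /=; have {}e : (u * n + m * a = v * n + m * b)%N.
  apply/eqP; rewrite -(eqn_pmul2l d0) !mulnDr !mulnA; apply/eqP.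
  have E (w z : nat) : (d * w * n + d * m * z = w * (d * n) + d * m * z)%N by rewrite -mulnA mulnCA.
  by rewrite !E.
have {}e : (m * a = m * b %[mod n])%N.
  by rewrite -(modnMDl u) e modnMDl.
wlog le : a b na nb e / (a <= b)%N.
  move=> H; case: (leqP a b) => [|/ltnW] le; first exact: (H a b).
  by apply/esym/(H b a).
have := e; move/esym/eqP; rewrite eqn_mod_dvd ?leq_mul // -mulnBr Gauss_dvdr; last first.
  by rewrite coprime_sym.
have := ltn_ord b; move: le; move: (nat_of_ord a) (nat_of_ord b) => a' b' le lt' dv.
by have [|lt2] := posnP (b' - a'); [lia | have := dvdn_leq lt2 dv; lia].
Qed.

Definition plane_curve : {poly {poly k}} := map_poly polyC U - V%:P.

Lemma plane_curve_eval v : map_poly (horner_eval v) plane_curve = U - (V.[v])%:P.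
Proof.
rewrite /plane_curve rmorphB /= map_polyC /= -map_poly_comp map_poly_id // => z _ /=.
by rewrite /horner_eval hornerC.
Qed.

Lemma plane_curve_monic : plane_curve \is monic /\ size plane_curve = n.+1.
Proof.
have s1 : size (map_poly polyC U) = n.+1 by rewrite size_map_polyC (monic_deg_size hU).
have lt : (size (- (V%:P) : {poly {poly k}}) < size (map_poly polyC U))%N.
  by rewrite s1 size_polyN (leq_ltn_trans (size_polyC_leq1 _)).
rewrite /plane_curve size_polyDl // monicE lead_coefDl //; split=> //.
by rewrite lead_coef_map_inj ?(monicP (monic_deg_monic hU)) //; apply: polyC_inj.
Qed.

Lemma eval_plane_curve : eval_pair plane_curve = 0.
Proof.
rewrite /eval_pair /plane_curve rmorphB /= map_polyC /= -map_poly_comp.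
rewrite hornerD hornerN hornerC -eUV.
suff -> : map_poly (comp_poly f2 \o polyC) U = map_poly polyC U.
  by rewrite /comp_poly subrr.
by apply: eq_map_poly => z /=; rewrite comp_polyC.
Qed.

(** By induction, dividing by the equation of the curve [U(X) = V(Y)]. If [Phi] is not
    constant in the first variable, it has a zero over every [v], which lies on the
    curve parametrised by [f1] and [f2]; so it vanishes on the curve, and its
    remainder is zero by [eval_pair_inj]. *)
Lemma power_of_plane_curve (N : nat) (Phi : {poly {poly k}}) :
  (size Phi <= N)%N -> Phi \is monic ->
  (forall v c, root (map_poly (horner_eval v) Phi) c ->
     exists2 x, f1.[x] = c & f2.[x] = v) ->
  exists j, Phi = plane_curve ^+ j.
Proof.
have [mM sM] := plane_curve_monic.
elim: N Phi => [|N IH] Phi sP mP hr.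
  by move: sP; rewrite leqn0 size_poly_eq0 (negPf (monic_neq0 mP)).
have [s1|s1] := leqP (size Phi) 1.
  exists 0%N; rewrite expr0; have e := size1_polyC s1.
  by move/monicP: mP; rewrite e lead_coefC => ->.
have ev0 : eval_pair Phi = 0.
  apply/eqP; apply: contraTT isT => qN0; set q := eval_pair Phi in qN0.
  have [|v hv] := @generic_point (\prod_(z <- [seq f2.[r] | r <- rootseq ((lead_coef q)^-1 *: q)]) ('X - z%:P)).
    exact: monic_neq0 (monic_prod_XsubC _ _ _).
  have sv : size (map_poly (horner_eval v) Phi) != 1%N.
    rewrite size_map_poly_id0 ?neq_ltn ?s1 ?orbT // (monicP mP) /=.
    by rewrite /horner_eval hornerC oner_eq0.
  have /closed_rootP[c rc] := sv; have [x e1 e2] := hr _ _ rc; move: rc.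
  move=> rc; have qx : root q x.
    by rewrite /root horner_eval_pair e1 e2.
  have mq : (lead_coef q)^-1 *: q \is monic.
    by rewrite monicE lead_coefZ mulVf // lead_coef_eq0.
  move: hv; rewrite -/(root _ v) root_prod_XsubC; case/mapP; exists x => //.
  by rewrite mem_roots // rootZ // invr_eq0 lead_coef_eq0.
have mu : Pdiv.CommonRing.rmodp Phi plane_curve = 0.
  apply: eval_pair_inj.
    by rewrite -ltnS -sM Pdiv.CommonRing.ltn_rmodp monic_neq0.
  have := ev0; rewrite {1}(Pdiv.RingMonic.rdivp_eq mM Phi) eval_pairD eval_pairM.
  by rewrite eval_plane_curve mulr0 add0r.
have ePhi := Pdiv.RingMonic.rdivp_eq mM Phi; rewrite mu addr0 in ePhi.
set Q := Pdiv.CommonRing.rdivp Phi plane_curve in ePhi.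
have mQ : Q \is monic by move: mP; rewrite ePhi monicMr.
have sQ : (size Q <= N)%N.
  have := sP; rewrite {1}ePhi size_monicM ?monic_neq0 // sM addnS /=.
  by move: n0; move: (size Q) => sQ h; lia.
have [|j ej] := IH Q sQ mQ.
  by move=> v c rc; apply: hr; rewrite ePhi rmorphM /= rootM rc.
by exists j.+1; rewrite exprSr -ej.
Qed.

(** Over a fixed value [v] of [f2] the values of [f1] are the roots of
    [U - V.[v]], each taken equally often: the resultant of [f1 - X] and [f2 - Y]
    vanishes on the irreducible curve [U(X) = V(Y)], hence is a power of its
    equation. *)
Theorem fibre_polyE v : fibre_poly f1 f2 v = (U - (V.[v])%:P) ^+ d.
Proof.
have [Phi hPhi] := fibre_poly_family dm0 dn0 hf1 hf2.
have hF w := fibre_poly_monic f1 dn0 hf2 w.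
have [mM sM] := plane_curve_monic.
have cPhi j w : (Phi`_j).[w] = (fibre_poly f1 f2 w)`_j by rewrite -hPhi coef_map.
have mPhi : Phi \is monic /\ size Phi = (d * n).+1.
  have c1 : Phi`_(d * n) = 1.
    apply/eqP; rewrite -subr_eq0; apply/eqP/poly_eq0_everywhere => w.
    rewrite hornerD hornerN cPhi hornerC; have /monic_degP[/monicP ml sw] := hF w.
    by rewrite -[in X in _ - X]ml lead_coefE sw subrr.
  have sPhi : size Phi = (d * n).+1.
    apply/eqP; rewrite eqn_leq; apply/andP; split; last first.
      by apply: contraTT isT; rewrite -leqNgt => /leq_sizeP/(_ _ (leqnn _))/eqP; rewrite c1 oner_eq0.
    apply/leq_sizeP => j lj; apply: poly_eq0_everywhere => w; rewrite cPhi.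
    by rewrite nth_default // (monic_deg_size (hF w)).
  by split=> //; rewrite monicE lead_coefE sPhi /= c1.
have [|j ej] := power_of_plane_curve (leqnn (size Phi)) mPhi.1.
  by move=> w c; rewrite hPhi; apply: (root_fibre_poly dn0 hf2).
suff ejd : j = d by rewrite -hPhi ej rmorphXn /= plane_curve_eval ejd.
have := size_exp plane_curve j; rewrite -ej mPhi.2 sM /= => /eqP.
by rewrite mulnC eqn_pmul2l // => /eqP.
Qed.

End FibrePower.
End Closed.

(** * A common right factor of degree the gcd *)

Section RootsMore.
Variable k : closedFieldType.
Implicit Types (p q f g h : {poly k}) (c v x y z : k).

Lemma mem_rootsN0 p x : p != 0 -> (x \in rootseq p) = root p x.
Proof.
rewrite /rootseq; case: closed_field_poly_normal => r /= e pN0.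
by rewrite [in RHS]e rootZ ?lead_coef_eq0 // root_prod_XsubC.
Qed.

Lemma count_roots p x : p \is monic -> count_mem x (rootseq p) = mup x p.
Proof. by move=> mp; rewrite [in RHS](rootsE mp) mu_prod_XsubC. Qed.

Lemma deriv_sqr_root q x : (q * ('X - x%:P) ^+ 2)^`().[x] = 0.
Proof.
have : ('X - x%:P).[x] = 0 by rewrite hornerXsubC subrr.
move: ('X - x%:P) => L L0; rewrite expr2 !derivM !(hornerD, hornerM) L0.
by rewrite !(mul0r, mulr0, addr0).
Qed.

Lemma uniq_roots p : p \is monic -> {in rootseq p, forall x, p^`().[x] != 0} ->
  uniq (rootseq p).
Proof.
move=> mp h; apply: count_mem_uniq => x; rewrite count_roots //.
have pN0 := monic_neq0 mp.
have [xp|xp] := boolP (x \in rootseq p); last first.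
  by rewrite mupNroot // -mem_roots.
apply/eqP; rewrite eqn_leq -XsubC_dvd // dvdp_XsubCl -mem_roots // xp andbT.
rewrite mup_leq //; apply: contra (h x xp) => /dvdpP[q ->].
by rewrite deriv_sqr_root.
Qed.

(** It does not vanish at a point whose fibre under [f] avoids the zeros of [q]. *)
Definition fibre_away f q := \prod_(r <- rootseq q) (f - (f.[r])%:P).

Lemma fibre_away_neq0 f q : (1 < size f)%N -> fibre_away f q != 0.
Proof.
move=> sf; rewrite /fibre_away prodf_seq_neq0; apply/allP => r _ /=.
apply: contraTneq sf => /eqP; rewrite subr_eq0 => /eqP ->.
by rewrite -leqNgt size_polyC_leq1.
Qed.

Lemma fibre_awayP f q c y : q != 0 -> (fibre_away f q).[c] != 0 ->
  f.[y] = f.[c] -> q.[y] != 0.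
Proof.
move=> qN0 h e; apply: contra h => qy.
have yr : y \in rootseq q by rewrite mem_rootsN0.
rewrite /fibre_away horner_prod; apply/eqP; move: yr; elim: (rootseq q) => //= r s IH.
rewrite inE big_cons => /orP[/eqP <-|/IH ->]; last by rewrite mulr0.
by rewrite !(hornerD, hornerN, hornerC) e subrr mul0r.
Qed.

End RootsMore.

Section Gauss.
Variable k : closedFieldType.
Implicit Types (D G Q A : {poly {poly k}}) (b c : {poly k}) (r x y : k).

Local Notation "P `@ x" := (map_poly (horner_eval x) P) (at level 2).

Lemma coef_eval_inner D r j : (D`@r)`_j = (D`_j).[r].
Proof. by rewrite coef_map. Qed.

Lemma factor_inner Q r : Q`@r = 0 -> exists Q1, Q = ('X - r%:P) *: Q1.
Proof.
move=> e; exists (map_poly (fun p => p %/ ('X - r%:P)) Q); apply/polyP => j.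
rewrite coefZ coef_map_id0 ?div0p // mulrC divpK // dvdp_XsubCl.
by rewrite /root -coef_eval_inner e coef0.
Qed.

(** Removing the factors ['X - r] of the leading coefficient that divide all the
    coefficients. *)
Lemma primitive_part D : D != 0 ->
  exists b G, [/\ b != 0, D = b *: G & forall x, G`@x != 0].
Proof.
elim: {D}_.+1 {-2}D (ltnSn (size (lead_coef D))) => // N IH D leN DN0.
have lN0 : lead_coef D != 0 by rewrite lead_coef_eq0.
have [/hasP[r _ /eqP e]|nh] := boolP (has (fun r => D`@r == 0) (rootseq (lead_coef D))).
  have [D1 e1] := factor_inner e.
  have XN0 : 'X - r%:P != 0 by rewrite polyXsubC_eq0.
  have D1N0 : D1 != 0 by apply: contraNneq DN0 => D10; rewrite e1 D10 scaler0.
  have [|b [G [bN0 eG hG]]] := IH D1 _ D1N0.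
    move: leN; rewrite e1 lead_coefZ size_mul ?lead_coef_eq0 // size_XsubC.
    by rewrite addSn /= add1n ltnS.
  exists (('X - r%:P) * b), G; split=> //; first by rewrite mulf_neq0.
  by rewrite e1 eG scalerA.
exists 1, D; split=> //; [exact: oner_neq0|by rewrite scale1r|].
move=> x; apply: contra nh => e; apply/hasP; exists x => //.
rewrite mem_rootsN0 // /root lead_coefE -coef_eval_inner.
by rewrite (eqP e) coef0.
Qed.

(** Gauss's lemma: [G] vanishes identically at no [x], so each root of [c] is a root
    of all coefficients of [Q]. *)
Lemma gauss_exact A G Q c : c != 0 -> (forall x, G`@x != 0) -> c *: A = G * Q ->
  exists Q', A = G * Q'.
Proof.
elim: {c}_.+1 {-2}c Q (ltnSn (size c)) => // N IH c Q leN cN0 hG e.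
have [s1|s1] := eqVneq (size c) 1%N.
  have ec : c = (c`_0)%:P by apply: size1_polyC; rewrite s1.
  have c0 : c`_0 != 0 by apply: contra cN0 => /eqP c0; rewrite ec c0.
  exists ((c`_0)^-1%:P *: Q); rewrite -scalerAr -e scalerA ec -polyCM coefC /=.
  by rewrite mulVf // scale1r.
have /closed_rootP[r rc] := s1.
have Qr : Q`@r = 0.
  have := congr1 (fun P => P`@r) e; rewrite rmorphM /= map_polyZ /=.
  rewrite /horner_eval (eqP rc) scale0r => /esym/eqP.
  by rewrite mulf_eq0 (negPf (hG r)) => /eqP.
have [Q1 eQ] := factor_inner Qr.
have /factor_theorem[c1 ec] := rc.
have XN0 : 'X - r%:P != 0 by rewrite polyXsubC_eq0.
have c1N0 : c1 != 0 by apply: contraNneq cN0 => h; rewrite ec h mul0r.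
apply: (IH c1 Q1) => //.
  move: leN; rewrite ec size_mul // size_XsubC addn2 /= ltnS; exact: leq_trans.
have XPN0 : ('X - r%:P)%:P != 0 :> {poly {poly k}} by rewrite polyC_eq0.
apply: (mulfI XPN0); rewrite !mul_polyC.
by rewrite scalerA mulrC -ec e eQ -scalerAr.
Qed.

Lemma horner_horner2 A b y : A.[b].[y] = (A`@y).[b.[y]].
Proof.
elim/poly_ind: A => [|A c IH]; first by rewrite rmorph0 !horner0.
by rewrite !rmorphD !rmorphM /= map_polyX map_polyC /= !hornerE IH.
Qed.

End Gauss.

Section Luroth.
Variable k : closedFieldType.
Local Notation "P `@ x" := (map_poly (horner_eval x) P) (at level 2).
Variables (d m n : nat) (f1 f2 U V : {poly k}).
Hypotheses (d0 : (0 < d)%N) (m0 : (0 < m)%N) (n0 : (0 < n)%N) (co : coprime m n).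
Hypotheses (hf1 : monic_deg (d * m) f1) (hf2 : monic_deg (d * n) f2).
Hypotheses (hU : monic_deg n U) (hV : monic_deg m V).
Hypothesis (eUV : U \Po f1 = V \Po f2).
Hypotheses (nN0 : n%:R != 0 :> k) (dnN0 : (d * n)%:R != 0 :> k).

Let dn0 : (0 < d * n)%N. Proof. by rewrite muln_gt0 d0. Qed.
Let dm0 : (0 < d * m)%N. Proof. by rewrite muln_gt0 d0. Qed.
Let sf1 : (1 < size f1)%N. Proof. by rewrite (monic_deg_size hf1). Qed.
Let sf2 : (1 < size f2)%N. Proof. by rewrite (monic_deg_size hf2). Qed.

Definition common_fibre c := [seq y <- rootseq (f2 - (f2.[c])%:P) | f1.[y] == f1.[c]].

Lemma mem_common_fibre c y :
  (y \in common_fibre c) = (f1.[y] == f1.[c]) && (f2.[y] == f2.[c]).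
Proof. by rewrite mem_filter (mem_roots_sub _ _ dn0 hf2). Qed.

Lemma deriv_monic_neq0 (N : nat) (p : {poly k}) :
  N%:R != 0 :> k -> monic_deg N p -> p^`() != 0.
Proof.
move=> NN0 /monic_degP[/monicP mp sp]; apply: contraNneq NN0 => e.
case: N sp => [|N] sp; first by rewrite mulr0n.
have := congr1 (fun q : {poly k} => q`_N) e; rewrite coef_deriv coef0.
by move: mp; rewrite lead_coefE sp /= => -> ->.
Qed.

(** By [fibre_polyE], [d] of the roots of [f2 - f2.[c]] have the same value [f1.[c]]
    when this value is a simple root of [U - V.[f2.[c]]]. *)
Lemma generic_fibre : exists2 q : {poly k}, q != 0 & forall c, q.[c] != 0 ->
  uniq (rootseq (f2 - (f2.[c])%:P)) /\ size (common_fibre c) = d.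
Proof.
have f2'N0 := deriv_monic_neq0 dnN0 hf2; have U'N0 := deriv_monic_neq0 nN0 hU.
exists (fibre_away f2 (f2^`()) * (U^`() \Po f1)).
  rewrite mulf_neq0 ?fibre_away_neq0 //; apply: contra U'N0 => /eqP e.
  by apply/eqP; apply: (comp_poly_inj sf1); rewrite e comp_poly0.
move=> c; rewrite hornerM mulf_eq0 negb_or horner_comp => /andP[h1 h2].
have hm := monic_degB (f2.[c]) dn0 hf2.
split.
  apply: uniq_roots => [|x]; first exact: monic_deg_monic hm.
  rewrite (mem_roots_sub _ _ dn0 hf2) derivB derivC subr0 => /eqP e.
  exact: (fibre_awayP f2'N0 h1 e).
have hF := fibre_polyE d0 m0 n0 co hf1 hf2 hU hV eUV (f2.[c]).
have := congr1 (mup f1.[c]) hF.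
have eq1 : fibre_poly f1 f2 f2.[c] = \prod_(z <- [seq f1.[x] | x <- rootseq (f2 - f2.[c]%:P)]) ('X - z%:P).
  by rewrite /fibre_poly big_map.
rewrite eq1 mu_prod_XsubC count_map -size_filter => e.
have -> : size (common_fibre c) = mup f1.[c] ((U - (V.[f2.[c]])%:P) ^+ d).
  by rewrite -e; congr size; apply: eq_filter => y /=.
have hm2 : monic_deg n (U - (V.[f2.[c]])%:P) by apply: monic_degB.
have ru : root (U - (V.[f2.[c]])%:P) f1.[c].
  by rewrite /root !hornerE -!horner_comp eUV subrr.
have -> : mup f1.[c] ((U - (V.[f2.[c]])%:P) ^+ d) =
    (d * mup f1.[c] (U - (V.[f2.[c]])%:P))%N.
  elim: (d) => [|j IH]; first by rewrite expr0 mupNroot // root1.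
  by rewrite exprS mupM ?IH ?mulSn // ?expf_neq0 // (monic_deg_neq0 hm2).
suff -> : mup f1.[c] (U - (V.[f2.[c]])%:P) = 1%N by rewrite muln1.
have N0 := monic_deg_neq0 hm2.
apply/eqP; rewrite eqn_leq -XsubC_dvd // dvdp_XsubCl ru andbT mup_leq //.
apply: contra h2 => /dvdpP[q eq2].
have -> : U^`() = (U - (V.[f2.[c]])%:P)^`() by rewrite derivB derivC subr0.
by rewrite eq2 deriv_sqr_root.
Qed.

Local Notation diff_poly f := (plane_curve f f).
Implicit Types (f : {poly k}) (A Q : {poly {poly k}}).

Lemma diff_poly_neq0 N f : (0 < N)%N -> monic_deg N f ->
  diff_poly f != 0 /\ lead_coef (diff_poly f) = 1.
Proof.
by move=> N0 hf; have [mM _] := plane_curve_monic f N0 hf; rewrite monic_neq0 // (monicP mM).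
Qed.

Lemma swap_diff_poly f : swapXY (diff_poly f) = - diff_poly f.
Proof.
rewrite /plane_curve -[LHS]/(swapXY (map_poly polyC f - f%:P)) raddfB /=.
by rewrite swapXY_map_polyC swapXY_polyC opprB.
Qed.

(** The greatest common divisor of [f1(X) - f1(x)] and [f2(X) - f2(x)], made
    primitive in [x], vanishes exactly on the common fibre of a generic [x]; it is
    symmetric in the two variables up to sign, which bounds its degree in [x]. *)
Lemma common_fibre_poly : exists G : {poly {poly k}},
  (exists2 t, t != 0 & lead_coef G = t%:P) /\ (forall j, (size (G`_j)%R <= d.+1)%N) /\
  exists2 q : {poly k}, q != 0 & forall c, q.[c] != 0 ->
    [/\ uniq (common_fibre c), size (common_fibre c) = d &
        G`@c = (lead_coef G).[c] *: \prod_(y <- common_fibre c) ('X - y%:P)].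
Proof.
have [A1N0 l1] := diff_poly_neq0 dm0 hf1; have [A2N0 l2] := diff_poly_neq0 dn0 hf2.
set A1 := diff_poly f1 in A1N0 l1; set A2 := diff_poly f2 in A2N0 l2.
have A1E c : A1`@c = f1 - (f1.[c])%:P := plane_curve_eval f1 f1 c.
have A2E c : A2`@c = f2 - (f2.[c])%:P := plane_curve_eval f2 f2 c.
set D := gcdp A1 A2.
have DN0 : D != 0 by rewrite gcdp_eq0 negb_and A1N0.
have [b [G [bN0 eD hG]]] := primitive_part DN0.
have dvdG A : D %| A -> exists Q, A = G * Q.
  move=> /Pdiv.Idomain.dvdpP[[c qq] /= cN0 e]; apply: (gauss_exact cN0 hG (Q := b *: qq)).
  by rewrite e eD -!scalerAr mulrC.
have [Q1 e1] := dvdG _ (dvdp_gcdl A1 A2).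
have [Q2 e2] := dvdG _ (dvdp_gcdr A1 A2).
have [t et] : exists t, lead_coef G = t%:P.
  have : lead_coef G * lead_coef Q1 = 1 by rewrite -lead_coefM -e1.
  move=> h; have : lead_coef G \is a GRing.unit.
    by apply/unitrPr; exists (lead_coef Q1).
  by rewrite poly_unitE => /andP[/eqP s1 _]; exists (lead_coef G)`_0; apply: size1_polyC; rewrite s1.
have tN0 : t != 0.
  by apply: contraNneq DN0 => t0; rewrite eD -lead_coef_eq0 lead_coefZ et t0 mulr0.
have sGD : size D = size G by rewrite eD size_scale.
have hsw : (size (swapXY G) <= size G)%N.
  rewrite -sGD; apply: dvdp_leq => //; rewrite dvdp_gcd.
  have aux A Q : swapXY A = - A -> A = G * Q -> swapXY G %| A.
    by move=> sA eA; rewrite -dvdpNr -sA eA rmorphM /= dvdp_mulr.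
  by rewrite (aux _ _ (swap_diff_poly f1) e1) (aux _ _ (swap_diff_poly f2) e2).
have [[u v] /= /eqpP[[c1 c2] /= /andP[c1N0 c2N0] eB]] := Bezoutp A1 A2.
have [q0 q0N0 hq0] := generic_fibre.
have c2bN0 : c2 * b != 0 by rewrite mulf_neq0.
have key c : (q0 * (c2 * b)).[c] != 0 ->
    [/\ uniq (common_fibre c), size (common_fibre c) = d &
        G`@c = (lead_coef G).[c] *: \prod_(y <- common_fibre c) ('X - y%:P)].
  rewrite hornerM mulf_eq0 negb_or => /andP[/hq0 [ur sz] cb].
  have ucf : uniq (common_fibre c) by apply: filter_uniq.
  split=> //.
  have lG : lead_coef G`@c = t.
    have lc : horner_eval c (lead_coef G) = t by rewrite et /horner_eval hornerC.
    by rewrite lead_coef_map_eq /= lc.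
  have GcN0 : G`@c != 0 by apply: hG.
  have mG : t^-1 *: G`@c \is monic by rewrite monicE lead_coefZ lG mulVf.
  have hm2 := monic_degB (f2.[c]) dn0 hf2.
  rewrite et hornerC; apply: (scalerI (a := t^-1)); first by rewrite invr_eq0.
  rewrite scalerA mulVf // scale1r [LHS](rootsE mG); apply: perm_big.
  have ur' : uniq (rootseq (t^-1 *: G`@c)).
    apply: count_mem_uniq => y; rewrite count_roots //.
    have [yr|yr] := boolP (y \in _); last first.
      by rewrite mupNroot // -mem_roots.
    apply/eqP; rewrite eqn_leq -XsubC_dvd ?monic_neq0 // dvdp_XsubCl -mem_roots // yr andbT.
    have f2N0 := monic_deg_neq0 hm2.
    have : (mup y (f2 - (f2.[c])%:P) <= 1)%N.
      by rewrite -count_roots ?(monic_deg_monic hm2) // count_uniq_mem // leq_b1.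
    have eA : f2 - (f2.[c])%:P = (t^-1 *: G`@c) * (t *: Q2`@c).
      by rewrite -scalerAl -scalerAr scalerA mulVf // scale1r -A2E e2 rmorphM.
    have : (t *: Q2`@c) != 0 by apply: contraNneq f2N0 => h; rewrite eA h mulr0.
    by move=> h; rewrite eA mupM ?(monic_neq0 mG) //; apply: leq_trans; apply: leq_addr.
  apply: uniq_perm => // y; rewrite mem_roots // rootZ ?invr_eq0 // mem_common_fibre.
  apply/idP/andP => [ry|[/eqP y1 /eqP y2]].
    have aux f Q : diff_poly f = G * Q -> f.[y] == f.[c].
      move=> /(congr1 (fun P => (P`@c).[y])); rewrite plane_curve_eval rmorphM hornerM.
      by rewrite (eqP ry) mul0r !(hornerD, hornerN, hornerC) => /eqP; rewrite subr_eq0.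
    by rewrite (aux _ _ e1) (aux _ _ e2).
  have := congr1 (fun P => (P`@c).[y]) eB.
  rewrite -/D eD scalerA !map_polyZ !rmorphD !rmorphM /= A1E A2E !hornerZ hornerD !hornerM.
  rewrite !(hornerD, hornerN, hornerC) y1 y2 !subrr !mulr0 addr0 mulr0.
  move/esym/eqP; rewrite mulf_eq0 => /orP[|//].
  by rewrite -hornerM (negPf cb).
have szG : size G = d.+1.
  have [|c hc] := @generic_point _ (q0 * (c2 * b)); first by rewrite mulf_neq0.
  have [_ sz eG] := key c hc.
  have <- : size G`@c = size G.
    rewrite size_map_poly_id0 // et /horner_eval hornerC //.
  by rewrite eG et hornerC size_scale // size_prod_XsubC sz.
exists G; split; first by exists t.
split=> [j|]; last by exists (q0 * (c2 * b)) => //; rewrite mulf_neq0.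
rewrite -szG; apply: leq_trans hsw; rewrite -sizeYE; exact: max_size_coefXY.
Qed.

(** As in a proof of Lueroth's theorem, a nonconstant coefficient of the polynomial
    of the common fibre is the right factor. *)
Lemma common_right_factor_fibre : exists (h q : {poly k}), size h = d.+1 /\ q != 0 /\
  forall c, q.[c] != 0 -> exists s, [/\ uniq s, size s = d &
    {in s, forall y, [/\ f1.[y] = f1.[c], f2.[y] = f2.[c] & h.[y] = h.[c]]}].
Proof.
have [G [[t tN0 et] [sG [q0 q0N0 hq0]]]] := common_fibre_poly.
pose q := q0 * fibre_away f1 q0.
have qN0 : q != 0 by rewrite mulf_neq0 ?fibre_away_neq0.
have key c : q.[c] != 0 -> {in common_fibre c, forall y, forall j, (G`_j).[y] = (G`_j).[c]}.
  rewrite hornerM mulf_eq0 negb_or => /andP[c0 c1] y yS j.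
  have := yS; rewrite mem_common_fibre => /andP[/eqP y1 /eqP y2].
  have [_ _ eGc] := hq0 c c0.
  have [_ _ eGy] := hq0 y (fibre_awayP q0N0 c1 y1).
  have eS : common_fibre y = common_fibre c by rewrite /common_fibre y1 y2.
  by rewrite -!coef_eval_inner eGc eGy eS et !hornerC.
have [j hj] : exists j, (1 < size (G`_j)%R)%N.
  have [/existsP[j hj]|nj] := boolP [exists j : 'I_(size G), (1 < size (G`_j)%R)%N].
    by exists j.
  pose g : {poly k} := map_poly (horner_eval 0) G.
  have eG : G = map_poly polyC g.
    apply/polyP => j; rewrite !coef_map /= /horner_eval.
    have [lt|le] := ltnP j (size G).
      move/existsPn: nj => /(_ (Ordinal lt)) /=; rewrite -leqNgt => /size1_polyC e.
      by rewrite e hornerC.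
    by rewrite nth_default // horner0.
  have Gg c : G`@c = g.
    by rewrite {1}eG -map_poly_comp map_poly_id // => z _ /=; rewrite /horner_eval hornerC.
  have g0 : g = 0.
    apply: (poly_eq0_generic q0N0) => c /hq0[_ _]; rewrite Gg => ->.
    have : c \in common_fibre c by rewrite mem_common_fibre !eqxx.
    move=> cS; have /rootP r : root (\prod_(y <- common_fibre c) ('X - y%:P)) c.
      by rewrite root_prod_XsubC.
    by rewrite hornerZ r mulr0.
  have [c hc] := generic_point q0N0; have [_ _ e] := hq0 c hc.
  have : \prod_(y <- common_fibre c) ('X - y%:P) = 0.
    move: e; rewrite et hornerC Gg g0 => /esym/eqP.
    by rewrite scaler_eq0 (negPf tN0) => /eqP.
  by move/eqP; rewrite (negPf (monic_neq0 (monic_prod_XsubC _ _ _))).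
exists (G`_j), q; split; last split=> //.
  apply/eqP; rewrite eqn_leq sG /=.
  have [c hc] := generic_point qN0; have hcS := key c hc.
  move: (hc); rewrite hornerM mulf_eq0 negb_or => /andP[/hq0[us sz _] _].
  have hN0 : G`_j - ((G`_j).[c])%:P != 0.
    apply: contraTneq hj => /eqP; rewrite subr_eq0 => /eqP ->.
    by rewrite -leqNgt size_polyC_leq1.
  have := max_poly_roots hN0 _ us; rewrite sz => lt.
  have eS : size (G`_j - ((G`_j).[c])%:P)%R = size (G`_j)%R.
    by rewrite size_polyDl // size_polyN (leq_ltn_trans (size_polyC_leq1 _)).
  rewrite -eS; apply: lt; apply/allP => y yS.
  by rewrite /root !(hornerD, hornerN, hornerC) (hcS y yS) subrr.
move=> c hc; exists (common_fibre c).
move: (hc); rewrite hornerM mulf_eq0 negb_or => /andP[/hq0[us sz _] _].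
split=> // y yS; split; last exact: key.
  by move: yS; rewrite mem_common_fibre => /andP[/eqP].
by move: yS; rewrite mem_common_fibre => /andP[_ /eqP].
Qed.

Lemma expansion_in (h f : {poly k}) : size h = d.+1 -> exists2 A, f = A.[h] &
  forall j, (size (A`_j)%R <= d)%N.
Proof.
move=> sh; elim: {f}_.+1 {-2}f (ltnSn (size f)) => // N IH f leN.
have hN0 : h != 0 by rewrite -size_poly_gt0 sh.
have [sm|sb] := ltnP (size f) (size h).
  exists f%:P; first by rewrite hornerC.
  by move=> [|j]; rewrite coefC /= ?size_poly0 // -ltnS -sh.
have [|A eA hA] := IH (f %/ h).
  rewrite size_divp // sh; move: leN sb; rewrite sh; move: (size f) => s; move: d0; lia.
exists (A * 'X + (f %% h)%:P).
  by rewrite !hornerE -eA -divp_eq.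
move=> [|j]; rewrite coefD coefMX coefC /= ?add0r ?addr0 //.
by rewrite -ltnS -sh ltn_modp.
Qed.

(** A polynomial taking equal values on generic fibres of [h] of full size is a
    polynomial in [h]: its [h]-adic digits have too many repeated values to be
    nonconstant. *)
Lemma factor_through (f h q : {poly k}) : size h = d.+1 -> q != 0 ->
  (forall c, q.[c] != 0 -> exists s, [/\ uniq s, size s = d &
    {in s, forall y, f.[y] = f.[c] /\ h.[y] = h.[c]}]) ->
  exists F, f = F \Po h.
Proof.
move=> sh qN0 hs; have [A eA hA] := expansion_in f sh.
have sh1 : (1 < size h)%N by rewrite sh.
suff e0 j : (swapXY A)`_j.+1 = 0.
  exists ((swapXY A)`_0); rewrite /comp_poly eA; congr _.[_].
  by apply/polyP => i; apply/polyP => -[|j]; rewrite -coef_swapXY coef_map coefC //= e0 coef0.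
apply: (comp_poly_inj sh1); rewrite comp_poly0; apply: (poly_eq0_generic qN0) => c.
case/hs => s [us ss es]; rewrite horner_comp.
have -> : ((swapXY A)`_j.+1).[h.[c]] = (A.[(h.[c])%:P])`_j.+1.
  by rewrite horner_polyC coef_map.
suff /eqP : A.[(h.[c])%:P] - (f.[c])%:P = 0.
  by rewrite subr_eq0 => /eqP ->; rewrite coefC.
apply: (eq_poly_uniq_points us).
- apply: leq_trans (size_polyD _ _) _; rewrite size_polyN geq_max ss.
  rewrite (leq_trans (size_polyC_leq1 _)) // andbT.
  by apply: leq_trans (max_size_evalC _ _) _; apply/bigmax_leqP => i _.
- by rewrite size_poly0.
move=> y /es[y1 y2]; rewrite horner0 !(hornerD, hornerN, hornerC) -y1 -y2.
have -> : f.[y] = A.[h].[y] by rewrite -eA.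
by rewrite !horner_horner2 hornerC subrr.
Qed.

Lemma common_right_factor : exists h F1 F2, [/\ monic_deg d h /\ h`_0 = 0,
  monic_deg m F1, monic_deg n F2, f1 = F1 \Po h & f2 = F2 \Po h].
Proof.
have [h1 [q [sh [qN0 hq]]]] := common_right_factor_fibre.
have lN0 : lead_coef h1 != 0 by rewrite lead_coef_eq0 -size_poly_gt0 sh.
pose h := (lead_coef h1)^-1 *: (h1 - (h1`_0)%:P).
have hh : monic_deg d h.
  have lt : (size (- (h1`_0)%:P) < size h1)%N.
    by rewrite sh size_polyN (leq_ltn_trans (size_polyC_leq1 _)).
  apply/monic_degP; rewrite monicE lead_coefZ size_scale ?invr_eq0 // size_polyDl //.
  by rewrite lead_coefDl // mulVf.
have sz : size h = d.+1 := monic_deg_size hh.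
have hs f : f = f1 \/ f = f2 -> forall c, q.[c] != 0 -> exists s, [/\ uniq s, size s = d &
    {in s, forall y, f.[y] = f.[c] /\ h.[y] = h.[c]}].
  move=> ef c /hq[s [us ss es]]; exists s; split=> // y /es[y1 y2 y3].
  split; first by case: ef => ->.
  by rewrite /h !hornerZ !(hornerD, hornerN, hornerC) y3.
have [F1 e1] := factor_through sz qN0 (hs f1 (or_introl erefl)).
have [F2 e2] := factor_through sz qN0 (hs f2 (or_intror erefl)).
have aux N F f : monic_deg (d * N) f -> f = F \Po h -> monic_deg N F.
  move=> hf e; have s1 : (1 < size h)%N by rewrite sz.
  have := size_comp_poly F h; rewrite -e sz (monic_deg_size hf) /= mulnC => /eqP.
  rewrite eqn_pmul2r // => /eqP eN.
  have lF : lead_coef F = 1.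
    have := monicP (monic_deg_monic hf); rewrite e lead_coef_comp //.
    by rewrite (monicP (monic_deg_monic hh)) expr1n mulr1.
  apply/monic_degP; rewrite monicE lF; split=> //; rewrite eN prednK // size_poly_gt0.
  by rewrite -lead_coef_eq0 lF oner_neq0.
exists h, F1, F2; split=> //; [split=> //|exact: aux e1|exact: aux e2].
by rewrite /h coefZ coefB coefC subrr mulr0.
Qed.

End Luroth.

(** * Ramification of a composite *)

Section Mult.
Variable k : closedFieldType.
Implicit Types (p q f g h : {poly k}) (x y z : k).

Lemma mup_rootseq p x : p != 0 -> mup x p = count_mem x (rootseq p).
Proof.
rewrite /rootseq; case: closed_field_poly_normal => r /= e pN0.
have mN0 : \prod_(z <- r) ('X - z%:P) != 0 := monic_neq0 (monic_prod_XsubC _ _ _).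
rewrite [in LHS]e -mul_polyC mupM ?polyC_eq0 ?lead_coef_eq0 //.
by rewrite mupNroot ?mu_prod_XsubC // rootC lead_coef_eq0.
Qed.

Lemma size_rootseq p : p != 0 -> size (rootseq p) = (size p).-1.
Proof.
rewrite /rootseq; case: closed_field_poly_normal => r /= e pN0.
by rewrite [in RHS]e size_scale ?lead_coef_eq0 // size_prod_XsubC.
Qed.

Lemma sum_count_mem (T : eqType) (s r : seq T) : uniq s ->
  (\sum_(x <- s) count_mem x r)%N = count (mem s) r.
Proof.
move=> us; elim: r => [|y r IH] /=; first by rewrite big1_eq.
rewrite big_split /= IH; congr addn; rewrite -(count_uniq_mem _ us).
elim: (s) => [|z s' IHs] /=; first by rewrite big_nil.
by rewrite big_cons IHs eq_sym.
Qed.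

Lemma sum_mup_le p (s : seq k) : p != 0 -> uniq s ->
  (\sum_(x <- s) mup x p <= (size p).-1)%N.
Proof.
move=> pN0 us; under eq_bigr do rewrite mup_rootseq //.
by rewrite sum_count_mem // -size_rootseq // count_size.
Qed.

Lemma sum_mup_eq p (s : seq k) : p != 0 -> uniq s -> {subset rootseq p <= s} ->
  (\sum_(x <- s) mup x p = (size p).-1)%N.
Proof.
move=> pN0 us sub; under eq_bigr do rewrite mup_rootseq //.
rewrite sum_count_mem // -size_rootseq //; apply/eqP; rewrite -all_count.
exact/allP.
Qed.

Lemma mupX p n x : p != 0 -> mup x (p ^+ n) = (n * mup x p)%N.
Proof.
move=> pN0; elim: n => [|n IH]; first by rewrite expr0 mupNroot // root1.
by rewrite exprS mupM ?expf_neq0 // IH mulSn.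
Qed.

Lemma mup_factor p x : p != 0 ->
  exists2 q, p = q * ('X - x%:P) ^+ (mup x p) & ~~ root q x.
Proof.
move=> pN0; have := leqnn (mup x p); rewrite mup_geq // => /dvdpP[q e].
exists q => //; have qN0 : q != 0 by apply: contraNneq pN0 => q0; rewrite e q0 mul0r.
apply/negP => rq; have := congr1 (mup x) e.
rewrite mupM ?expf_neq0 ?polyXsubC_eq0 // mup_XsubCX eqxx => /eqP.
have : (0 < mup x q)%N by rewrite -XsubC_dvd // dvdp_XsubCl.
lia.
Qed.

Lemma mup_comp p q x : p != 0 -> (1 < size q)%N ->
  mup x (p \Po q) = (mup q.[x] p * mup x (q - (q.[x])%:P))%N.
Proof.
move=> pN0 sq; have [r e nr] := mup_factor q.[x] pN0.
have qN0 : q - (q.[x])%:P != 0.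
  apply: contraTneq sq => /eqP; rewrite subr_eq0 => /eqP ->.
  by rewrite -leqNgt size_polyC_leq1.
rewrite {1}e rmorphM rmorphXn /= rmorphB /= comp_polyX comp_polyC.
have nr' : ~~ root (r \Po q) x by rewrite /root horner_comp.
by rewrite mupMr // mupX.
Qed.

Definition mult p x := mup x (p - (p.[x])%:P).
Definition dmult p x := mup x p^`().
Definition fib p y := undup (rootseq (p - y%:P)).

Section OnePoly.
Variables (n : nat) (p : {poly k}).
Hypotheses (n0 : (0 < n)%N) (nN0 : n%:R != 0 :> k) (hp : monic_deg n p).

Let sp : (1 < size p)%N. Proof. by rewrite (monic_deg_size hp). Qed.

Lemma mem_fib y x : (x \in fib p y) = (p.[x] == y).
Proof. by rewrite mem_undup (mem_roots_sub _ _ n0 hp). Qed.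

Lemma fib_uniq y : uniq (fib p y). Proof. exact: undup_uniq. Qed.

Lemma sub_neq0 y : p - y%:P != 0.
Proof. exact: monic_deg_neq0 (monic_degB y n0 hp). Qed.

Lemma sum_mult y : (\sum_(x <- fib p y) mult p x)%N = n.
Proof.
transitivity (\sum_(x <- fib p y) mup x (p - y%:P))%N.
  rewrite !big_seq; apply: eq_bigr => x; rewrite mem_fib => /eqP e.
  by rewrite /mult e.
rewrite sum_mup_eq ?sub_neq0 ?fib_uniq //.
  by rewrite (monic_deg_size (monic_degB y n0 hp)).
by move=> x; rewrite mem_undup.
Qed.

Lemma deriv_neq0 : p^`() != 0.
Proof. exact: deriv_monic_neq0 hp. Qed.

Lemma size_deriv_tame : size p^`() = n.
Proof.
have /monic_degP[mp s] := hp.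
apply/eqP; rewrite eqn_leq; apply/andP; split.
  by rewrite -ltnS -s lt_size_deriv // monic_neq0.
case: (n) n0 nN0 s => // n' _ nN s; rewrite ltnNge; apply: contra nN => /leq_sizeP/(_ _ (leqnn _)).
rewrite coef_deriv; have := monicP mp; rewrite lead_coefE s /= => -> /eqP.
by [].
Qed.

Lemma mult_gt0 x : (0 < mult p x)%N.
Proof.
by rewrite -XsubC_dvd ?sub_neq0 // dvdp_XsubCl /root !(hornerD, hornerN, hornerC) subrr.
Qed.

Lemma deriv_factor x : exists2 q, ~~ root q x &
  p^`() = ('X - x%:P) ^+ (mult p x).-1 * (q^`() * ('X - x%:P) + q *+ mult p x).
Proof.
have [q e nr] := mup_factor x (sub_neq0 p.[x]); exists q => //.
have -> : p^`() = (p - (p.[x])%:P)^`() by rewrite derivB derivC subr0.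
rewrite e -/(mult p x); have := mult_gt0 x; case: (mult p x) => // j _.
by rewrite derivM deriv_exp derivXsubC /= exprS; ring.
Qed.

Lemma mult_le_dmult x : (mult p x <= (dmult p x).+1)%N.
Proof.
have [q nr e] := deriv_factor x.
rewrite -(prednK (mult_gt0 x)) ltnS /dmult mup_geq ?deriv_neq0 //.
by rewrite e dvdp_mulr.
Qed.

Lemma dmult_tame x : (mult p x)%:R != 0 :> k -> mult p x = (dmult p x).+1.
Proof.
move=> tN0; have [q nr e] := deriv_factor x.
have nr2 : ~~ root (q^`() * ('X - x%:P) + q *+ mult p x) x.
  rewrite /root hornerD hornerM hornerXsubC subrr mulr0 add0r hornerMn.
  by rewrite -mulr_natr mulf_neq0.
by rewrite /dmult e mupMl // mup_XsubCX eqxx prednK // mult_gt0.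
Qed.

Lemma dmult_wild x : (mult p x)%:R = 0 :> k -> (mult p x <= dmult p x)%N.
Proof.
move=> t0; have [q nr e] := deriv_factor x.
rewrite /dmult mup_geq ?deriv_neq0 //; rewrite -mulr_natr -polyC_natr t0 mulr0 addr0 in e.
rewrite e mulrCA -exprSr prednK ?mult_gt0 //; exact: dvdp_mull.
Qed.

Lemma dmult_unramified x : mult p x = 1%N -> dmult p x = 0%N.
Proof.
move=> e; have : (mult p x)%:R != 0 :> k by rewrite e oner_neq0.
by move/dmult_tame; rewrite e => -[].
Qed.

Lemma mult1_deriv x : (mult p x == 1%N) = (p^`().[x] != 0).
Proof.
apply/eqP/idP => [/dmult_unramified|nr].
  by apply: contra_eqN => r; rewrite -lt0n -XsubC_dvd ?deriv_neq0 // dvdp_XsubCl.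
have d0 : dmult p x = 0%N by rewrite /dmult mupNroot.
by have := mult_le_dmult x; have := mult_gt0 x; rewrite d0; lia.
Qed.

End OnePoly.
End Mult.

Lemma uniq_flatten_key (T1 T2 : eqType) (key : T2 -> T1) (s : seq T1) (F : T1 -> seq T2) :
  uniq s -> {in s, forall i, uniq (F i)} ->
  {in s, forall i, {in F i, forall x, key x = i}} -> uniq (flatten [seq F i | i <- s]).
Proof.
elim: s => //= i s IH /andP[nis us] uF kF; rewrite cat_uniq uF ?inE ?eqxx //=.
rewrite IH //; last 2 first.
- by move=> j js; apply: uF; rewrite inE js orbT.
- by move=> j js; apply: kF; rewrite inE js orbT.
rewrite andbT; apply/hasPn => x /flatten_mapP[j js xj].
apply: contra nis => xi; have <- : key x = i by apply: kF => //; rewrite inE eqxx.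
by rewrite (kF j) // inE js orbT.
Qed.

Section Pair.
Variable k : closedFieldType.
Variables (m n : nat) (f1 f2 U V : {poly k}).
Hypotheses (m1 : (1 < m)%N) (n1 : (1 < n)%N) (co : coprime m n).
Hypotheses (mN0 : m%:R != 0 :> k) (nN0 : n%:R != 0 :> k).
Hypotheses (hf1 : monic_deg m f1) (hf2 : monic_deg n f2).
Hypotheses (hU : monic_deg n U) (hV : monic_deg m V).
Hypothesis (eUV : U \Po f1 = V \Po f2).

Let m0 : (0 < m)%N := ltnW m1.
Let n0 : (0 < n)%N := ltnW n1.

Definition pts (u v : k) := [seq x <- fib f1 u | f2.[x] == v].

Lemma mem_pts u v x : (x \in pts u v) = (f1.[x] == u) && (f2.[x] == v).
Proof. by rewrite mem_filter (mem_fib m0 hf1) andbC. Qed.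

Lemma pts_uniq u v : uniq (pts u v).
Proof. exact: filter_uniq (fib_uniq _ _). Qed.

Lemma count_undup (T : eqType) (r : seq T) (P : pred T) :
  count P r = (\sum_(x <- undup r | P x) count_mem x r)%N.
Proof.
rewrite -big_filter sum_count_mem ?filter_uniq ?undup_uniq //.
apply: eq_in_count => x xr.
by rewrite -[RHS]/(x \in filter P (undup r)) mem_filter mem_undup xr andbT.
Qed.

(** The multiplicity of [u] in [fibre_poly f1 f2 v], which is [U - V.[v]]. *)
Lemma sum_mult2 u v : U.[u] = V.[v] -> (\sum_(x <- pts u v) mult f2 x)%N = mult U u.
Proof.
move=> euv.
have hf1' : monic_deg (1 * m) f1 by rewrite mul1n.
have hf2' : monic_deg (1 * n) f2 by rewrite mul1n.
have := fibre_polyE (ltn0Sn 0) m0 n0 co hf1' hf2' hU hV eUV v; rewrite expr1 => e.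
rewrite /mult euv -e.
have -> : fibre_poly f1 f2 v = \prod_(z <- [seq f1.[x] | x <- rootseq (f2 - v%:P)]) ('X - z%:P).
  by rewrite /fibre_poly big_map.
rewrite mu_prod_XsubC count_map count_undup -/(fib f2 v) -[RHS]big_filter.
have pe : perm_eq (pts u v) [seq x <- fib f2 v | preim (fun x => f1.[x]) (pred1 u) x].
  apply: uniq_perm; [exact: pts_uniq|exact: filter_uniq (fib_uniq _ _)|].
  by move=> x; rewrite mem_pts mem_filter (mem_fib n0 hf2).
rewrite (perm_big _ pe) !big_seq; apply: eq_bigr => x.
rewrite mem_filter (mem_fib n0 hf2) /mult => /andP[_ /eqP ->].
by rewrite mup_rootseq // (sub_neq0 n0 hf2).
Qed.

Lemma mult_composite x :
  (mult f1 x * mult U f1.[x] = mult f2 x * mult V f2.[x])%N.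
Proof.
have sf1 : (1 < size f1)%N by rewrite (monic_deg_size hf1).
have sf2 : (1 < size f2)%N by rewrite (monic_deg_size hf2).
have h1 := mup_comp x (sub_neq0 n0 hU (U.[f1.[x]])) sf1.
have h2 := mup_comp x (sub_neq0 m0 hV (V.[f2.[x]])) sf2.
rewrite mulnC -/(mult f1 x) -/(mult U f1.[x]) in h1.
rewrite mulnC -/(mult f2 x) -/(mult V f2.[x]) in h2.
rewrite -h1 -h2 !rmorphB /= !comp_polyC eUV.
by rewrite -!horner_comp eUV.
Qed.

Lemma dmult_composite x : (mult f1 x * dmult U f1.[x] + dmult f1 x =
  mult f2 x * dmult V f2.[x] + dmult f2 x)%N.
Proof.
have sf1 : (1 < size f1)%N by rewrite (monic_deg_size hf1).
have sf2 : (1 < size f2)%N by rewrite (monic_deg_size hf2).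
have U0 := deriv_neq0 nN0 hU; have V0 := deriv_neq0 mN0 hV.
have f10 := deriv_neq0 mN0 hf1; have f20 := deriv_neq0 nN0 hf2.
have cN0 (p q : {poly k}) : (1 < size q)%N -> p != 0 -> p \Po q != 0.
  by move=> sq; apply: contra_neq => e; apply: (comp_poly_inj sq); rewrite e comp_poly0.
have := congr1 (fun p => mup x p^`()) eUV; rewrite !deriv_comp !mupM ?cN0 //.
rewrite (mup_comp x U0 sf1) (mup_comp x V0 sf2) => h.
by rewrite [(mult f1 x * _)%N]mulnC [(mult f2 x * _)%N]mulnC.
Qed.

End Pair.

Section PairRamification.
Variable k : closedFieldType.
Variables (m n : nat) (f1 f2 U V : {poly k}).
Hypotheses (m1 : (1 < m)%N) (n1 : (1 < n)%N) (co : coprime m n).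
Hypotheses (mN0 : m%:R != 0 :> k) (nN0 : n%:R != 0 :> k).
Hypotheses (hf1 : monic_deg m f1) (hf2 : monic_deg n f2).
Hypotheses (hU : monic_deg n U) (hV : monic_deg m V).
Hypothesis (eUV : U \Po f1 = V \Po f2).

Let m0 : (0 < m)%N := ltnW m1.
Let n0 : (0 < n)%N := ltnW n1.
Let co' : coprime n m. Proof. by rewrite coprime_sym. Qed.
Local Notation pts := (pts f1 f2).

Lemma sum_mult1 u v : U.[u] = V.[v] -> (\sum_(x <- pts u v) mult f1 x)%N = mult V v.
Proof.
move=> e; rewrite -(sum_mult2 n1 m1 co' hf2 hf1 hV hU (esym eUV) (esym e)).
apply: perm_big; apply: uniq_perm; try exact: pts_uniq.
by move=> x; rewrite (mem_pts _ m1 hf1) (mem_pts _ n1 hf2) andbC.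
Qed.

Lemma pts_exist u v : U.[u] = V.[v] -> exists x, x \in pts u v.
Proof.
move=> e; have := sum_mult1 e; have := mult_gt0 m0 hV v.
case E : (pts u v) => [|x s]; first by rewrite big_nil => h1 h2; rewrite -h2 in h1.
by exists x; rewrite inE eqxx.
Qed.

Definition cdiff (f : {poly k}) u v := (\sum_(x <- pts u v) dmult f x)%N.

Lemma cdiff_balance u v : U.[u] = V.[v] ->
  (cdiff f1 u v + mult V v * dmult U u = cdiff f2 u v + mult U u * dmult V v)%N.
Proof.
move=> e; rewrite -(sum_mult1 e) -(sum_mult2 m1 n1 co hf1 hf2 hU hV eUV e).
rewrite /cdiff !big_distrl -!big_split /= !big_seq; apply: eq_bigr => x.
rewrite (mem_pts _ m1 hf1) => /andP[/eqP <- /eqP <-].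
by have := dmult_composite m1 n1 mN0 nN0 hf1 hf2 hU hV eUV x; lia.
Qed.

(** Each point over [(u, v)] has index over [v] a multiple of [e / gcd e f], so there
    are at most [gcd e f] points. *)
Lemma size_pts u v : U.[u] = V.[v] ->
  (size (pts u v) <= gcdn (mult U u) (mult V v))%N.
Proof.
move=> e; have eU := sum_mult2 m1 n1 co hf1 hf2 hU hV eUV e.
have u0 := mult_gt0 n0 hU u; have v0 := mult_gt0 m0 hV v.
have [p ep] := dvdnP (dvdn_gcdl (mult U u) (mult V v)).
have [q eq] := dvdnP (dvdn_gcdr (mult U u) (mult V v)).
have g0 : (0 < gcdn (mult U u) (mult V v))%N by rewrite gcdn_gt0 u0.
have p0 : (0 < p)%N by case: p ep => //; rewrite mul0n => h; rewrite h in u0.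
have cpq : coprime p q.
  by rewrite /coprime -(eqn_pmul2r g0) mul1n muln_gcdl -ep -eq.
rewrite -(leq_pmul2r p0) [leqRHS]mulnC -ep -eU -sum_const_seq.
apply: leq_sum_seq_in => x; rewrite (mem_pts _ m1 hf1) => /andP[/eqP e1 /eqP e2].
apply: dvdn_leq; first exact: mult_gt0 hf2 _.
have := mult_composite m1 n1 hf1 hf2 hU hV eUV x; rewrite e1 e2 => h1.
have /eqP : (mult f1 x * p * gcdn (mult U u) (mult V v) =
    mult f2 x * q * gcdn (mult U u) (mult V v))%N by rewrite -!mulnA -ep -eq.
rewrite eqn_pmul2r // => /eqP h.
by rewrite -(Gauss_dvdl _ cpq) -h dvdn_mull.
Qed.

Lemma cdiff2_bound u v : U.[u] = V.[v] ->
  (mult U u <= cdiff f2 u v + gcdn (mult U u) (mult V v))%N.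
Proof.
move=> e; rewrite -{1}(sum_mult2 m1 n1 co hf1 hf2 hU hV eUV e).
apply: leq_trans (leq_add (leqnn _) (size_pts e)).
rewrite -[size _]muln1 -sum_const_seq /cdiff -big_split /=.
apply: leq_sum_seq_in => x _; rewrite addn1; exact: (mult_le_dmult n0 nN0 hf2).
Qed.

Lemma cdiff1_bound u v : U.[u] = V.[v] ->
  (mult V v <= cdiff f1 u v + gcdn (mult U u) (mult V v))%N.
Proof.
move=> e; rewrite -{1}(sum_mult1 e).
apply: leq_trans (leq_add (leqnn _) (size_pts e)).
rewrite -[size _]muln1 -sum_const_seq /cdiff -big_split /=.
apply: leq_sum_seq_in => x _; rewrite addn1; exact: (mult_le_dmult m0 mN0 hf1).
Qed.

Definition critical_values := undup
  ([seq U.[u] | u <- rootseq U^`()] ++ [seq V.[v] | v <- rootseq V^`()]).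

Lemma sum_dmult (N : nat) (p : {poly k}) : (1 < N)%N -> N%:R != 0 :> k -> monic_deg N p ->
  {subset [seq p.[u] | u <- rootseq p^`()] <= critical_values} ->
  (\sum_(l <- critical_values) \sum_(u <- fib p l) dmult p u + 1 = N)%N.
Proof.
move=> N1 NN0 hp sub; have N0 := ltnW N1.
have pN0 := deriv_neq0 NN0 hp.
pose s := flatten [seq fib p l | l <- critical_values].
have us : uniq s.
  apply: (uniq_flatten_key (key := fun u => p.[u])); first exact: undup_uniq.
    by move=> l _; apply: fib_uniq.
  by move=> l _ u; rewrite (mem_fib N0 hp) => /eqP.
have -> : (\sum_(l <- critical_values) \sum_(u <- fib p l) dmult p u =
    \sum_(u <- s) dmult p u)%N.
  by rewrite big_flatten big_map.
rewrite /dmult sum_mup_eq // ?(size_deriv_tame N0 NN0 hp) ?addn1 ?prednK //.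
move=> u ur; apply/flatten_mapP; exists p.[u]; last by rewrite (mem_fib N0 hp).
by apply: sub; apply/mapP; exists u.
Qed.

Lemma sum_cdiff (N : nat) (f : {poly k}) : (0 < N)%N -> N%:R != 0 :> k -> monic_deg N f ->
  (\sum_(l <- critical_values) \sum_(u <- fib U l) \sum_(v <- fib V l) cdiff f u v + 1 <= N)%N.
Proof.
move=> N0 NN0 hf; pose s2 l u := flatten [seq pts u v | v <- fib V l].
pose s1 l := flatten [seq s2 l u | u <- fib U l].
pose s := flatten [seq s1 l | l <- critical_values].
have -> : (\sum_(l <- critical_values) \sum_(u <- fib U l) \sum_(v <- fib V l) cdiff f u v =
   \sum_(x <- s) dmult f x)%N.
  rewrite big_flatten big_map; apply: eq_bigr => l _.
  rewrite big_flatten big_map; apply: eq_bigr => u _.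
  by rewrite big_flatten big_map.
have us2 l u : uniq (s2 l u).
  apply: (uniq_flatten_key (key := fun x => f2.[x])); first exact: fib_uniq.
    by move=> v _; apply: pts_uniq.
  by move=> v _ x; rewrite (mem_pts _ m1 hf1) => /andP[_ /eqP].
have us1 l : uniq (s1 l).
  apply: (uniq_flatten_key (key := fun x => f1.[x])); first exact: fib_uniq.
    by move=> u _.
  move=> u _ x /flatten_mapP[v _].
  by rewrite (mem_pts _ m1 hf1) => /andP[/eqP].
have us : uniq s.
  apply: (uniq_flatten_key (key := fun x => U.[f1.[x]])); first exact: undup_uniq.
    by move=> u _.
  move=> l _ x /flatten_mapP[u uU] /flatten_mapP[v _].
  rewrite (mem_pts _ m1 hf1) => /andP[/eqP -> _].
  by move: uU; rewrite (mem_fib n0 hU) => /eqP.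
have pN0 := deriv_neq0 NN0 hf.
have := sum_mup_le pN0 us; rewrite (size_deriv_tame N0 NN0 hf) addn1 => h.
by apply: leq_ltn_trans h _; rewrite ltn_predL.
Qed.

(** The degrees are nonzero in the field, so the derivatives have the expected
    degrees, and the sums of multiplicities over all critical values are known. *)
Lemma composite_ramification :
  ramification n m critical_values (fib U) (fib V)
    (mult U) (dmult U) (mult V) (dmult V) (cdiff f2) (cdiff f1).
Proof.
have vals l u v : u \in fib U l -> v \in fib V l -> U.[u] = V.[v].
  by rewrite (mem_fib n0 hU) (mem_fib m0 hV) => /eqP -> /eqP ->.
split=> //.
- exact: undup_uniq.
- by move=> l _; apply: fib_uniq.
- by move=> l _; apply: fib_uniq.
- by move=> l _; apply: sum_mult.
- by move=> l _; apply: sum_mult.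
- move=> l _ u _; split; first exact: mult_gt0 hU _.
    exact: (mult_le_dmult n0 nN0 hU).
  exact: (dmult_unramified n0 hU).
- move=> l _ u _; split; first exact: mult_gt0 hV _.
    exact: (mult_le_dmult m0 mN0 hV).
  exact: (dmult_unramified m0 hV).
- by move=> l _ u v uR vR; apply: cdiff2_bound; apply: (vals l).
- by move=> l _ u v uR vR; apply: cdiff1_bound; apply: (vals l).
- by move=> l _ u v uR vR; apply: cdiff_balance; apply: (vals l).
- by apply: sum_dmult => // x; rewrite mem_undup mem_cat => ->.
- by apply: sum_dmult => // x; rewrite mem_undup mem_cat orbC => ->.
- exact: sum_cdiff.
- exact: sum_cdiff.
Qed.

End PairRamification.

(** * Pell equations characterising Dickson polynomials *)

Section LucasMore.
Variable R : comNzRingType.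
Implicit Types (x a : R).

Lemma lucasVW_add x a n : lucasV x a n + x * lucasW x a n = lucasW x a n.+1 *+ 2.
Proof.
case: n => [|n]; first by rewrite /=; ring.
by rewrite lucasVW lucasWS; ring.
Qed.

Lemma lucasW_double x a n :
  lucasW x a n.*2.+1 = lucasW x a n.+1 ^+ 2 - a * lucasW x a n ^+ 2 /\
  lucasW x a n.*2.+2 = lucasW x a n.+1 * (lucasW x a n.+2 - a * lucasW x a n).
Proof.
elim: n => [|n [h1 h2]]; first by rewrite /=; split; ring.
have e1 : lucasW x a n.+1.*2.+1 = lucasW x a n.+2 ^+ 2 - a * lucasW x a n.+1 ^+ 2.
  by rewrite doubleS lucasWS h1 h2 !lucasWS; ring.
split=> //; rewrite doubleS lucasWS -doubleS e1 doubleS h2 !lucasWS; ring.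
Qed.
End LucasMore.

Section Pell.
Variable K : fieldType.
Implicit Types (p q y F H A B : {poly K}) (a c d s : K).

Lemma monic_deg_lucasW y a n : monic_deg 1 y -> monic_deg n (lucasW y a%:P n.+1).
Proof.
move=> hy; elim: n {-2}n (leqnn n) => [|N IH] [|[|n]] le //.
- by rewrite /= /monic_deg monic1 size_poly1.
- by rewrite /= /monic_deg monic1 size_poly1.
- by rewrite /= mulr1 mulr0 subr0.
rewrite lucasWS; apply: monic_degD; last first.
  by rewrite -add1n; apply: monic_degM => //; apply: IH.
rewrite size_polyN mul_polyC (leq_trans (size_scale_leq _ _)) //.
by rewrite (monic_deg_size (IH n _)) // ltnW.
Qed.

(** The form [a ^ 2 - a b y + r b ^ 2] is the norm of [a - b t], where
    [t ^ 2 - y t + r = 0]. Multiplication by a unit replaces [(a, b)] by the smaller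
    pair [(b, (y b - a) / r)], up to a constant. *)
Lemma pell_descent y (r : K) d A B : r != 0 -> monic_deg 1 y -> (size B <= size A)%N ->
  A ^+ 2 - A * B * y + r%:P * B ^+ 2 = d%:P -> d != 0 ->
  exists c j, A = c *: lucasW y r%:P j.+1 /\ B = c *: lucasW y r%:P j.
Proof.
move=> r0 hy; elim: {B}_.+1 {-2}B A d (ltnSn (size B)) => // N IH b a d leN le e d0.
have [b0|bN0] := eqVneq b 0.
  have e1 : a ^+ 2 = d%:P by rewrite -e b0; ring.
  have : (size a <= 1)%N.
    have := congr1 (fun p : {poly K} => (size p).-1) e1.
    by rewrite /= size_exp size_polyC d0 /=; case: (size a) => [|[|t]] //=; lia.
  move/size1_polyC => ea; exists a`_0, 0%N; rewrite /= b0 scaler0; split=> //.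
  by rewrite {1}ea -mul_polyC mulr1.
have sb0 : (0 < size b)%N by rewrite size_poly_gt0.
have aN0 : a != 0 by rewrite -size_poly_gt0 (leq_trans sb0).
have sy := monic_deg_size hy; have yN0 := monic_deg_neq0 hy.
have syb : size (y * b) = (size b).+1 by rewrite size_mul // sy.
set t := y * b - a.
have eat : a * t = r%:P * b ^+ 2 - d%:P by rewrite -e /t; ring.
have st : (size t < size b)%N.
  have [->|tN0] := eqVneq t 0; first by rewrite size_poly0.
  have : (size (a * t)%R <= 2 * size b - 1)%N.
    rewrite eat; apply: leq_trans (size_polyD _ _) _; rewrite geq_max size_polyN.
    rewrite andbC; apply/andP; split; first by apply: leq_trans (size_polyC_leq1 _) _; lia.
    rewrite mul_polyC (leq_trans (size_scale_leq _ _)) //.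
    by rewrite expr2 size_mul // mul2n addnn subn1.
  rewrite size_mul // => h.
  have [st1 st2] : (size t <= size b)%N /\ (size t = size b -> size a = size b).
    by move: h le sb0; move: (size a) (size b) (size t); clear; lia.
  rewrite ltn_neqAle st1 andbT; apply/eqP => stb; have sab := st2 stb.
  have : size t = (size b).+1 by rewrite /t size_polyDl syb // size_polyN sab.
  by rewrite stb => /n_Sn.
have rP0 : r%:P != 0 :> {poly K} by rewrite polyC_eq0.
pose b' := r^-1 *: t.
have tb : t = r%:P * b' by rewrite mul_polyC scalerA divff // scale1r.
have sb' : size b' = size t by rewrite size_scale ?invr_eq0.
have [| | | |c [j [ej1 ej2]]] := IH b' b (d / r).
- by rewrite sb'; lia.
- by rewrite sb' ltnW.
- apply: (mulfI rP0); rewrite -polyCM [X in _ = X%:P]mulrCA divff // mulr1 -e.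
  have -> : r%:P * (b ^+ 2 - b * b' * y + r%:P * b' ^+ 2) =
    r%:P * b ^+ 2 - b * (r%:P * b') * y + (r%:P * b') ^+ 2 by ring.
  by rewrite -tb /t; ring.
- by rewrite mulf_neq0 ?invr_eq0.
exists c, j.+1; split=> //.
have -> : a = y * b - r%:P * b' by rewrite -tb /t; ring.
by rewrite lucasWS ej1 ej2 -!mul_polyC; ring.
Qed.

Lemma pell_lucas n y a d F H : 2%:R != 0 :> K -> a != 0 -> d != 0 -> monic_deg 1 y ->
  monic_deg n.+1 F -> monic_deg n H ->
  F ^+ 2 - (y ^+ 2 - (4%:R * a)%:P) * H ^+ 2 = d%:P -> F = lucasV y a%:P n.+1.
Proof.
move=> two a0 d0 hy hF hH e.
have hyH : monic_deg n.+1 (y * H) by rewrite -add1n; apply: monic_degM.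
pose A := 2%:R^-1 *: (F + y * H).
have eA : F = 2%:R%:P * A - y * H.
  by rewrite mul_polyC scalerA divff // scale1r addrK.
have /monic_degP[/monicP lF sF] := hF; have /monic_degP[/monicP lH sH] := hyH.
have A1 : A`_n.+1 = 1.
  rewrite coefZ coefD; move: lF lH; rewrite !lead_coefE sF sH /= => -> ->.
  by rewrite -mulr2n mulVf.
have hA : monic_deg n.+1 A.
  have sA : size A = n.+2.
    apply/eqP; rewrite eqn_leq; apply/andP; split.
      apply: leq_trans (size_scale_leq _ _) _; apply: leq_trans (size_polyD _ _) _.
      by rewrite sF sH maxnn.
    rewrite ltnNge; apply/negP => /leq_sizeP/(_ _ (leqnn _)); rewrite A1 => /eqP.
    by rewrite oner_eq0.
  by apply/monic_degP; rewrite monicE lead_coefE sA A1.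
have four : 4%:R != 0 :> K by rewrite (_ : 4%:R = 2%:R * 2%:R) ?mulf_neq0 // -natrM.
have fourP : 4%:R%:P != 0 :> {poly K} by rewrite polyC_eq0.
have sHA : (size H <= size A)%N by rewrite (monic_deg_size hA) (monic_deg_size hH).
have eq : A ^+ 2 - A * H * y + a%:P * H ^+ 2 = (d / 4%:R)%:P.
  apply: (mulfI fourP); rewrite -polyCM [X in _ = X%:P]mulrCA divff // mulr1 -e eA.
  by rewrite polyCM !polyC_natr; ring.
have dN0 : d / 4%:R != 0 by rewrite mulf_neq0 ?invr_eq0.
have [c [j [ej1 ej2]]] := pell_descent a0 hy sHA eq dN0.
have hW := monic_deg_lucasW a j hy.
have c1 : c = 1.
  have := monicP (monic_deg_monic hA).
  by rewrite ej1 lead_coefZ (monicP (monic_deg_monic hW)) mulr1.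
rewrite c1 !scale1r in ej1 ej2.
have jn : j = n.+1 by have := monic_deg_size hA; rewrite ej1 (monic_deg_size hW) => -[].
have := lucasVW_add y a%:P n.+1; rewrite -jn -ej1 -ej2 => h.
apply/eqP; rewrite -subr_eq0 eA; apply/eqP.
have -> : 2%:R%:P * A - y * H - lucasV y a%:P j = A *+ 2 - (lucasV y a%:P j + y * H).
  by rewrite polyC_natr; ring.
by rewrite h subrr.
Qed.

End Pell.

Section PellChar2.
Variable K : fieldType.
Hypothesis two : 2%:R = 0 :> K.
Implicit Types (p q y a b F H : {poly K}) (c d s : K).

Lemma add_self2 p : p + p = 0.
Proof. by rewrite -mulr2n -mulr_natr -polyC_natr two mulr0. Qed.

Lemma opp_char2 p : - p = p.
Proof. by apply/eqP; rewrite eq_sym -subr_eq0 opprK add_self2. Qed.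

Lemma pell2_lucas y s d a b : s != 0 -> monic_deg 1 y ->
  a ^+ 2 + a * b * y + (s ^+ 2)%:P * b ^+ 2 = d%:P -> d != 0 ->
  exists c i, a + s%:P * b + y * b =
    c *: (lucasW y (s ^+ 2)%:P i.+1 + s%:P * lucasW y (s ^+ 2)%:P i).
Proof.
move=> s0 hy; rewrite -[a * b * y]opp_char2 => e d0.
have s20 : s ^+ 2 != 0 by rewrite expf_neq0.
have [le|lt] := leqP (size b) (size a).
  have [c [[|j] [ea eb]]] := pell_descent s20 hy le e d0.
    by exists c, 0%N; rewrite ea eb -!mul_polyC /=; ring.
  exists (c * s), j; rewrite ea eb !lucasWS (_ : (s ^+ 2)%:P = s%:P * s%:P) -?polyCM //.
  move: (lucasW _ _ j.+1) (lucasW _ _ j) => w w'; rewrite -!mul_polyC !polyCM.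
  apply/eqP; rewrite -subr_eq0; apply/eqP.
  have -> : c%:P * (y * w - s%:P * s%:P * w') + s%:P * (c%:P * w) + y * (c%:P * w) -
    c%:P * s%:P * (w + s%:P * w') = (c%:P * (y * w - s%:P * s%:P * w')) +
    (c%:P * (y * w - s%:P * s%:P * w')) by ring.
  exact: add_self2.
have sP0 : s%:P != 0 :> {poly K} by rewrite polyC_eq0.
have [||c [j [ea eb]]] := @pell_descent _ y (s ^+ 2) d (s *: b) (s^-1 *: a) s20 hy _ _ d0.
- by rewrite !size_scale ?invr_eq0 // ltnW.
- rewrite -e -!mul_polyC; have -> : (s ^+ 2)%:P * (s^-1%:P * a) ^+ 2 = a ^+ 2.
    by rewrite exprMn mulrA -rmorphXn /= -polyCM exprVn divff ?expf_neq0 // polyC1 mul1r.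
  have -> : s%:P * b * (s^-1%:P * a) * y = (s%:P * s^-1%:P) * (a * b * y) by ring.
  by rewrite -polyCM divff // polyC1 rmorphXn /=; ring.
have e1 : a = s%:P * (c *: lucasW y (s ^+ 2)%:P j).
  by rewrite -eb mul_polyC scalerA divff // scale1r.
exists (c / s), j.+1; apply: (mulfI sP0).
have -> : s%:P * (a + s%:P * b + y * b) = s%:P * a + s%:P * (s%:P * b) + y * (s%:P * b) by ring.
have ec : s%:P * (c / s)%:P = c%:P by rewrite -polyCM mulrCA divff // mulr1.
rewrite [s%:P * b]mul_polyC ea e1 -!mul_polyC [RHS]mulrA ec.
rewrite lucasWS (_ : (s ^+ 2)%:P = s%:P * s%:P) -?polyCM //.
move: (lucasW _ _ j.+1) (lucasW _ _ j) => w w'; rewrite polyCM.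
apply/eqP; rewrite -subr_eq0; apply/eqP.
have -> : s%:P * (s%:P * (c%:P * w')) + s%:P * (c%:P * w) + y * (c%:P * w) -
  c%:P * (y * w - s%:P * s%:P * w' + s%:P * w) = (s%:P * (s%:P * (c%:P * w'))) +
  (s%:P * (s%:P * (c%:P * w'))) by ring.
exact: add_self2.
Qed.

Lemma lucasV_char2 y a n : lucasV y a n = y * lucasW y a n.
Proof.
have := lucasVW_add y a n; rewrite mulr2n add_self2 => /eqP; rewrite addr_eq0 opp_char2.
by move/eqP.
Qed.

(** The substitution [b = y H' / s], [a = H + y H' + y ^ 2 H' / s] turns this Riccati
    equation into the Pell equation of [pell2_lucas], whose solutions are known, and
    [H = a + s b + y b]. *)
Lemma lucas_of_riccati y s d N H : s != 0 -> d != 0 -> monic_deg 1 y -> monic_deg N H ->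
  y ^+ 2 * H * H^`() + y ^+ 3 * H^`() ^+ 2 + s%:P * H ^+ 2 = d%:P ->
  y * H ^+ 2 = lucasV y (s ^+ 2)%:P N.*2.+1.
Proof.
move=> s0 d0 hy hH e; set p := H^`() in e.
pose b := s^-1 *: (y * p); pose a := H + y * p + s^-1 *: (y ^+ 2 * p).
have sb : s%:P * b = y * p by rewrite mul_polyC scalerA divff // scale1r.
have ea : a = H + s%:P * b + y * b.
  by rewrite sb /a /b -!mul_polyC; ring.
have sP0 : s%:P != 0 :> {poly K} by rewrite polyC_eq0.
have ep : a ^+ 2 + a * b * y + (s ^+ 2)%:P * b ^+ 2 = (d / s)%:P.
  apply: (mulfI sP0); rewrite -polyCM [X in _ = X%:P]mulrCA divff // mulr1 -e.
  have e2 : y ^+ 2 * H * p = s%:P * b * y * H by rewrite sb; ring.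
  have e3 : y ^+ 3 * p ^+ 2 = s%:P * b * y * (s%:P * b) by rewrite sb; ring.
  rewrite e2 e3 ea rmorphXn /=; apply/eqP; rewrite -subr_eq0; apply/eqP.
  have -> : s%:P * ((H + s%:P * b + y * b) ^+ 2 + (H + s%:P * b + y * b) * b * y +
     s%:P ^+ 2 * b ^+ 2) - (s%:P * b * y * H + s%:P * b * y * (s%:P * b) + s%:P * H ^+ 2) =
     (s%:P * (s%:P ^+ 2 * b ^+ 2 + y ^+ 2 * b ^+ 2 + H * s%:P * b + H * y * b + s%:P * y * b ^+ 2)) +
     (s%:P * (s%:P ^+ 2 * b ^+ 2 + y ^+ 2 * b ^+ 2 + H * s%:P * b + H * y * b + s%:P * y * b ^+ 2)).
    ring.
  exact: add_self2.
have [|c [i ei]] := pell2_lucas s0 hy ep; first by rewrite mulf_neq0 ?invr_eq0.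
have eH : H = c *: (lucasW y (s ^+ 2)%:P i.+1 + s%:P * lucasW y (s ^+ 2)%:P i).
  rewrite -ei ea; apply/eqP; rewrite -subr_eq0; apply/eqP.
  have -> : H - (H + s%:P * b + y * b + s%:P * b + y * b) =
     - ((s%:P * b + y * b) + (s%:P * b + y * b)) by ring.
  by rewrite add_self2 oppr0.
have hW : monic_deg i (lucasW y (s ^+ 2)%:P i.+1 + s%:P * lucasW y (s ^+ 2)%:P i).
  apply: monic_degD; last exact: monic_deg_lucasW.
  rewrite mul_polyC (leq_trans (size_scale_leq _ _)) //.
  by case: (i) => [|j]; rewrite ?size_poly0 // (monic_deg_size (monic_deg_lucasW _ _ hy)).
have c1 : c = 1.
  have := monicP (monic_deg_monic hH).
  by rewrite eH lead_coefZ (monicP (monic_deg_monic hW)) mulr1.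
rewrite c1 scale1r in eH.
have iN : i = N by have := monic_deg_size hH; rewrite eH (monic_deg_size hW) => -[].
rewrite -iN lucasV_char2 (lucasW_double _ _ _).1 eH; congr (_ * _).
set w := lucasW _ _ _; set w' := lucasW _ _ _.
rewrite -[(s ^+ 2)%:P * _]opp_char2 opprK rmorphXn /=.
have -> : (w + s%:P * w') ^+ 2 = w ^+ 2 + s%:P ^+ 2 * w' ^+ 2 + (w * s%:P * w' + w * s%:P * w') by ring.
by rewrite add_self2 addr0.
Qed.

End PellChar2.

Section MultiplicityTools.
Variable k : closedFieldType.
Implicit Types (p q P G H f : {poly k}) (x y u : k).

Lemma mup_eq_monic p q : p \is monic -> q \is monic -> (forall x, mup x p = mup x q) -> p = q.
Proof.
move=> mp mq h; rewrite (rootsE mp) (rootsE mq); apply: perm_big.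
by apply/allP => x _ /=; rewrite -!mup_rootseq ?monic_neq0 // h.
Qed.

Lemma mup_prod_pow (s : seq k) (e : k -> nat) x : uniq s ->
  mup x (\prod_(y <- s) ('X - y%:P) ^+ e y) = if x \in s then e x else 0%N.
Proof.
elim: s => [|y s IH] /=; first by rewrite big_nil mupNroot // root1.
case/andP=> nys us; rewrite big_cons mupM; last 2 first.
- by rewrite expf_neq0 // polyXsubC_eq0.
- by apply: monic_neq0; apply: monic_prod => i _; apply: monic_exp; apply: monicXsubC.
rewrite IH // mup_XsubCX inE [x == y]eq_sym; have [eyx|ne] := eqVneq y x; last by [].
by rewrite /= -eyx (negPf nys) addn0.
Qed.

(** Over a closed field, a polynomial is a square up to its roots of odd
    multiplicity. *)
Lemma odd_part P (T : seq k) : P \is monic -> uniq T ->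
  (forall x, odd (mup x P) = (x \in T)) ->
  exists2 G, G \is monic & P = (\prod_(x <- T) ('X - x%:P)) * G ^+ 2 /\
    forall x, (mup x P = (x \in T) + (mup x G).*2)%N.
Proof.
move=> mP uT hT.
pose G := \prod_(y <- undup (rootseq P)) ('X - y%:P) ^+ (mup y P)./2.
have mG : G \is monic by apply: monic_prod => i _; apply: monic_exp; apply: monicXsubC.
have hG x : (mup x P = (x \in T) + (mup x G).*2)%N.
  rewrite /G mup_prod_pow ?undup_uniq // mem_undup -hT.
  case: ifP => [_|/negbT nr]; first by rewrite odd_double_half.
  by rewrite mupNroot // -mem_roots.
exists G => //; split=> //.
have mT : \prod_(x <- T) ('X - x%:P) \is monic by apply: monic_prod_XsubC.
apply: mup_eq_monic => // [|x]; first by rewrite monicMl // monic_exp.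
rewrite mupM ?expf_neq0 ?monic_neq0 // mu_prod_XsubC mupX ?monic_neq0 //.
by rewrite count_uniq_mem // hG mul2n.
Qed.

(** Over two critical values, all points but [x1] and [x2] being double, the product
    [(f - u) (f - u')] is a Pell equation. *)
Lemma dickson_of_double_points N f u u' x1 x2 G : 2%:R != 0 :> k -> monic_deg N.+1 f ->
  u != u' -> x1 != x2 -> G \is monic ->
  (f - u%:P) * (f - u'%:P) = ('X - x1%:P) * ('X - x2%:P) * G ^+ 2 ->
  f = lucasV ('X - ((x1 + x2) / 2%:R)%:P) (((x1 - x2) / 4%:R) ^+ 2)%:P N.+1 +
      ((u + u') / 2%:R)%:P.
Proof.
move=> two hf nu nx mG e.
have four : 4%:R != 0 :> k by rewrite (_ : 4%:R = 2%:R * 2%:R) ?mulf_neq0 // -natrM.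
set c := (x1 + x2) / 2%:R; set a := ((x1 - x2) / 4%:R) ^+ 2; set b := (u + u') / 2%:R.
have hG : monic_deg N G.
  apply/monic_degP; split=> //.
  have h1 : monic_deg (N.+1 + N.+1) ((f - u%:P) * (f - u'%:P)).
    by apply: monic_degM; apply: monic_degB.
  have := monic_deg_size h1.
  have hX : monic_deg 2 (('X - x1%:P) * ('X - x2%:P)).
    by rewrite (_ : 2 = 1 + 1)%N //; apply: monic_degM; apply: monic_deg_XsubC.
  rewrite e size_monicM ?(monic_deg_monic hX) ?expf_neq0 ?monic_neq0 // (monic_deg_size hX).
  have := size_exp G 2; have : (0 < size (G ^+ 2)%R)%N.
    by rewrite size_poly_gt0 expf_neq0 ?monic_neq0.
  have : (0 < size G)%N by rewrite size_poly_gt0 monic_neq0.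
  move: (size G) (size (G ^+ 2)%R); lia.
have hy : monic_deg 1 ('X - c%:P) by apply: monic_deg_XsubC.
have hF : monic_deg N.+1 (f - b%:P) by apply: monic_degB.
have a0 : a != 0 by rewrite expf_neq0 // mulf_neq0 ?invr_eq0 // subr_eq0.
have d0 : ((u - u') / 2%:R) ^+ 2 != 0 by rewrite expf_neq0 // mulf_neq0 ?invr_eq0 // subr_eq0.
suff /(pell_lucas two a0 d0 hy hF hG) <- :
    (f - b%:P) ^+ 2 - (('X - c%:P) ^+ 2 - (4%:R * a)%:P) * G ^+ 2 =
      (((u - u') / 2%:R) ^+ 2)%:P.
  by rewrite subrK.
have e1 : ('X - c%:P) ^+ 2 - (4%:R * a)%:P = ('X - x1%:P) * ('X - x2%:P).
  have p1 : x1 + x2 = c * 2%:R by rewrite /c divfK.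
  have p2 : x1 * x2 = c ^+ 2 - 4%:R * a by rewrite /c /a; field; rewrite four two.
  have -> : ('X - x1%:P) * ('X - x2%:P) = 'X ^+ 2 - (x1 + x2)%:P * 'X + (x1 * x2)%:P.
    by rewrite polyCM polyCD; ring.
  by rewrite p1 p2 polyCB !polyCM ?rmorphXn ?polyC_natr /=; ring.
rewrite e1 -e.
have p1 : u + u' = b * 2%:R by rewrite /b divfK.
have p2 : ((u - u') / 2%:R) ^+ 2 = b ^+ 2 - u * u' by rewrite /b; field.
have -> : (f - u%:P) * (f - u'%:P) = f ^+ 2 - (u + u')%:P * f + (u * u')%:P.
  by rewrite polyCM polyCD; ring.
by rewrite p1 p2 polyCB !polyCM ?rmorphXn ?polyC_natr /=; ring.
Qed.

End MultiplicityTools.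

Section MoreTools.
Variable k : closedFieldType.
Implicit Types (p q H : {poly k}) (x : k).

Lemma dvdp_prod_count (r : seq k) q : q != 0 ->
  (forall x, (count_mem x r <= mup x q)%N) -> \prod_(z <- r) ('X - z%:P) %| q.
Proof.
elim: r q => [|z r IH] q qN0 h; first by rewrite big_nil dvd1p.
have : ('X - z%:P) %| q.
  by rewrite XsubC_dvd //; apply: leq_trans (h z); rewrite /= eqxx.
case/dvdpP=> q1 e; have q1N0 : q1 != 0 by apply: contraNneq qN0 => q10; rewrite e q10 mul0r.
rewrite e big_cons mulrC dvdp_mul2r ?polyXsubC_eq0 //; apply: IH => // x.
have := h x; rewrite e mupM ?polyXsubC_eq0 // (mup_XsubCX 1) /= eq_sym.
by case: (x == z); lia.
Qed.

Lemma dvdp_mup p q : p \is monic -> q != 0 -> (forall x, mup x p <= mup x q)%N -> p %| q.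
Proof.
move=> mp qN0 h; rewrite (rootsE mp); apply: dvdp_prod_count => // x.
by rewrite -mup_rootseq ?monic_neq0.
Qed.

Lemma deriv_root_double p x : p != 0 -> root p x -> root p^`() x -> (1 < mup x p)%N.
Proof.
move=> pN0 rp rd; have h : (0 < mup x p)%N by rewrite -XsubC_dvd // dvdp_XsubCl.
rewrite ltn_neqAle h andbT eq_sym; apply/eqP => m1.
have [q e nq] := mup_factor x pN0; move: rd; rewrite e m1 expr1 derivM derivXsubC mulr1.
by rewrite /root hornerD hornerM hornerXsubC subrr mulr0 add0r; apply/negP.
Qed.

Section Char2.
Hypothesis two : 2%:R = 0 :> k.

Lemma deriv2_char2 p : p^`()^`() = 0.
Proof.
apply/polyP => i; rewrite !coef_deriv coef0 -mulrnA -mulr_natr.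
have : ~~ odd (i.+2 * i.+1)%N by rewrite oddM /= negbK; case: odd.
by move/even_halfK <-; rewrite -muln2 natrM two !mulr0.
Qed.

(** Both sides agree doubly at the simple zeros of [H], because the derivative of
    the left hand side vanishes identically in characteristic 2. *)
Lemma riccati_of_values (x0 g1 : k) H : H \is monic ->
  (forall h, root H h -> ~~ root H^`() h) -> H.[x0] != 0 ->
  (forall h, root H h -> (h - x0) ^+ 3 * H^`().[h] ^+ 2 = g1) ->
  ('X - x0%:P) ^+ 2 * H * H^`() + ('X - x0%:P) ^+ 3 * H^`() ^+ 2 +
     (g1 / H.[x0] ^+ 2)%:P * H ^+ 2 = g1%:P.
Proof.
move=> mH hs Hx0 hg; have HN0 := monic_neq0 mH; set y := 'X - x0%:P.
have [hP|hP] := eqVneq H^`() 0.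
  have sH : H = 1.
    have [s1|s1] := eqVneq (size H) 1%N.
      have e := size1_polyC (eq_leq s1); move/monicP: mH; rewrite e lead_coefC => ->.
      by rewrite polyC1.
    have /closed_rootP[h rh] := s1; have := hs h rh.
    by rewrite hP /root horner0 eqxx.
  rewrite sH hornerC expr1n divr1 derivC; ring.
set D := H^`() in hs hg hP *.
have D' : D^`() = 0 by apply: deriv2_char2.
set Th := y ^+ 2 * H * D + y ^+ 3 * D ^+ 2 - g1%:P.
have Th' : Th^`() = 0.
  have y' : y^`() = 1 by rewrite derivXsubC.
  rewrite /Th derivB derivC subr0 derivD !exprS !expr0 !mulr1 !derivM y' D' -/D.
  transitivity ((y * H * D + y ^+ 2 * D ^+ 2 *+ 2) + (y * H * D + y ^+ 2 * D ^+ 2 *+ 2)).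
    ring.
  exact: (add_self2 two).
have dv : H ^+ 2 %| Th.
  have [->|ThN0] := eqVneq Th 0; first exact: dvdp0.
  apply: dvdp_mup => //; first exact: monic_exp.
  move=> x; rewrite mupX //; have [rx|nr] := boolP (root H x); last first.
    by rewrite mupNroot.
  have m1 : (mup x H <= 1)%N.
    rewrite mup_leq //; apply: contra (hs x rx) => /dvdpP[q e].
    by rewrite /D e /root deriv_sqr_root.
  suff : (1 < mup x Th)%N by lia.
  apply: deriv_root_double => //; last by rewrite Th' root0.
  rewrite /root /Th !(hornerD, hornerN, hornerC) !(horner_exp, hornerM) hornerXsubC.
  by rewrite (eqP rx) mulr0 mul0r add0r hg // subrr.
have [T eT] := dvdpP _ _ dv.
have sT : (size T <= 2)%N.
  have [->|TN0] := eqVneq T 0; first by rewrite size_poly0.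
  have sy : size y = 2%N by rewrite size_XsubC.
  have sD : (size D < size H)%N by apply: lt_size_deriv.
  have sy2 : size (y ^+ 2) = 3%N by rewrite size_exp_XsubC.
  have sy3 : size (y ^+ 3) = 4%N by rewrite size_exp_XsubC.
  have sTh : (size Th <= 2 * size H)%N.
    rewrite /Th; apply: leq_trans (size_polyD _ _) _; rewrite geq_max size_polyN.
    have H0 : (0 < size H)%N by rewrite size_poly_gt0.
    rewrite (leq_trans (size_polyC_leq1 _)) ?muln_gt0 // andbT.
    apply: leq_trans (size_polyD _ _) _; rewrite geq_max; apply/andP; split.
      apply: leq_trans (size_polyMleq _ _) _; have := size_polyMleq (y ^+ 2) H.
      rewrite sy2; move: (size (y ^+ 2 * H)) (size H) (size D) sD => a b c; lia.
    apply: leq_trans (size_polyMleq _ _) _; have := size_polyMleq D D.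
    have D0 : (0 < size D)%N by rewrite size_poly_gt0.
    rewrite sy3 -expr2; move: (size (D ^+ 2)) (size H) (size D) sD D0 => a b c; lia.
  have s2 : size (H ^+ 2) = (size H + size H).-1 by rewrite expr2 size_mul.
  move: sTh; rewrite eT size_mul ?expf_neq0 // s2.
  have H0 : (0 < size H)%N by rewrite size_poly_gt0.
  by move: (size H) (size T) H0; clear; lia.
have T' : T^`() = 0.
  have := Th'; rewrite eT derivM expr2 derivM -/D.
  have -> : T^`() * (H * H) + T * (D * H + H * D) = T^`() * (H * H) + (T * D * H + T * D * H) by ring.
  rewrite (add_self2 two) addr0 => /eqP; rewrite mulf_eq0 mulf_eq0 (negPf HN0) !orbF.
  by move/eqP.
have eTc : T = (T`_0)%:P.
  apply/polyP => -[|[|i]]; rewrite coefC //=; last by rewrite nth_default // (leq_trans sT).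
  by have := congr1 (fun p : {poly k} => p`_0) T'; rewrite coef_deriv coef0 mulr1n.
have := congr1 (fun p : {poly k} => p.[x0]) eT.
rewrite /Th !(hornerD, hornerN, hornerC) !(horner_exp, hornerM) hornerXsubC subrr.
rewrite !expr0n /= !mul0r !add0r eTc hornerC => et.
have -> : g1 / H.[x0] ^+ 2 = - T`_0.
  by rewrite -[g1]opprK et mulNr mulfK // expf_neq0.
rewrite polyCN mulNr -eTc -eT /Th; ring.
Qed.

End Char2.
End MoreTools.

(** * From ramification types to explicit polynomials *)

Record tame_pair (k : closedFieldType) (m n : nat) (f1 f2 U V : {poly k}) : Prop :=
  TamePair {
    tp_m : (1 < m)%N; tp_n : (1 < n)%N; tp_co : coprime m n;
    tp_mN0 : m%:R != 0 :> k; tp_nN0 : n%:R != 0 :> k;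
    tp_f1 : monic_deg m f1; tp_f2 : monic_deg n f2;
    tp_U : monic_deg n U; tp_V : monic_deg m V; tp_eq : U \Po f1 = V \Po f2 }.

Lemma tame_pair_sym k m n f1 f2 U V :
  @tame_pair k m n f1 f2 U V -> tame_pair n m f2 f1 V U.
Proof. by case=> *; split=> //; rewrite coprime_sym. Qed.

Section TamePair.
Variable k : closedFieldType.
Variables (m n : nat) (f1 f2 U V : {poly k}).
Hypothesis tp : tame_pair m n f1 f2 U V.
Implicit Types (x u v l : k).

Lemma tp_m0 : (0 < m)%N. Proof. exact: ltnW (tp_m tp). Qed.
Lemma tp_n0 : (0 < n)%N. Proof. exact: ltnW (tp_n tp). Qed.

Lemma tp_ramification :
  ramification n m (critical_values U V) (fib U) (fib V)
    (mult U) (dmult U) (mult V) (dmult V) (cdiff f1 f2 f2) (cdiff f1 f2 f1).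
Proof. by case: tp => *; apply: composite_ramification. Qed.

Lemma tp_sum2 u v : U.[u] = V.[v] -> (\sum_(x <- pts f1 f2 u v) mult f2 x)%N = mult U u.
Proof. by case: tp => *; apply: (@sum_mult2 _ m n f1 f2 U V). Qed.

Lemma tp_sum1 u v : U.[u] = V.[v] -> (\sum_(x <- pts f1 f2 u v) mult f1 x)%N = mult V v.
Proof. by case: tp => *; apply: (@sum_mult1 _ m n f1 f2 U V). Qed.

Lemma tp_mult x : (mult f1 x * mult U f1.[x] = mult f2 x * mult V f2.[x])%N.
Proof. by case: tp => *; apply: (@mult_composite _ m n f1 f2 U V). Qed.

Lemma tp_pts u v x : (x \in pts f1 f2 u v) = (f1.[x] == u) && (f2.[x] == v).
Proof. exact: (mem_pts _ (tp_m tp) (tp_f1 tp)). Qed.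

Lemma tp_exist u v : U.[u] = V.[v] -> exists2 x, f1.[x] = u & f2.[x] = v.
Proof.
move=> e; have [x] : exists x, x \in pts f1 f2 u v.
  by case: tp => *; apply: (@pts_exist _ m n f1 f2 U V).
by rewrite tp_pts => /andP[/eqP <- /eqP <-]; exists x.
Qed.

Lemma tp_values x : U.[f1.[x]] = V.[f2.[x]].
Proof. by rewrite -!horner_comp (tp_eq tp). Qed.

Lemma mem_fibU u l : (u \in fib U l) = (U.[u] == l).
Proof. exact: mem_fib tp_n0 (tp_U tp) _ _. Qed.

Lemma mem_fibV v l : (v \in fib V l) = (V.[v] == l).
Proof. exact: mem_fib tp_m0 (tp_V tp) _ _. Qed.

Lemma power_of_mult N f x : (0 < N)%N -> monic_deg N f -> mult f x = N ->
  f = ('X - x%:P) ^+ N + (f.[x])%:P.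
Proof.
move=> N0 hf e; apply: (addIr (- (f.[x])%:P)); rewrite addrK.
have hg := monic_degB f.[x] N0 hf; have gN0 := monic_deg_neq0 hg.
have dv : ('X - x%:P) ^+ N %| f - (f.[x])%:P by rewrite -mup_geq // -e.
apply/esym/eqP; rewrite -eqp_monic ?(monic_deg_monic hg) ?monic_exp ?monicXsubC //.
by rewrite -(dvdp_size_eqp dv) size_exp_XsubC (monic_deg_size hg).
Qed.

(** If the fibre of [U] is the single point [u], then all but one of the points of [V]
    over the same value have index divisible by [n], since each exception costs
    [n / 2] in the different of [f2]. The exceptional index is then prime to [n],
    which forces [f2] to be totally ramified above it. *)
Lemma power_of_single l : l \in critical_values U V -> size (fib U l) = 1%N ->
  exists c b, f2 = ('X - c%:P) ^+ n + b%:P.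
Proof.
move=> lS; case E: (fib U l) => [|u [|]] // _.
have R := tp_ramification; have n0 := tp_n0.
have /eqP uU : U.[u] == l by rewrite -mem_fibU E inE.
have en : mult U u = n by rewrite -[RHS](rm_sume R lS) E big_seq1.
have uniqV := rm_uniqV R lS.
have sc : (\sum_(v <- fib V l) cdiff f1 f2 f2 u v < n)%N.
  have := rm_sumc R; rewrite addn1; apply: leq_ltn_trans.
  apply: leq_trans (leq_sum_seq1
    (fun l => \sum_(u <- fib U l) \sum_(v <- fib V l) cdiff f1 f2 f2 u v)%N lS).
  by rewrite E big_seq1.
have cb v : v \in fib V l -> (n <= cdiff f1 f2 f2 u v + gcdn n (mult V v))%N.
  by move=> vV; have := rm_c R lS; rewrite E => /(_ u v); rewrite inE eqxx en; apply.
have [v vV nv] : exists2 v, v \in fib V l & ~~ (n %| mult V v)%N.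
  apply/hasP; rewrite has_predC; apply/negP => /allP h.
  have : (n %| m)%N by rewrite -(rm_sumf R lS) big_seq; apply: dvdn_sum => v /h.
  move=> nm; have := tp_co tp; rewrite /coprime gcdnC (gcdn_idPl nm) => /eqP e1.
  by have := tp_n tp; rewrite e1.
have dv v' : v' \in fib V l -> v' != v -> (n %| mult V v')%N.
  move=> v'V ne; apply/idP/negPn/negP => nv'.
  have b1 := half_of_proper_gcd n0 nv; have b2 := half_of_proper_gcd n0 nv'.
  have c1 := cb v vV; have c2 := cb v' v'V; rewrite gcdnC in b1; rewrite gcdnC in b2.
  have : (cdiff f1 f2 f2 u v + cdiff f1 f2 f2 u v' <= \sum_(v <- fib V l) cdiff f1 f2 f2 u v)%N.
    rewrite (bigD1_seq v) //= leq_add2l.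
    exact: (leq_sum_seq1_cond (fun v => cdiff f1 f2 f2 u v) v'V ne).
  lia.
have cop : coprime n (mult V v).
  rewrite /coprime -dvdn1; have /eqP <- : gcdn n m == 1%N by rewrite gcdnC; exact: (tp_co tp).
  rewrite dvdn_gcd dvdn_gcdl -(rm_sumf R lS) (bigD1_seq v) //= dvdn_addr ?dvdn_gcdr //.
  rewrite -big_filter big_seq; apply: dvdn_sum => v'; rewrite mem_filter => /andP[ne v'V].
  exact: dvdn_trans (dvdn_gcdl _ _) (dv v' v'V ne).
have vE : V.[v] = l by apply/eqP; rewrite -mem_fibV.
have [x x1 x2] : exists2 x, f1.[x] = u & f2.[x] = v by apply: tp_exist; rewrite uU vE.
have := tp_mult x; rewrite x1 x2 en => h.
have nd : (n %| mult f2 x)%N by rewrite -(Gauss_dvdl _ cop) -h dvdn_mull.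
exists x, f2.[x]; apply: power_of_mult (tp_f2 tp) _ => //.
apply/eqP; rewrite eqn_leq (dvdn_leq (mult_gt0 n0 (tp_f2 tp) x) nd) andbT.
rewrite -en -(@tp_sum2 u v) ?uU ?vE //; apply: leq_sum_seq1.
by rewrite tp_pts x1 x2 !eqxx.
Qed.

(** Under two values where all but two points of [U], and all but one point of [V]
    over each value, are double, the two remaining points of [U] lift to the only
    points where the products below vanish to odd order. *)
Lemma double_points l1 l2 u1 u2 v1 v2 : l1 != l2 -> u1 != u2 ->
  V.[v1] = l1 -> V.[v2] = l2 -> mult V v1 = 1%N -> mult V v2 = 1%N ->
  (forall v, V.[v] = l1 \/ V.[v] = l2 -> [\/ v = v1, v = v2 | mult V v = 2%N]) ->
  (U.[u1] = l1 \/ U.[u1] = l2) -> (U.[u2] = l1 \/ U.[u2] = l2) ->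
  mult U u1 = 1%N -> mult U u2 = 1%N ->
  (forall u, U.[u] = l1 \/ U.[u] = l2 -> [\/ u = u1, u = u2 | mult U u = 2%N]) ->
  exists x1 x2, [/\ x1 != x2,
    forall x, odd (mup x ((f1 - u1%:P) * (f1 - u2%:P))) = (x \in [:: x1; x2]) &
    forall x, odd (mup x ((f2 - v1%:P) * (f2 - v2%:P))) = (x \in [:: x1; x2])].
Proof.
move=> nl nu hv1 hv2 m1 m2 hV hu1 hu2 n1 n2 hU.
have nv : v1 != v2 by apply: contraNneq nl => ev; rewrite -hv1 -hv2 ev.
have lift u : u = u1 \/ u = u2 -> exists x, [/\ f1.[x] = u, f2.[x] = v1 \/ f2.[x] = v2,
    odd (mult f1 x), odd (mult f2 x) &
    forall y, f1.[y] = u -> f2.[y] = v1 \/ f2.[y] = v2 -> y = x].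
  move=> hu; have [lu mu] : (U.[u] = l1 \/ U.[u] = l2) /\ mult U u = 1%N.
    by case: hu => ->.
  have [v [hv uv mv nv']] : exists v, [/\ v = v1 \/ v = v2, U.[u] = V.[v], mult V v = 1%N &
      forall v', v' = v1 \/ v' = v2 -> U.[u] = V.[v'] -> v' = v].
    case: lu => e; [exists v1|exists v2]; split=> //; try by [left|right|rewrite e].
      by move=> v' [->|->] //; rewrite e hv2 => h; rewrite h eqxx in nl.
    by move=> v' [->|->] //; rewrite e hv1 => h; rewrite h eqxx in nl.
  have s1 := tp_sum1 uv; have s2 := tp_sum2 uv; rewrite mv in s1; rewrite mu in s2.
  have big x : x \in pts f1 f2 u v -> mult f1 x = 1%N /\ mult f2 x = 1%N.
    move=> xp; have := leq_sum_seq1 (mult f1) xp; have := leq_sum_seq1 (mult f2) xp.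
    rewrite s1 s2; have := mult_gt0 tp_m0 (tp_f1 tp) x; have := mult_gt0 tp_n0 (tp_f2 tp) x.
    by move: (mult f1 x) (mult f2 x); lia.
  have s3 : size (pts f1 f2 u v) = 1%N.
    rewrite -s1 -[LHS]muln1 -sum_const_seq big_seq [RHS]big_seq.
    by apply: eq_bigr => x /big[-> _].
  case E: (pts f1 f2 u v) s3 => [|x [|]] // _.
  have xp : x \in pts f1 f2 u v by rewrite E inE.
  have [o1 o2] := big x xp; move: xp; rewrite tp_pts => /andP[/eqP ex1 /eqP ex2].
  exists x; split; rewrite ?o1 ?o2 ?ex2 // => y ey ey2.
  have : y \in pts f1 f2 u v; last by rewrite E inE => /eqP.
  by rewrite tp_pts ey eqxx; apply/eqP/nv' => //; rewrite -ey tp_values.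
have [x1 [e11 e12 o11 o12 q1]] := lift u1 (or_introl erefl).
have [x2 [e21 e22 o21 o22 q2]] := lift u2 (or_intror erefl).
have mup_sub N f a x : (0 < N)%N -> monic_deg N f ->
    mup x (f - a%:P) = if f.[x] == a then mult f x else 0%N.
  move=> N0 hf; case: eqP => [<-//|ne]; apply: mupNroot.
  by rewrite /root !(hornerD, hornerN, hornerC) subr_eq0; apply/eqP.
have mup_prod N f a b x : (0 < N)%N -> monic_deg N f -> a != b ->
    mup x ((f - a%:P) * (f - b%:P)) = if (f.[x] == a) || (f.[x] == b) then mult f x else 0%N.
  move=> N0 hf ab; rewrite mupM ?(sub_neq0 N0 hf) // !(mup_sub N) //.
  by case: eqP => [->|_] /=; rewrite ?(negPf ab) ?addn0.
exists x1, x2; split=> [|x|x].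
- by apply: contraNneq nu => e; rewrite -e11 -e21 e.
- rewrite (mup_prod m) ?tp_m0 ?(tp_f1 tp) //; rewrite !inE; apply/idP/idP; last first.
    by case/orP=> /eqP ->; rewrite ?e11 ?e21 eqxx ?orbT.
  case: ifP => // hx ox.
  have hux : f1.[x] = u1 \/ f1.[x] = u2 by case/orP: hx => /eqP ->; [left|right].
  have : V.[f2.[x]] = l1 \/ V.[f2.[x]] = l2 by rewrite -tp_values; case: hux => ->.
  case/hV => h2.
  + by case: hux => hux; [rewrite (q1 x) ?eqxx //|rewrite (q2 x) ?eqxx ?orbT //]; left.
  + by case: hux => hux; [rewrite (q1 x) ?eqxx //|rewrite (q2 x) ?eqxx ?orbT //]; right.
  have := tp_mult x; have -> : mult U f1.[x] = 1%N by case: hux => ->.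
  by rewrite h2 muln1 => e; rewrite e muln2 odd_double in ox.
- rewrite (mup_prod n) ?tp_n0 ?(tp_f2 tp) //; rewrite !inE; apply/idP/idP; last first.
    by case/orP=> /eqP ->; [case: e12|case: e22] => ->; rewrite eqxx ?orbT.
  case: ifP => // hx ox.
  have hvx : f2.[x] = v1 \/ f2.[x] = v2 by case/orP: hx => /eqP ->; [left|right].
  have : U.[f1.[x]] = l1 \/ U.[f1.[x]] = l2.
    by rewrite tp_values; case: hvx => ->; rewrite ?hv1 ?hv2; [left|right].
  case/hU => h2; first by rewrite (q1 x) ?eqxx.
    by rewrite (q2 x) ?eqxx ?orbT.
  have := tp_mult x; have -> : mult V f2.[x] = 1%N by case: hvx => ->.
  by rewrite h2 muln1 => e; rewrite -e muln2 odd_double in ox.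
Qed.

Lemma lucas_of_dickson_type :
  dickson_type (critical_values U V) (fib U) (fib V) (mult U) (dmult U) (mult V) (dmult V) ->
  exists c a b1 b2, f1 = lucasV ('X - c%:P) a%:P m + b1%:P /\
                    f2 = lucasV ('X - c%:P) a%:P n + b2%:P.
Proof.
case=> l1 [l2 [l1S l2S nl [c1 c2 c3] h]]; have R := tp_ramification.
have simple l : count (fun v => mult V v == 1)%N (fib V l) = 1%N ->
    exists v, [/\ V.[v] = l, mult V v = 1%N & forall v', V.[v'] = l -> mult V v' = 1%N -> v' = v].
  rewrite -size_filter; case E: [seq _ <- _ | _] => [|v [|]] // _.
  have hm w : (w \in [:: v]) = (mult V w == 1%N) && (V.[w] == l) by rewrite -E mem_filter mem_fibV.
  have := hm v; rewrite inE eqxx => /esym/andP[/eqP mv /eqP vl]; exists v; split=> // w wl mw.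
  by apply/eqP; have := hm w; rewrite inE mw wl !eqxx.
have [v1 [hv1 mv1 qv1]] := simple _ c1; have [v2 [hv2 mv2 qv2]] := simple _ c2.
have two : 2%:R != 0 :> k.
  apply/eqP => two; have : (1 < \sum_(v <- fib V l1) mult V v)%N.
    by rewrite (rm_sumf R l1S) (tp_m tp).
  have v1V : v1 \in fib V l1 by rewrite mem_fibV hv1.
  rewrite (bigD1_seq v1) ?(rm_uniqV R l1S) //= mv1 -big_filter big_seq big1 // => v.
  rewrite mem_filter => /andP[nv vV].
  have [_ /(_ v vV)] := h l1 (or_introl erefl); case=> [mv|[mv dv]].
    by move: nv; rewrite (qv1 v) ?eqxx //; apply/eqP; rewrite -mem_fibV.
  have := dmult_wild tp_m0 (tp_mN0 tp) (tp_V tp) (x := v); rewrite mv dv => /(_ two).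
  by [].
pose s := [seq u <- fib U l1 ++ fib U l2 | (mult U u == 1)%N].
have hm u : (u \in s) = (mult U u == 1%N) && ((U.[u] == l1) || (U.[u] == l2)).
  by rewrite mem_filter mem_cat !mem_fibU.
have : size s = 2 by rewrite size_filter count_cat.
have : uniq s.
  apply: filter_uniq; rewrite cat_uniq !fib_uniq /= andbT; apply/hasPn => u.
  by rewrite !mem_fibU => /eqP ->; rewrite eq_sym.
case: s hm => [|u1 [|u2 []]] // hm /=; rewrite inE andbT => nu _.
have := hm u1; have := hm u2; rewrite !inE !eqxx orbT.
move=> /esym/andP[/eqP n2 /orP hu2] /esym/andP[/eqP n1 /orP hu1].
have toP a b c : (a == b :> k) \/ (a == c) -> a = b \/ a = c.
  by case=> /eqP; [left|right].
have [||||||||||||x1 [x2 [nx o1 o2]]] := @double_points l1 l2 u1 u2 v1 v2 => //; try exact: toP.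
- move=> v hv; have [_ /(_ v)] := h V.[v] hv; rewrite mem_fibV eqxx => /(_ isT) [mv|[mv _]].
    case: hv => hv; first by constructor 1; apply: qv1.
    by constructor 2; apply: qv2.
  by constructor 3.
- move=> u hu; have [/(_ u) + _] := h U.[u] hu; rewrite mem_fibU eqxx => /(_ isT) [mu|[mu _]].
    have : u \in [:: u1; u2] by rewrite hm mu eqxx; case: hu => ->; rewrite eqxx ?orbT.
    by rewrite !inE => /orP[]/eqP ->; [constructor 1|constructor 2].
  by constructor 3.
have nv : v1 != v2 by apply: contraNneq nl => ev; rewrite -hv1 -hv2 ev.
have dick N f a b : (0 < N)%N -> monic_deg N f -> a != b ->
    (forall x, odd (mup x ((f - a%:P) * (f - b%:P))) = (x \in [:: x1; x2])) ->
    f = lucasV ('X - ((x1 + x2) / 2%:R)%:P) (((x1 - x2) / 4%:R) ^+ 2)%:P N +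
      ((a + b) / 2%:R)%:P.
  case: N => // N _ hf ab o; have hs c := monic_deg_monic (monic_degB c (ltn0Sn N) hf).
  have [||G mG [eG _]] := odd_part _ _ o; first by rewrite monicMl.
    by rewrite /= inE nx.
  apply: (dickson_of_double_points two hf ab nx mG).
  by rewrite eG big_cons big_seq1.
exists ((x1 + x2) / 2%:R), (((x1 - x2) / 4%:R) ^+ 2), ((u1 + u2) / 2%:R), ((v1 + v2) / 2%:R).
by split; apply: dick => //; rewrite ?tp_m0 ?tp_n0 ?(tp_f1 tp) ?(tp_f2 tp).
Qed.

End TamePair.

(** * Wild ramification forces index two *)

Section Approximation.
Variable k : closedFieldType.
Implicit Types (f g U V A B p q : {poly k}) (x u v : k).

(** Where [f] is unramified it is a local parameter, so every polynomial has a Taylor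
    expansion in powers of [f - f.[x]]. *)
Lemma local_expansion f g x N : f - (f.[x])%:P != 0 -> mult f x = 1%N ->
  exists p, ('X - x%:P) ^+ N %| p \Po f - g.
Proof.
move=> fN0 mf.
have [t] := mup_factor x fN0; rewrite -/(mult f x) mf expr1 => et nt.
elim: N => [|N [p /dvdpP[q e]]]; first by exists 0; rewrite expr0 dvd1p.
pose c := q.[x] / t.[x] ^+ N.
exists (p - c *: ('X - (f.[x])%:P) ^+ N).
rewrite rmorphB /= linearZ /= rmorphXn rmorphB /= comp_polyX comp_polyC.
have -> : p \Po f - c *: (f - (f.[x])%:P) ^+ N - g = (q - c *: t ^+ N) * ('X - x%:P) ^+ N.
  by rewrite addrAC e et exprMn -!mul_polyC; ring.
rewrite exprS dvdp_mul // dvdp_XsubCl /root hornerD hornerN hornerZ horner_exp /c.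
by rewrite divfK ?subrr // expf_neq0.
Qed.

Lemma comp_poly_taylor U A B : exists R, U \Po (A + B) = U \Po A + B * (U^`() \Po A) + B ^+ 2 * R.
Proof.
elim/poly_ind: U => [|U c [R IH]]; first by exists 0; rewrite deriv0 !comp_poly0; ring.
exists (R * (A + B) + (U^`() \Po A)).
rewrite derivD derivC addr0 derivM derivX mulr1 !rmorphD !rmorphM /= !comp_polyX !comp_polyC IH.
ring.
Qed.

(** The order of a perturbation [U \Po (A + B) - U \Po A] is the order of its linear
    term when [B] vanishes to higher order than [U' \Po A]. *)
Lemma mup_perturbation U A B x : B != 0 -> U^`() \Po A != 0 ->
  (mup x (U^`() \Po A) < mup x B)%N ->
  mup x (U \Po (A + B) - (U \Po A)) = (mup x B + mup x (U^`() \Po A))%N.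
Proof.
move=> BN0 dN0 lt; have [R ->] := comp_poly_taylor U A B.
have [b eb nb] := mup_factor x BN0; have [d ed nd] := mup_factor x dN0.
set M := mup x B in lt eb *; set L := mup x _ in lt ed *.
have -> : U \Po A + B * (U^`() \Po A) + B ^+ 2 * R - (U \Po A) =
   (b * (d + b * ('X - x%:P) ^+ (M - L) * R)) * ('X - x%:P) ^+ (M + L).
  have e1 : ('X - x%:P) ^+ M = ('X - x%:P) ^+ (M - L) * ('X - x%:P) ^+ L.
    by rewrite -exprD subnK // ltnW.
  rewrite exprD eb ed e1.
  by move: (('X - x%:P) ^+ (M - L)) (('X - x%:P) ^+ L) (U \Po A) => yi yj UA; ring.
rewrite mupMr ?mup_XsubCX ?eqxx // rootM negb_or nb /= /root hornerD !hornerM.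
rewrite horner_exp hornerXsubC subrr expr0n subn_eq0 leqNgt lt /= mulr0 mul0r addr0.
exact: nd.
Qed.

End Approximation.

Section NormOrder.
Variable k : closedFieldType.
Variables (m n : nat) (f1 f2 U V : {poly k}).
Hypothesis tp : tame_pair m n f1 f2 U V.

(** [U \Po p - V] is, up to a constant, the norm of [p \Po f2 - f1] for the extension
    defined by [f2], so its zeros are the images of the zeros of the latter. *)
Lemma norm_order (p : {poly k}) (v : k) (s : seq k) :
  p \Po f2 - f1 != 0 -> uniq s -> {in s, forall x, f2.[x] = v} ->
  U \Po p - V != 0 /\ (\sum_(x <- s) mup x (p \Po f2 - f1) <= mup v (U \Po p - V)%R)%N.
Proof.
move=> QN0 us hs; have n0 := tp_n0 tp; have m0 := tp_m0 tp.
set Q := p \Po f2 - f1 in QN0 *; set E := U \Po p - V.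
have lN0 : lead_coef Q != 0 by rewrite lead_coef_eq0.
pose q := (lead_coef Q)^-1 *: Q.
have mq : q \is monic by rewrite monicE lead_coefZ mulVf.
have eQ : Q = lead_coef Q *: q by rewrite scalerA divff // scale1r.
pose r := [seq f2.[y] | y <- rootseq q].
have [c cN0 eE] : exists2 c, c != 0 & E = c *: \prod_(z <- r) ('X - z%:P).
  exists (lead_coef Q ^+ n * (-1) ^+ (n * size (rootseq q)) * (-1) ^+ size r).
    by rewrite !mulf_neq0 ?expf_neq0 // oppr_eq0 oner_eq0.
  apply/eqP; rewrite -subr_eq0; apply/eqP/poly_eq0_everywhere => t.
  have hs2 := monic_degB t n0 (tp_f2 tp).
  have hf1' : monic_deg (1 * m) f1 by rewrite mul1n; exact: tp_f1 tp.
  have hf2' : monic_deg (1 * n) f2 by rewrite mul1n; exact: tp_f2 tp.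
  have := fibre_polyE (ltn0Sn 0) m0 n0 (tp_co tp) hf1' hf2' (tp_U tp) (tp_V tp) (tp_eq tp) t.
  rewrite expr1 => /(congr1 (fun P => P.[p.[t]])).
  rewrite !hornerD !hornerN hornerC /fibre_poly horner_prod => e.
  rewrite horner_comp -e hornerZ horner_prod big_map.
  have -> : \prod_(x <- rootseq (f2 - t%:P)) ('X - (f1.[x])%:P).[p.[t]] =
      lead_coef Q ^+ n * \prod_(x <- rootseq (f2 - t%:P)) q.[x].
    rewrite -(size_roots hs2).
    have : {in rootseq (f2 - t%:P), forall x, f2.[x] = t}.
      by move=> x; rewrite (mem_roots_sub _ _ n0 (tp_f2 tp)) => /eqP.
    elim: (rootseq _) => [|x l IH] hl; first by rewrite !big_nil mulr1.
    rewrite !big_cons IH => [|y yl]; last by apply: hl; rewrite inE yl orbT.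
    have -> : ('X - (f1.[x])%:P).[p.[t]] = lead_coef Q * q.[x].
      rewrite -hornerZ -eQ /Q hornerXsubC hornerD hornerN horner_comp hl //.
      by rewrite inE eqxx.
    by rewrite /= exprS; ring.
  rewrite (norm_reciprocity (monic_deg_monic hs2) mq) (size_roots hs2) -!mulrA.
  apply/eqP; rewrite subr_eq0; apply/eqP; congr (_ * (_ * _)).
  rewrite size_map; elim: (rootseq q) => [|y l IH]; first by rewrite !big_nil mulr1.
  by rewrite !big_cons IH /= exprS !(hornerD, hornerN, hornerX, hornerC); ring.
have prN0 : \prod_(z <- r) ('X - z%:P) != 0 := monic_neq0 (monic_prod_XsubC _ _ _).
have EN0 : E != 0 by rewrite eE scaler_eq0 negb_or cN0.
split=> //; rewrite eE -mul_polyC mupMr ?rootC // mu_prod_XsubC count_map.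
have -> : (\sum_(x <- s) mup x Q = count (mem s) (rootseq q))%N.
  rewrite -sum_count_mem //; apply: eq_bigr => x _.
  by rewrite -mup_rootseq ?monic_neq0 // [in LHS]eQ -mul_polyC mupMr ?rootC.
by apply: sub_count => y ys /=; rewrite hs.
Qed.

End NormOrder.

(** Over [l] all points of [U] and [V] other than [u0] and [v0] are wildly ramified,
    as mildly as possible, and [x0] is the only point over [(u0, v0)]. *)
Record wild_pair (k : closedFieldType) (m n : nat) (f1 f2 U V : {poly k})
    (l u0 v0 x0 : k) : Prop := WildPair {
  wp_tp : tame_pair m n f1 f2 U V;
  wp_u0 : U.[u0] = l; wp_v0 : V.[v0] = l; wp_x1 : f1.[x0] = u0; wp_x2 : f2.[x0] = v0;
  wp_uniq : forall x, f1.[x] = u0 -> f2.[x] = v0 -> x = x0;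
  wp_tameU : mult U u0 = (dmult U u0).+1;
  wp_tameV : mult V v0 = (dmult V v0).+1;
  wp_wildU : forall u, U.[u] = l -> u != u0 -> dmult U u = mult U u;
  wp_wildV : forall v, V.[v] = l -> v != v0 -> dmult V v = mult V v }.

Lemma wild_pair_sym k m n f1 f2 U V l u0 v0 x0 :
  @wild_pair k m n f1 f2 U V l u0 v0 x0 -> wild_pair n m f2 f1 V U l v0 u0 x0.
Proof. by case=> tp *; split=> //; [exact: tame_pair_sym|eauto]. Qed.

Section WildPair.
Variable k : closedFieldType.
Variables (m n : nat) (f1 f2 U V : {poly k}) (l u0 v0 x0 : k).
Hypothesis wp : wild_pair m n f1 f2 U V l u0 v0 x0.
Let tp := wp_tp wp.
Let m0 := tp_m0 tp.
Let n0 := tp_n0 tp.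
Implicit Types (x u v : k).

Lemma wild_zero u : U.[u] = l -> u != u0 -> (mult U u)%:R = 0 :> k.
Proof.
move=> ul nu; apply/eqP/negPn/negP => /(dmult_tame n0 (tp_U tp)).
by rewrite (wp_wildU wp ul nu); lia.
Qed.

Lemma tame_nonzero : (mult U u0)%:R != 0 :> k.
Proof.
apply/eqP => /(dmult_wild n0 (tp_nN0 tp) (tp_U tp)).
by rewrite (wp_tameU wp) ltnn.
Qed.

(** Comparing differents, every point over [u0] other than [x0] lies over a wild
    [v], which makes the different exponent of [f1] at least its index. *)
Lemma euler_equation : ('X - x0%:P) * f1^`() = m%:R *: (f1 - u0%:P).
Proof.
have fN0 := sub_neq0 m0 (tp_f1 tp) u0; have hf := monic_degB u0 m0 (tp_f1 tp).
have dN0 := deriv_neq0 (tp_mN0 tp) (tp_f1 tp).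
have XN0 : 'X - x0%:P != 0 :> {poly k} by rewrite polyXsubC_eq0.
have dv : f1 - u0%:P %| ('X - x0%:P) * f1^`().
  apply: dvdp_mup; rewrite ?mulf_neq0 ?(monic_deg_monic hf) // => x.
  have [e1|ne] := eqVneq f1.[x] u0; last first.
    by rewrite mupNroot // /root !(hornerD, hornerN, hornerC) subr_eq0.
  rewrite mupM // (mup_XsubCX 1) -e1 -/(mult f1 x) -/(dmult f1 x).
  have [_|nx] := eqVneq x0 x; first exact: (mult_le_dmult m0 (tp_mN0 tp) (tp_f1 tp)).
  have vl : V.[f2.[x]] = l by rewrite -(tp_values tp) e1 (wp_u0 wp).
  have nv : f2.[x] != v0.
    by apply: contraNneq nx => ev; rewrite (wp_uniq wp e1 ev).
  have := tp_mult tp x.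
  have : (mult f1 x * dmult U f1.[x] + dmult f1 x = mult f2 x * dmult V f2.[x] + dmult f2 x)%N.
    by case: tp => *; apply: (@dmult_composite _ m n).
  rewrite (wp_wildV wp vl nv) e1 (wp_tameU wp); lia.
have sX : size (('X - x0%:P) * f1^`()) = m.+1.
  by rewrite size_monicM ?monicXsubC // size_XsubC (size_deriv_tame m0 (tp_mN0 tp) (tp_f1 tp)).
have /dvdpP[q eq] := dv; have qN0 : q != 0.
  by apply: contra_eq_neq eq => ->; rewrite mul0r mulf_neq0.
have sq : size q = 1%N.
  have := congr1 (fun p : {poly k} => size p) eq.
  rewrite sX size_mul // (monic_deg_size hf) addnS /= => /eqP.
  have : (0 < size q)%N by rewrite size_poly_gt0.
  by move: (size q); lia.
have eqc := size1_polyC (eq_leq sq); rewrite eq eqc mul_polyC; congr (_ *: _).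
have := congr1 (@lead_coef k) eq; rewrite eqc mul_polyC lead_coefZ.
rewrite (monicP (monic_deg_monic hf)) mulr1 => <-.
rewrite lead_coefM (monicP (monicXsubC _)) mul1r lead_coefE.
rewrite (size_deriv_tame m0 (tp_mN0 tp) (tp_f1 tp)) coef_deriv prednK //.
by have /monic_degP[/monicP + sf] := tp_f1 tp; rewrite lead_coefE sf coefC /= => ->.
Qed.

Lemma wild_deriv x : (x - x0) * f1^`().[x] = m%:R * (f1.[x] - u0).
Proof.
have := congr1 (fun p => p.[x]) euler_equation.
by rewrite hornerM hornerXsubC hornerZ hornerD hornerN hornerC.
Qed.

Lemma unramified_off x : f1.[x] != u0 -> mult f1 x = 1%N.
Proof.
move=> nu; apply/eqP; rewrite (mult1_deriv m0 (tp_mN0 tp) (tp_f1 tp)).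
have : (x - x0) * f1^`().[x] != 0 by rewrite wild_deriv mulf_neq0 ?subr_eq0 // (tp_mN0 tp).
by rewrite mulf_eq0 negb_or => /andP[].
Qed.

End WildPair.

Section WildIndex.
Variable k : closedFieldType.
Variables (m n : nat) (f1 f2 U V : {poly k}) (l u0 v0 x0 : k).
Hypothesis wp : wild_pair m n f1 f2 U V l u0 v0 x0.
Let tp := wp_tp wp.
Let wp' := wild_pair_sym wp.
Let m0 := tp_m0 tp.
Let n0 := tp_n0 tp.
Variables (u1 v1 : k).
Hypotheses (hu1 : U.[u1] = l) (nu1 : u1 != u0) (hv1 : V.[v1] = l) (nv1 : v1 != v0).

Lemma wild_index : size (pts f1 f2 u1 v1) = mult U u1.
Proof.
rewrite -(tp_sum2 tp (v := v1)) ?hu1 ?hv1 // -[LHS]muln1 -sum_const_seq !big_seq.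
apply: eq_bigr => x; rewrite (tp_pts tp) => /andP[_ /eqP e].
by rewrite (unramified_off wp') // e.
Qed.

Lemma wild_index_eq : mult U u1 = mult V v1.
Proof.
rewrite -wild_index -(tp_sum1 tp (u := u1)) ?hu1 ?hv1 // -[LHS]muln1 -sum_const_seq !big_seq.
apply: eq_bigr => x; rewrite (tp_pts tp) => /andP[/eqP e _].
by rewrite (unramified_off wp) // e.
Qed.

Lemma wild_index_gt1 : (1 < mult U u1)%N.
Proof.
have := mult_gt0 n0 (tp_U tp) u1; have := wild_zero wp hu1 nu1.
by case: (mult U u1) => [|[|]] // /eqP; rewrite oner_eq0.
Qed.

(** Let [L] be the common index and let [p \Po f2] approximate [f1] at a point [x1]
    over [(u1, v1)] to an order [N > L]. The equation [euler_equation] makes the first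
    order terms of the expansion the same at all [L] points over [(u1, v1)], so the
    norm of [p \Po f2 - f1] vanishes to order at least [N + 2 (L - 1)] at [v1]. It is
    the perturbation [U \Po (f1 + (p \Po f2 - f1)) - (U \Po f1)], of order [N + L]. *)
Lemma wild_index_le2 : (mult U u1 <= 2)%N.
Proof.
set L := mult U u1; have L1 := wild_index_gt1; rewrite -/L in L1.
have sz := wild_index; rewrite -/L in sz.
case E: (pts f1 f2 u1 v1) sz => [|x1 s]; first by move=> e; rewrite -e in L1.
have all_pts x : x \in x1 :: s -> f1.[x] = u1 /\ f2.[x] = v1.
  by rewrite -E (tp_pts tp) => /andP[/eqP ? /eqP ?].
have [e1 e2] : f1.[x1] = u1 /\ f2.[x1] = v1 by apply: all_pts; rewrite inE eqxx.
have um : mult f2 x1 = 1%N by rewrite (unramified_off wp') // e2.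
move=> /= sz; have us : uniq (x1 :: s) by rewrite -E; apply: pts_uniq.
have fN0 := sub_neq0 n0 (tp_f2 tp).
have [p dv] := local_expansion f1 L.+1 (fN0 _) um.
set Q := p \Po f2 - f1 in dv.
have QN0 : Q != 0.
  apply/eqP => /eqP; rewrite subr_eq0 => /eqP e.
  have := size_comp_poly p f2; rewrite e (monic_deg_size (tp_f1 tp)) (monic_deg_size (tp_f2 tp)).
  rewrite /= => em; have nm : (n %| m)%N by rewrite em dvdn_mull.
  have := tp_co tp; rewrite /coprime gcdnC (gcdn_idPl nm) => /eqP en.
  by have := tp_n tp; rewrite en.
have [EN0 le] := norm_order tp QN0 us (fun x xs => (all_pts x xs).2).
set M := mup x1 Q; have LM : (L < M)%N by rewrite /M mup_geq.
have pv x : x \in x1 :: s -> Q.[x] = 0.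
  have : Q.[x1] = 0.
    apply/eqP; rewrite -[_ == 0]/(root Q x1) -dvdp_XsubCl.
    by apply: dvdp_trans dv; rewrite exprS dvdp_mulr.
  by rewrite /Q !(hornerD, hornerN) !horner_comp => h /all_pts[-> ->]; rewrite -e1 -e2.
have dpv x : x \in x1 :: s -> Q^`().[x] = 0.
  move=> xs; have [ex1 ex2] := all_pts x xs.
  have nx y : y \in x1 :: s -> y - x0 != 0.
    move=> ys; rewrite subr_eq0; apply: contraNneq nu1 => ey.
    by have [<- _] := all_pts y ys; rewrite ey (wp_x1 wp).
  have hd y : y \in x1 :: s -> (y - x0) * Q^`().[y] = p^`().[v1] * (n%:R * (v1 - v0)) - m%:R * (u1 - u0).
    move=> ys; have [ey1 ey2] := all_pts y ys.
    rewrite -ey1 -(wild_deriv wp) -[in v1 - v0]ey2 -(wild_deriv wp') /Q derivB deriv_comp.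
    rewrite hornerD hornerN hornerM horner_comp ey2; ring.
  have dx1 : Q^`().[x1] = 0.
    have /dvdpP[t ->] : ('X - x1%:P) ^+ 2 %| Q.
      by apply: dvdp_trans dv; apply: dvdp_exp2l; rewrite ltnS ltnW.
    exact: deriv_sqr_root.
  apply: (mulfI (nx x xs)); rewrite mulr0 hd // -(hd x1) ?inE ?eqxx // dx1 mulr0.
  by [].
have ge : (M + 2 * size s <= \sum_(x <- x1 :: s) mup x Q)%N.
  rewrite big_cons leq_add2l mulnC -sum_const_seq; apply: leq_sum_seq_in => x xs.
  have xs' : x \in x1 :: s by rewrite inE xs orbT.
  by apply: deriv_root_double => //; rewrite /root ?pv ?dpv.
have eo : mup x1 (U \Po (f1 + Q) - (U \Po f1)) = mup v1 (U \Po p - V)%R.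
  have -> : U \Po (f1 + Q) - (U \Po f1) = (U \Po p - V) \Po f2.
    by rewrite [f1 + Q]addrC /Q subrK (tp_eq tp) rmorphB /= comp_polyA.
  rewrite mup_comp // ?(monic_deg_size (tp_f2 tp)) // -/(mult f2 x1) um muln1 e2.
  by [].
have sf1 : (1 < size f1)%N by rewrite (monic_deg_size (tp_f1 tp)).
have dUN0 := deriv_neq0 (tp_nN0 tp) (tp_U tp).
have dL : mup x1 (U^`() \Po f1) = L.
  rewrite mup_comp // -/(mult f1 x1) (unramified_off wp) ?e1 // muln1 -/(dmult U u1).
  exact: (wp_wildU wp).
have dN0 : U^`() \Po f1 != 0.
  by apply: contra_neq dUN0 => e; apply: (comp_poly_inj sf1); rewrite e comp_poly0.
have := mup_perturbation QN0 dN0 (x := x1); rewrite dL -/M => /(_ LM); rewrite eo => em.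
by move: (leq_trans ge le); rewrite em -sz leq_add2l; move: (size s) => t; clear; lia.
Qed.

Lemma wild_index2 : mult U u1 = 2%N /\ 2%:R = 0 :> k.
Proof.
have e : mult U u1 = 2%N by apply/eqP; rewrite eqn_leq wild_index_le2 wild_index_gt1.
by split=> //; rewrite -(wild_zero wp hu1 nu1) e.
Qed.

(** The indices over [(u0, v1)] satisfy [e * mult U u0 = 2], and the index at [u0] is
    not divisible by the characteristic. *)
Lemma tame_index1 : mult U u0 = 1%N.
Proof.
have [e two] := wild_index2; have ef := wild_index_eq.
have [x x1 x2] : exists2 x, f1.[x] = u0 & f2.[x] = v1.
  by apply: (tp_exist tp); rewrite (wp_u0 wp) hv1.
have := tp_mult tp x; rewrite x1 x2 -ef e (unramified_off wp') ?x2 // mul1n => h.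
have := tame_nonzero wp; have : (mult U u0 %| 2)%N by rewrite -h dvdn_mull.
by rewrite dvdn_divisors // !inE => /orP[/eqP -> //|/eqP ->]; rewrite two eqxx.
Qed.

End WildIndex.

(** * The wild case in characteristic two *)

Section SquarePart.
Variable k : closedFieldType.

Lemma square_part N (f : {poly k}) x0 : (0 < N)%N -> monic_deg N f -> mult f x0 = 1%N ->
  (forall x, f.[x] = f.[x0] -> x != x0 -> mult f x = 2%N) ->
  exists2 H : {poly k}, H \is monic &
    [/\ f - (f.[x0])%:P = ('X - x0%:P) * H ^+ 2, H.[x0] != 0 &
        forall x, root H x -> ~~ root H^`() x].
Proof.
move=> N0 hf m0 m2; have hg := monic_degB f.[x0] N0 hf.
have mE x : mup x (f - (f.[x0])%:P) =
    (if x == x0 then 1 else if f.[x] == f.[x0] then 2 else 0)%N.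
  have [->//|nx] := eqVneq x x0; case: eqP => [e|ne]; first by rewrite -e; apply: m2.
  by rewrite mupNroot // /root !(hornerD, hornerN, hornerC) subr_eq0; apply/eqP.
have [||H mH [eH hH]] := odd_part (T := [:: x0]) (monic_deg_monic hg) => //.
  by move=> x; rewrite mE inE; case: eqP => // _; case: ifP.
exists H => //; split.
- by rewrite eH big_seq1.
- apply/negP => r; have := hH x0; rewrite mE inE eqxx.
  have : (0 < mup x0 H)%N by rewrite -XsubC_dvd ?monic_neq0 // dvdp_XsubCl.
  by move: (mup x0 H); lia.
- move=> x r; apply/negP => rd; have := deriv_root_double (monic_neq0 mH) r rd.
  have := hH x; rewrite mE inE; move: (mup x H) => M; case: eqP => _; first by lia.
  by case: ifP => _; lia.
Qed.

End SquarePart.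

Section WildExplicit.
Variable k : closedFieldType.
Variables (m n : nat) (f1 f2 U V : {poly k}) (l u0 v0 x0 : k).
Hypothesis wp : wild_pair m n f1 f2 U V l u0 v0 x0.
Hypothesis two : 2%:R = 0 :> k.
Let tp := wp_tp wp.
Variables (H G A B : {poly k}).
Hypotheses (mH : H \is monic).
Hypotheses (eH : f1 - u0%:P = ('X - x0%:P) * H ^+ 2).
Hypotheses (eG : f2 - v0%:P = ('X - x0%:P) * G ^+ 2).
Hypotheses (eA : U - l%:P = ('X - u0%:P) * A ^+ 2).
Hypotheses (eB : V - l%:P = ('X - v0%:P) * B ^+ 2).
Implicit Types (x u v : k).

Lemma deriv_mul_sqr (f T : {poly k}) c x : f - c%:P = ('X - x%:P) * T ^+ 2 -> f^`() = T ^+ 2.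
Proof.
move=> e; have -> : f^`() = (f - c%:P)^`() by rewrite derivB derivC subr0.
rewrite e derivM derivXsubC mul1r expr2 derivM [T * T^`()]mulrC (add_self2 two) mulr0 addr0.
by [].
Qed.

Lemma horner_mul_sqr (f T : {poly k}) c a x : f - c%:P = ('X - a%:P) * T ^+ 2 ->
  f.[x] - c = (x - a) * T.[x] ^+ 2.
Proof.
move=> /(congr1 (fun p => p.[x])).
by rewrite hornerD hornerN hornerC hornerM hornerXsubC horner_exp.
Qed.

Lemma sqr_inj_char2 (p q : {poly k}) : p ^+ 2 = q ^+ 2 -> p = q.
Proof.
by move/eqP; rewrite eqf_sqr (opp_char2 two) orbb => /eqP.
Qed.

(** Both sides have the square [(U \Po f1 - l) / ('X - x0)], and square roots are
    unique in characteristic 2. *)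
Lemma wild_square_root : H * (A \Po f1) = G * (B \Po f2).
Proof.
apply: sqr_inj_char2; apply: (mulfI (x := 'X - x0%:P)); first by rewrite polyXsubC_eq0.
have h T a f c S : f - c%:P = ('X - x0%:P) * T ^+ 2 -> S - l%:P = ('X - c%:P) * a ^+ 2 ->
    ('X - x0%:P) * (T * (a \Po f)) ^+ 2 = (S \Po f) - l%:P.
  move=> e1 e2; rewrite -(comp_polyC l f) -rmorphB /= e2 rmorphM rmorphXn rmorphB /=.
  by rewrite comp_polyX comp_polyC e1; ring.
by rewrite (h _ _ _ _ _ eH eA) (h _ _ _ _ _ eG eB) (tp_eq tp).
Qed.

Lemma wild_square_root_deriv x :
  H^`().[x] * A.[f1.[x]] + H.[x] ^+ 3 * A^`().[f1.[x]] =
  G^`().[x] * B.[f2.[x]] + G.[x] ^+ 3 * B^`().[f2.[x]].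
Proof.
have := congr1 (fun p => p^`().[x]) wild_square_root.
rewrite !derivM !deriv_comp (deriv_mul_sqr eH) (deriv_mul_sqr eG).
rewrite !(hornerD, hornerM, horner_comp) => h.
have cube (a b : k) : a ^+ 3 * b = a * (b * (a * a)) by ring.
by rewrite !cube.
Qed.

Hypothesis A_u0 : A.[u0] != 0.
Hypothesis H_x0 : H.[x0] != 0.

Lemma root_sqr_part (f T : {poly k}) c a y : f - c%:P = ('X - a%:P) * T ^+ 2 ->
  f.[y] = c -> y != a -> T.[y] = 0.
Proof.
move=> /(horner_mul_sqr y) + e ne; rewrite e subrr => /esym/eqP.
by rewrite mulf_eq0 subr_eq0 (negPf ne) expf_eq0 /= => /eqP.
Qed.

(** Differentiating [H * (A \Po f1) = G * (B \Po f2)] where [A] and [B] vanish. *)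
Lemma wild_constant x : U.[f1.[x]] = l -> f1.[x] != u0 -> f2.[x] != v0 ->
  (f1.[x] - u0) ^+ 3 * A^`().[f1.[x]] ^+ 2 = (f2.[x] - v0) ^+ 3 * B^`().[f2.[x]] ^+ 2.
Proof.
move=> ul nu nv; have vl : V.[f2.[x]] = l by rewrite -(tp_values tp).
have := wild_square_root_deriv x.
rewrite (root_sqr_part eA ul nu) (root_sqr_part eB vl nv) !mulr0 !add0r => h.
rewrite (horner_mul_sqr x eH) (horner_mul_sqr x eG).
transitivity ((x - x0) ^+ 3 * (H.[x] ^+ 3 * A^`().[f1.[x]]) ^+ 2); first by ring.
rewrite h; ring.
Qed.

Variables (u1 : k).
Hypotheses (hu1 : U.[u1] = l) (nu1 : u1 != u0) (sA : A^`().[u1] != 0).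
Hypothesis sH : forall x, root H x -> ~~ root H^`() x.

(** The identities above show that [(h - x0) ^+ 3 * H^`().[h] ^+ 2] has the same value
    at all roots [h] of [H], so [H] satisfies a Riccati equation. *)
Lemma lucas_of_wild : f1 = lucasV ('X - x0%:P)
   ((((u1 - u0) ^+ 3 * A^`().[u1] ^+ 2) / (H.[x0] * A.[u0]) ^+ 2) ^+ 2)%:P m + u0%:P.
Proof.
set g := (u1 - u0) ^+ 3 * A^`().[u1] ^+ 2.
have g0 : g != 0 by rewrite mulf_neq0 ?expf_neq0 ?subr_eq0.
have val h : root H h -> (h - x0) ^+ 3 * H^`().[h] ^+ 2 = g / A.[u0] ^+ 2.
  move=> /eqP rh; have nh : h != x0 by apply: contraNneq H_x0 => <-; rewrite rh.
  have e1 : f1.[h] = u0.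
    by apply/eqP; rewrite -subr_eq0 (horner_mul_sqr h eH) rh expr0n mulr0.
  have nv : f2.[h] != v0 by apply: contraNneq nh => e2; rewrite (wp_uniq wp e1 e2).
  have ul : U.[f1.[h]] = l by rewrite e1 (wp_u0 wp).
  have vl : V.[f2.[h]] = l by rewrite -(tp_values tp).
  have := wild_square_root_deriv h.
  rewrite (root_sqr_part eB vl nv) rh e1 expr0n mul0r mulr0 addr0 add0r => eh.
  have [x x1 x2] : exists2 x, f1.[x] = u1 & f2.[x] = f2.[h].
    by apply: (tp_exist tp); rewrite hu1 vl.
  have := @wild_constant x; rewrite x1 x2 -/g => /(_ hu1 nu1 nv) ->.
  apply: (mulIf (x := A.[u0] ^+ 2)); first by rewrite expf_neq0.
  rewrite divfK ?expf_neq0 // (horner_mul_sqr h eG).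
  transitivity ((h - x0) ^+ 3 * (H^`().[h] * A.[u0]) ^+ 2); first by ring.
  rewrite eh; ring.
have m0 := tp_m0 tp; have hf := monic_degB u0 m0 (tp_f1 tp).
have hH : monic_deg (size H).-1 H.
  by apply/monic_degP; rewrite prednK ?size_poly_gt0 ?monic_neq0.
have em : m = (size H).-1.*2.+1.
  have h1 := monic_degM (monic_deg_XsubC x0) (monic_degXn 2 hH).
  have := monic_deg_size h1; rewrite -eH (monic_deg_size hf); move: (size H) => t; clear; lia.
have ric := riccati_of_values two mH sH H_x0 val.
apply: (addIr (- u0%:P)); rewrite addrK eH em.
have -> : g / (H.[x0] * A.[u0]) ^+ 2 = g / A.[u0] ^+ 2 / H.[x0] ^+ 2.
  by rewrite exprMn invfM mulrA mulrAC.
apply: (lucas_of_riccati two _ _ (monic_deg_XsubC x0) hH ric).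
  by rewrite mulf_neq0 ?invr_eq0 ?expf_neq0 // mulf_neq0 ?invr_eq0 ?expf_neq0.
by rewrite mulf_neq0 ?invr_eq0 ?expf_neq0.
Qed.

End WildExplicit.

Section WildCase.
Variable k : closedFieldType.
Variables (m n : nat) (f1 f2 U V : {poly k}).

Lemma wild_squares l u0 v0 x0 u1 v1 (wp : wild_pair m n f1 f2 U V l u0 v0 x0) :
  U.[u1] = l -> u1 != u0 -> V.[v1] = l -> v1 != v0 ->
  (exists2 H, H \is monic & [/\ f1 - u0%:P = ('X - x0%:P) * H ^+ 2, H.[x0] != 0 &
      forall x, root H x -> ~~ root H^`() x]) /\
  (exists2 A, A \is monic & [/\ U - l%:P = ('X - u0%:P) * A ^+ 2, A.[u0] != 0 &
      forall x, root A x -> ~~ root A^`() x]).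
Proof.
move=> hu1 nu1 hv1 nv1; have wp' := wild_pair_sym wp; have tp := wp_tp wp.
have [eV _] := wild_index2 wp' hv1 nv1 hu1 nu1.
have mU0 := tame_index1 wp hu1 nu1 hv1 nv1; have mV0 := tame_index1 wp' hv1 nv1 hu1 nu1.
split.
  rewrite -(wp_x1 wp); apply: (square_part (tp_m0 tp) (tp_f1 tp)) => [|x ex nx].
    apply/eqP; rewrite eqn_leq (mult_gt0 (tp_m0 tp) (tp_f1 tp)) andbT -mV0.
    rewrite -(tp_sum1 tp (u := u0)) ?(wp_u0 wp) ?(wp_v0 wp) //.
    by apply: leq_sum_seq1; rewrite (tp_pts tp) (wp_x1 wp) (wp_x2 wp) !eqxx.
  rewrite (wp_x1 wp) in ex.
  have vl : V.[f2.[x]] = l by rewrite -(tp_values tp) ex (wp_u0 wp).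
  have nv : f2.[x] != v0 by apply: contraNneq nx => e2; rewrite (wp_uniq wp ex e2).
  have [eVx _] := wild_index2 wp' vl nv hu1 nu1.
  have := tp_mult tp x; rewrite ex mU0 eVx (unramified_off wp') //.
  by rewrite muln1 mul1n.
rewrite -(wp_u0 wp); apply: (square_part (tp_n0 tp) (tp_U tp)) => // u.
rewrite (wp_u0 wp) => ul nu; by have [] := wild_index2 wp ul nu hv1 nv1.
Qed.

End WildCase.

Section WildConclusion.
Variable k : closedFieldType.
Variables (m n : nat) (f1 f2 U V : {poly k}).
Hypothesis tp : tame_pair m n f1 f2 U V.

Lemma lucas_of_wild_pair l u0 v0 x0 u1 v1 (wp : wild_pair m n f1 f2 U V l u0 v0 x0) :
  U.[u1] = l -> u1 != u0 -> V.[v1] = l -> v1 != v0 ->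
  exists c a b1 b2, f1 = lucasV ('X - c%:P) a%:P m + b1%:P /\
                    f2 = lucasV ('X - c%:P) a%:P n + b2%:P.
Proof.
move=> hu1 nu1 hv1 nv1; have wp' := wild_pair_sym wp;
have [_ two] := wild_index2 wp hu1 nu1 hv1 nv1.
have [[H mH [eH H0 sH]] [A mA [eA A0 sA]]] := wild_squares wp hu1 nu1 hv1 nv1.
have [[G mG [eG G0 sG]] [B mB [eB B0 sB]]] := wild_squares wp' hv1 nv1 hu1 nu1.
have rA : A^`().[u1] != 0 by apply: sA; rewrite /root (root_sqr_part eA hu1 nu1).
have rB : B^`().[v1] != 0 by apply: sB; rewrite /root (root_sqr_part eB hv1 nv1).
pose a := (((u1 - u0) ^+ 3 * A^`().[u1] ^+ 2) / (H.[x0] * A.[u0]) ^+ 2) ^+ 2.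
exists x0, a, u0, v0; split.
  exact: (lucas_of_wild wp two mH eH eG eA eB A0 H0 hu1 nu1 rA sH).
have [x x1 x2] : exists2 x, f1.[x] = u1 & f2.[x] = v1.
  by apply: (tp_exist tp); rewrite hu1 hv1.
have ea := wild_constant wp two eH eG eA eB (x := x).
rewrite x1 x2 in ea; rewrite /a ea //.
have := congr1 (fun p => p.[x0]) (wild_square_root wp two eH eG eA eB).
rewrite !(hornerM, horner_comp) (wp_x1 wp) (wp_x2 wp) => ->.
exact: (lucas_of_wild wp' two mG eG eH eB eA B0 G0 hv1 nv1 rB sG).
Qed.

End WildConclusion.

Lemma critical_values_sym (k : closedFieldType) (U V : {poly k}) :
  critical_values U V =i critical_values V U.
Proof. by move=> l; rewrite !mem_undup !mem_cat orbC. Qed.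

Section Classification.
Variable k : closedFieldType.
Variables (m n : nat) (f1 f2 U V : {poly k}).
Hypothesis tp : tame_pair m n f1 f2 U V.

Lemma classification_of_wild_type :
  wild_type (critical_values U V) (fib U) (fib V) (mult U) (dmult U) (mult V) (dmult V) ->
  [\/ exists c b, f2 = ('X - c%:P) ^+ n + b%:P,
      exists c b, f1 = ('X - c%:P) ^+ m + b%:P |
      exists c a b1 b2, f1 = lucasV ('X - c%:P) a%:P m + b1%:P /\
                        f2 = lucasV ('X - c%:P) a%:P n + b2%:P].
Proof.
case=> l [u0 [v0 [lS [u0l v0l] [tU wU] [tV wV] co]]].
have eu0 : U.[u0] = l by apply/eqP; rewrite -(mem_fibU tp).
have ev0 : V.[v0] = l by apply/eqP; rewrite -(mem_fibV tp).
have sz : (size (pts f1 f2 u0 v0) <= 1)%N.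
  rewrite -(eqP co); have uv : U.[u0] = V.[v0] by rewrite eu0.
  by case: tp => *; apply: (@size_pts _ m n).
have [x0 x1 x2] : exists2 x, f1.[x] = u0 & f2.[x] = v0.
  by apply: (tp_exist tp); rewrite eu0 ev0.
have wp : wild_pair m n f1 f2 U V l u0 v0 x0.
  split=> // [x ex1 ex2|u ul|v vl].
  - have hx : x \in pts f1 f2 u0 v0 by rewrite (tp_pts tp) ex1 ex2 !eqxx.
    have hx0 : x0 \in pts f1 f2 u0 v0 by rewrite (tp_pts tp) x1 x2 !eqxx.
    case: (pts _ _ _ _) sz hx hx0 => [|y [|]] // _; rewrite !inE.
    by move=> /eqP -> /eqP ->.
  - by apply: wU; rewrite (mem_fibU tp) ul.
  - by apply: wV; rewrite (mem_fibV tp) vl.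
have single (p : {poly k}) (y : k) : y \in fib p l -> ~~ has (predC1 y) (fib p l) -> size (fib p l) = 1%N.
  move=> yl /hasPn h; have u := fib_uniq p l.
  have : (size (fib p l) <= size [:: y])%N.
    by apply: uniq_leq_size => // z /h /=; rewrite negbK inE.
  by case: (fib p l) yl => [|? []].
have [/hasP[u1 u1l nu1]|/(single _ _ u0l) s] := boolP (has (predC1 u0) (fib U l)); last first.
  by constructor 1; apply: (power_of_single tp lS s).
have [/hasP[v1 v1l nv1]|/(single _ _ v0l) s] := boolP (has (predC1 v0) (fib V l)); last first.
  constructor 2; apply: (power_of_single (tame_pair_sym tp) _ s).
  by rewrite critical_values_sym.
constructor 3; apply: (lucas_of_wild_pair tp wp (u1 := u1) (v1 := v1)) => //.
  by apply/eqP; rewrite -(mem_fibU tp).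
by apply/eqP; rewrite -(mem_fibV tp).
Qed.

Lemma tame_pair_classification :
  [\/ exists c b, f2 = ('X - c%:P) ^+ n + b%:P,
      exists c b, f1 = ('X - c%:P) ^+ m + b%:P |
      exists c a b1 b2, f1 = lucasV ('X - c%:P) a%:P m + b1%:P /\
                        f2 = lucasV ('X - c%:P) a%:P n + b2%:P].
Proof.
have co : coprime n m by rewrite coprime_sym (tp_co tp).
have [[[l lS s]|[l lS s]]|d|d|w] := ramification_types (tp_ramification tp) co.
- by constructor 1; apply: (power_of_single tp lS s).
- constructor 2; apply: (power_of_single (tame_pair_sym tp) _ s).
  by rewrite critical_values_sym.
- by constructor 3; apply: (lucas_of_dickson_type tp d).
- constructor 3; have d' : dickson_type (critical_values V U) (fib V) (fib U)
      (mult V) (dmult V) (mult U) (dmult U).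
    by case: d => l1 [l2 [? ? ? ? ?]]; exists l1, l2; split; rewrite ?(critical_values_sym V).
  have [c [a [b1 [b2 [e1 e2]]]]] := lucas_of_dickson_type (tame_pair_sym tp) d'.
  by exists c, a, b2, b1.
- exact: classification_of_wild_type.
Qed.

End Classification.

(** * Left factors of polynomials in a power of the variable *)

Section CyclicSupport.
Variable K : fieldType.
Implicit Types (p q F U V A B : {poly K}).

Definition support_mod n r p := forall i, p`_i != 0 -> (i = r %[mod n])%N.

Lemma support_modM n r s p q :
  support_mod n r p -> support_mod n s q -> support_mod n (r + s) (p * q).
Proof.
move=> hp hq i; rewrite coefM => nz.
have [j] : exists j : 'I_i.+1, p`_j * q`_(i - j) != 0.
  apply/existsP; apply: contraNT nz; rewrite negb_exists => /forallP h.
  by rewrite big1 // => j _; apply/eqP/negPn/h.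
rewrite mulf_eq0 negb_or => /andP[/hp e1 /hq e2].
by rewrite -modnDm -e1 -e2 modnDm subnKC // -ltnS.
Qed.

Lemma support_modX n r p k : support_mod n r p -> support_mod n (k * r) (p ^+ k).
Proof.
move=> hp; elim: k => [|k IH]; last by rewrite mulSn exprS; apply: support_modM.
by move=> [|i]; rewrite expr0 coef1 //= eqxx.
Qed.

Lemma support_mod_comp n r p : (r < n)%N -> support_mod n r p ->
  exists P, p = 'X^r * (P \Po 'X^n).
Proof.
move=> rn hp; have n0 : (0 < n)%N by apply: leq_ltn_trans rn.
exists (\poly_(i < size p) p`_(i * n + r)); apply/polyP => i.
rewrite coefXnM coef_comp_poly_Xn //; case: ltnP => ir.
  apply/eqP/negPn/negP => /hp; rewrite (modn_small rn) modn_small; last exact: ltn_trans rn.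
  by move=> e; rewrite e ltnn in ir.
case: ifP => [dv|/negP ndv]; last first.
  apply/eqP/negPn/negP => /hp e; apply: ndv.
  by rewrite -(eqn_mod_dvd _ ir) e.
rewrite coef_poly divnK // subnK //; case: ltnP => // le.
rewrite nth_default //; apply: leq_trans le _.
by apply: leq_trans (leq_subr r i); apply: leq_div.
Qed.

Lemma coef_mul_top a j p q : monic_deg a p -> (size q <= j.+1)%N -> (p * q)`_(a + j) = q`_j.
Proof.
move=> /monic_degP[mp sp]; rewrite leq_eqVlt => /orP[/eqP sq|lt].
  have := lead_coef_Mmonic q mp; rewrite mulrC !lead_coefE size_monicM ?sp ?sq //.
    by rewrite addSn /= addnS.
  by rewrite -size_poly_gt0 sq.
rewrite !nth_default //; apply: leq_trans (size_polyMleq _ _) _; rewrite sp addSn /=.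
by rewrite leq_add2l.
Qed.

(** At the largest positive exponent [j] of [F] not congruent to [m], the coefficient
    of degree [m (n - 1) + j] in [U \Po F] is [n * F`_j], because the exponents of the
    [n]-th power of the part of [F] above [j] are multiples of [n]. *)
Lemma cyclic_support m n F U V : (0 < m)%N -> (0 < n)%N -> n%:R != 0 :> K ->
  monic_deg m F -> monic_deg n U -> U \Po F = V \Po 'X^n ->
  forall j, (0 < j)%N -> F`_j != 0 -> (j = m %[mod n])%N.
Proof.
case: n => [//|n] m0 _ nN0 hF hU e.
pose bad j := [&& (0 < j)%N, F`_j != 0 & (j %% n.+1 != m %% n.+1)%N].
have bad_le j : bad j -> (j <= m)%N.
  case/and3P=> _ h _; rewrite -ltnS -(monic_deg_size hF) ltnNge.
  by apply: contra h => /leq_sizeP/(_ _ (leqnn _)) ->.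
suff nb j : ~~ bad j.
  move=> j j0 fj; apply/eqP; apply: contraT => ne.
  by case/negP: (nb j); rewrite /bad j0 fj.
apply/negP => bj; have [{bj}j bj jmax] := ex_maxnP (ex_intro _ j bj) bad_le.
have /and3P[j0 fj jm] := bj.
have lt_jm : (j < m)%N.
  rewrite ltn_neqAle bad_le // andbT.
  by apply: contraNneq jm => ->.
pose A := drop_poly j.+1 F * 'X^(j.+1); pose B := take_poly j.+1 F.
have eF : F = A + B by rewrite addrC poly_take_drop.
have cB i : B`_i = if (i <= j)%N then F`_i else 0 by rewrite coef_take_poly ltnS.
have cA i : A`_i = if (i <= j)%N then 0 else F`_i.
  have := congr1 (fun p : {poly K} => p`_i) eF; rewrite coefD cB => ->.
  by case: leqP => h; rewrite ?addr0 //; rewrite /A coefMXn ltnS h.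
have sA : support_mod n.+1 m A.
  move=> i; rewrite cA; case: leqP => [_|ji] fi; first by rewrite eqxx in fi.
  apply/eqP; apply: contraT => ne; have : bad i by rewrite /bad fi (leq_ltn_trans _ ji).
  by move/jmax; rewrite leqNgt ji.
have sB : (size B <= j.+1)%N by exact: size_take_poly.
have hA : monic_deg m A.
  have -> : A = F - B by rewrite eF; ring.
  by apply: monic_degD => //; rewrite size_polyN (leq_trans sB).
set E := (m * n + j)%N.
have hE : ~~ (n.+1 %| E)%N.
  apply: contra jm => dE; rewrite -(eqn_modDl (m * n)) -/E.
  have -> : (m * n + m = m * n.+1)%N by rewrite mulnSr.
  by rewrite modnMl.
have := congr1 (fun p : {poly K} => p`_E) e.
rewrite coef_comp_poly_Xn // (negPf hE).
have -> : U = 'X^(n.+1) + (U - 'X^(n.+1)) by ring.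
have sU : (size (U - 'X^(n.+1))%R <= n.+1)%N.
  apply/leq_sizeP => i; rewrite leq_eqVlt => /orP[/eqP <-|lt].
    have /monic_degP[/monicP + sU] := hU; rewrite lead_coefE sU coefB coefXn /= => ->; rewrite eqxx.
    exact: subrr.
  by rewrite coefB coefXn nth_default ?(monic_deg_size hU) // gtn_eqF // subr0.
rewrite rmorphD coefD /= [X in _ + X]nth_default; last first.
  rewrite leqNgt; apply/negP => lt; have := size_comp_poly (U - 'X^(n.+1)) F.
  rewrite (monic_deg_size hF) /=; move: lt sU; rewrite /E.
  move: (size _) (size _) => b a lt le eab.
  have : (a.-1 <= n * m)%N.
    by rewrite eab leq_mul2r; apply/orP; right; case: b le {eab}.
  by rewrite [(n * m)%N]mulnC; move: lt j0; move: (m * n)%N; clear; lia.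
rewrite addr0 comp_Xn_poly {1}eF exprDn coef_sum.
rewrite big_ord_recl big_ord_recl big1 => [|i _]; last first.
  have [a [b [ea eb ab]]] : exists a b, [/\ (n.+1 - lift ord0 (lift ord0 i))%N = a,
      lift ord0 (lift ord0 i) = b :> nat & (a + b = n.+1)%N /\ (1 < b)%N].
    exists (n.+1 - i.+2)%N, i.+2; split=> //; split=> //.
    by rewrite subnK // !ltnS; exact: ltn_ord.
  rewrite ea eb coefMn nth_default ?mul0rn //.
  apply: leq_trans (size_polyMleq _ _) _.
  rewrite (monic_deg_size (monic_degXn a hA)) addSn /=.
  apply: leq_trans (leq_add (leqnn _) (size_poly_exp_leq B b)) _.
  have sB' : ((size B).-1 <= j)%N by rewrite -ltnS; move: sB; case: (size B).
  apply: leq_trans (leq_add (leqnn _) (_ : _ <= (j * b).+1)%N) _; first by rewrite ltnS leq_mul2r sB' orbT.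
  rewrite /E; case: ab => ab b1; have -> : n = (a + b.-1)%N by move: ab b1; clear; lia.
  have := leq_mul lt_jm (leqnn b.-1); case: b b1 {eb ab} => [|[|b]] // _ /=.
  by rewrite mulnDr; move: (m * a)%N (m * b.+1)%N; clear; lia.
rewrite /= subn0 expr0 mulr1 bin0 mulr1n addr0.
have -> : (A ^+ n.+1)`_E = 0.
  apply/eqP; apply: contraNT hE => /(support_modX sA).
  by rewrite modnMr => h; rewrite /dvdn h.
rewrite add0r bin1 expr1 subSS subn0 coefMn coef_mul_top ?monic_degXn //.
rewrite cB leqnn => /eqP; rewrite -mulr_natr mulf_eq0 (negPf fj) (negPf nN0).
by [].
Qed.

End CyclicSupport.

(** * Descent to the base field *)

Section SubleadingCoefficients.
Variable K : fieldType.
Implicit Types (a c : K) (G : {poly K}).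

Lemma monic_deg_lucasV a n : monic_deg n.+1 (lucasV 'X a%:P n.+1).
Proof.
have hX : monic_deg 1 ('X : {poly K}) by rewrite /monic_deg monicX size_polyX.
elim: n {-2}n (leqnn n) => [|N IH] [|[|n]] le //.
  rewrite lucasVS; apply: monic_degD; last by apply: (monic_degM hX hX).
  by rewrite size_polyN /= -polyC_natr -polyCM (leq_trans (size_polyC_leq1 _)).
rewrite lucasVS; apply: monic_degD; last first.
  by rewrite -add1n; apply: monic_degM hX _; apply: IH.
rewrite size_polyN mul_polyC (leq_trans (size_scale_leq _ _)) //.
by rewrite (monic_deg_size (IH n _)) // ltnW.
Qed.

Lemma lucasV_subleading a n : (lucasV 'X a%:P n.+1)`_n = 0.
Proof.
elim: n {-2}n (leqnn n) => [|N IH] [|[|n]] le //; first by rewrite coefX.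
- by rewrite coefX.
- by rewrite lucasVS coefB coefXM /= coefCM coefX -polyC_natr coefC mulr0 subrr.
rewrite lucasVS coefB coefXM (IH n.+1) // coefCM nth_default ?mulr0 ?subr0 //.
by rewrite (monic_deg_size (monic_deg_lucasV _ _)).
Qed.

Lemma lucasV_subsubleading a n : (lucasV 'X a%:P n.+2)`_n = - (n.+2%:R * a).
Proof.
elim: n => [|n IH].
  by rewrite lucasVS coefB coefXM /= coefCM -polyC_natr coefC sub0r mulrC.
rewrite lucasVS coefB coefXM [n.+1.-1]/= IH coefCM.
have /monic_degP[/monicP + s] := monic_deg_lucasV a n.
rewrite lead_coefE s => ->; transitivity (- (n.+2%:R * a) - a * 1) => //.
by rewrite -(natr1 n.+2); ring.
Qed.

Lemma coef_exp_XsubC c n : (('X - c%:P) ^+ n.+1)`_n = - (n.+1%:R * c).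
Proof.
elim: n => [|n IH]; first by rewrite expr1 coefB coefX coefC sub0r mul1r.
rewrite exprS mulrBl coefB coefXM IH coefCM.
have /monicP := monic_exp n.+1 (monicXsubC c); rewrite lead_coefE size_exp_XsubC /= => ->.
transitivity (- (n.+1%:R * c) - c * 1) => //.
by rewrite -(natr1 n.+1); ring.
Qed.

Lemma coef_comp_XsubC G c n : monic_deg n.+2 G -> G`_n.+1 = 0 ->
  (G \Po ('X - c%:P))`_n.+1 = - (n.+2%:R * c).
Proof.
move=> hG G1; have -> : G = 'X^(n.+2) + (G - 'X^(n.+2)) by ring.
rewrite rmorphD /= comp_Xn_poly coefD coef_exp_XsubC nth_default ?addr0 //.
have s : (size (G - 'X^(n.+2))%R <= n.+1)%N.
  apply/leq_sizeP => i; rewrite leq_eqVlt => /orP[/eqP <-|].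
    by rewrite coefB G1 coefXn ltn_eqF // subr0.
  rewrite leq_eqVlt => /orP[/eqP <-|lt].
    have /monic_degP[/monicP + sG] := hG; rewrite lead_coefE sG coefB coefXn /= => ->.
    by rewrite eqxx subrr.
  by rewrite coefB coefXn nth_default ?(monic_deg_size hG) // gtn_eqF // subr0.
by have := size_comp_le (ltn0Sn 0) (monic_deg_XsubC c) s; rewrite muln1.
Qed.

End SubleadingCoefficients.

Section Descent.
Variables (K k : fieldType) (i : {rmorphism K -> k}).
Local Notation "p ^i" := (map_poly i p) (at level 2, format "p ^i").

Lemma descend_constant (p q : {poly K}) b : p^i = q^i + b%:P ->
  exists b0, p = q + b0%:P.
Proof.
move=> e; have h : size (p - q) = size b%:P.
  by rewrite -(size_map_poly i) rmorphB /= e addrC addKr.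
have /size1_polyC e2 : (size (p - q)%R <= 1)%N by rewrite h size_polyC_leq1.
by exists (p - q)`_0; rewrite -e2 addrC subrK.
Qed.

Lemma map_shift (F : {poly K}) c : (F \Po ('X + c%:P))^i = F^i \Po ('X + (i c)%:P).
Proof. by rewrite map_comp_poly rmorphD /= map_polyX map_polyC. Qed.

(** The centre [c] is read off the coefficient below the leading one. *)
Lemma descend_centre n (F : {poly K}) (G : {poly k}) c b : (1 < n)%N -> n%:R != 0 :> k ->
  monic_deg n G -> G`_n.-1 = 0 -> F^i = G \Po ('X - c%:P) + b%:P ->
  exists2 c0, c = i c0 & (F \Po ('X + c0%:P))^i = G + b%:P.
Proof.
case: n => [|[|n]] // _ nN0 hG G1 e.
have ec : c = i (- F`_n.+1 / n.+2%:R).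
  rewrite fmorph_div rmorphN rmorph_nat -coef_map e coefD coefC addr0 coef_comp_XsubC //.
  by rewrite opprK mulrC mulKf.
exists (- F`_n.+1 / n.+2%:R) => //; rewrite map_shift -ec e rmorphD /= comp_polyC.
by rewrite -comp_polyA rmorphB /= comp_polyX comp_polyC addrK comp_polyXr.
Qed.

End Descent.

Section CoprimeDegrees.
Variables (K : fieldType) (k : closedFieldType) (i : {rmorphism K -> k}).
Variables (m n : nat) (F1 F2 U V : {poly K}).
Hypotheses (n1 : (1 < n)%N) (lt_nm : (n < m)%N) (co : coprime m n).
Hypotheses (mN0 : m%:R != 0 :> K) (nN0 : n%:R != 0 :> K).
Hypotheses (hF1 : monic_deg m F1) (hF2 : monic_deg n F2).
Hypotheses (hU : monic_deg n U) (hV : monic_deg m V) (eUV : U \Po F1 = V \Po F2).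
Local Notation "p ^i" := (map_poly i p) (at level 2, format "p ^i").

Let n0 : (0 < n)%N := ltnW n1.
Let m1 : (1 < m)%N := ltn_trans n1 lt_nm.
Let m0 : (0 < m)%N := ltnW m1.
Let mN0' : m%:R != 0 :> k. Proof. by rewrite -(rmorph_nat i) fmorph_eq0. Qed.
Let nN0' : n%:R != 0 :> k. Proof. by rewrite -(rmorph_nat i) fmorph_eq0. Qed.

Lemma monic_deg_shift N (F : {poly K}) c : (0 < N)%N -> monic_deg N F -> monic_deg N (F \Po ('X + c%:P)).
Proof.
move=> N0 hF; rewrite -[N]muln1; apply: monic_deg_comp => //.
by rewrite -[c]opprK polyCN; apply: monic_deg_XsubC.
Qed.

Lemma cyclic_shape c0 b : F2 \Po ('X + c0%:P) = 'X^n + b%:P ->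
  exists r P b1, (0 < r)%N /\ F1 \Po ('X + c0%:P) = 'X^r * (P \Po 'X^n) + b1%:P.
Proof.
move=> e2; set G1 := F1 \Po _; have hG1 : monic_deg m G1 by apply: monic_deg_shift.
have e : U \Po G1 = (V \Po ('X + b%:P)) \Po 'X^n.
  by rewrite /G1 comp_polyA eUV -comp_polyA e2 -[RHS]comp_polyA rmorphD /= comp_polyX comp_polyC.
have sup := cyclic_support m0 n0 nN0 hG1 hU e.
have rn : (m %% n < n)%N by rewrite ltn_mod.
have [|P eP] := @support_mod_comp _ n (m %% n) (G1 - (G1`_0)%:P) rn.
  move=> [|j]; rewrite coefB coefC /= ?subrr ?eqxx // subr0 modn_mod.
  exact: sup.
exists (m %% n)%N, P, G1`_0; rewrite -eP subrK; split=> //.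
rewrite lt0n; apply/negP => /eqP h.
have nm : (n %| m)%N by rewrite /dvdn h.
by move: (co) (n1); rewrite /coprime gcdnC (gcdn_idPl nm) => /eqP ->.
Qed.

Lemma power_shape c0 b : F1 \Po ('X + c0%:P) = 'X^m + b%:P ->
  exists b2, F2 \Po ('X + c0%:P) = 'X^n + b2%:P.
Proof.
move=> e1; set G2 := F2 \Po _; have hG2 : monic_deg n G2 by apply: monic_deg_shift.
have e : V \Po G2 = (U \Po ('X + b%:P)) \Po 'X^m.
  by rewrite /G2 comp_polyA -eUV -comp_polyA e1 -[RHS]comp_polyA rmorphD /= comp_polyX comp_polyC.
have sup := cyclic_support n0 m0 mN0 hG2 hV e.
exists G2`_0; apply/polyP => j; rewrite coefD coefXn coefC.
have /monic_degP[/monicP lG sG] := hG2; rewrite lead_coefE sG /= in lG.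
case: j => [|j]; first by rewrite /= (ltn_eqF n0) add0r.
rewrite /= addr0; case: eqP => [->|/eqP jn] //; have [//|fj] := eqVneq G2`_j.+1 0.
have jn' : (j.+1 <= n)%N.
  by rewrite leqNgt; apply: contra fj => lt; rewrite nth_default // sG.
have := sup j.+1 (ltn0Sn j) fj; rewrite !modn_small ?(leq_ltn_trans jn') //.
by move=> ejn; rewrite ejn eqxx in jn.
Qed.

Lemma lucas_comp_shift (c a : k) N :
  lucasV ('X - c%:P) a%:P N = lucasV 'X a%:P N \Po ('X - c%:P).
Proof. by rewrite rmorph_lucasV /= comp_polyX comp_polyC. Qed.

Lemma map_lucas a N : (lucasV 'X a%:P N)^i = lucasV 'X (i a)%:P N.
Proof. by rewrite rmorph_lucasV /= map_polyX map_polyC. Qed.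

Lemma coprime_shapes : exists c0,
  (exists r P b1 b2, [/\ (0 < r)%N, F1 \Po ('X + c0%:P) = 'X^r * (P \Po 'X^n) + b1%:P &
     F2 \Po ('X + c0%:P) = 'X^n + b2%:P]) \/
  (exists a b1 b2, F1 \Po ('X + c0%:P) = dickson m a + b1%:P /\
     F2 \Po ('X + c0%:P) = dickson n a + b2%:P).
Proof.
have tp : tame_pair m n F1^i F2^i U^i V^i.
  by split; rewrite ?monic_deg_map // -!map_comp_poly eUV.
have hXn N : (1 < N)%N -> monic_deg N ('X^N : {poly k}) /\ ('X^N : {poly k})`_N.-1 = 0.
  move=> N1; split; first by rewrite /monic_deg monicXn size_polyXn /=.
  by rewrite coefXn ltn_eqF // ltn_predL ltnW.
case: (tame_pair_classification tp) => [[c [b e]]|[c [b e]]|[c [a [b1 [b2 [e1 e2]]]]]].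
- have [hX X1] := hXn n n1.
  have [|c0 _ ec] := descend_centre (b := b) (c := c) n1 nN0' hX X1 (i := i) (F := F2).
    by rewrite e comp_Xn_poly.
  have [b2 eb2] : exists b2, F2 \Po ('X + c0%:P) = 'X^n + b2%:P.
    by apply: (descend_constant (i := i) (b := b)); rewrite ec map_polyXn.
  have [r [P [b1 [r0 eP]]]] := cyclic_shape eb2.
  by exists c0; left; exists r, P, b1, b2.
- have [hX X1] := hXn m m1.
  have [|c0 _ ec] := descend_centre (b := b) (c := c) m1 mN0' hX X1 (i := i) (F := F1).
    by rewrite e comp_Xn_poly.
  have [b1 eb1] : exists b1, F1 \Po ('X + c0%:P) = 'X^m + b1%:P.
    by apply: (descend_constant (i := i) (b := b)); rewrite ec map_polyXn.
  have [b2 eb2] := power_shape eb1.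
  have [r [P [b1' [r0 eP]]]] := cyclic_shape eb2.
  by exists c0; left; exists r, P, b1', b2.
have hL N : (1 < N)%N -> monic_deg N (lucasV 'X a%:P N) /\ (lucasV 'X a%:P N)`_N.-1 = 0.
  by case: N => // N _; split; [exact: monic_deg_lucasV|exact: lucasV_subleading].
have [h1 h2] := hL m m1.
have [|c0 ec0 ec] := descend_centre (b := b1) (c := c) m1 mN0' h1 h2 (i := i) (F := F1).
  by rewrite e1 lucas_comp_shift.
(* As [m >= 3], the parameter is read off the coefficient of degree [m - 2 > 0]. *)
have [a0 ea] : exists a0, a = i a0.
  move: (mN0) (mN0') (m1) (lt_nm) ec; case: (m) => [|[|[|M]]] //; first by move=> _ _ _; rewrite ltnNge n1.
  move=> MN0 MN0' _ _ ecM; exists (- (F1 \Po ('X + c0%:P))`_M.+1 / M.+3%:R).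
  rewrite fmorph_div rmorphN rmorph_nat -coef_map ecM coefD coefC addr0.
  by rewrite lucasV_subsubleading opprK mulrC mulKf.
exists c0; right; exists a0; rewrite !dickson_lucasV //.
have [b1' eb1] : exists b, F1 \Po ('X + c0%:P) = lucasV 'X a0%:P m + b%:P.
  by apply: (descend_constant (i := i) (b := b1)); rewrite ec map_lucas -ea.
have [b2' eb2] : exists b, F2 \Po ('X + c0%:P) = lucasV 'X a0%:P n + b%:P.
  apply: (descend_constant (i := i) (b := b2)); rewrite map_lucas -ea map_shift -ec0 e2.
  rewrite lucas_comp_shift rmorphD /= comp_polyC -comp_polyA rmorphB /= comp_polyX comp_polyC.
  by rewrite addrK comp_polyXr.
by exists b1', b2'.
Qed.

End CoprimeDegrees.

(** * Reduction to countable fields *)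

Section GeneratedField.
Variables (K : fieldType) (s : seq K).

Fixpoint field_expr (t : GenTree.tree nat) : K :=
  match t with
  | GenTree.Leaf i => s`_i
  | GenTree.Node 0 [:: a; b] => field_expr a - field_expr b
  | GenTree.Node 1 [:: a; b] => field_expr a / field_expr b
  | _ => 1
  end.

(** Elements of the subfield generated by [s] are values of expressions, and the
    expressions form a countable type. *)
Definition generated (x : K) : bool := boolp.asbool (exists t, field_expr t = x).

Lemma generatedP x : reflect (exists t, field_expr t == x) (generated x).
Proof. by apply: (iffP (boolp.asboolP _)) => -[t /eqP]; exists t => //; apply/eqP. Qed.

Lemma generated_divring : divring_closed generated.
Proof.
split=> [|x y /generatedP[a /eqP <-] /generatedP[b /eqP <-]|x y /generatedP[a /eqP <-] /generatedP[b /eqP <-]].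
- by apply/generatedP; exists (GenTree.Node 2 [::]).
- by apply/generatedP; exists (GenTree.Node 0 [:: a; b]).
- by apply/generatedP; exists (GenTree.Node 1 [:: a; b]).
Qed.

HB.instance Definition _ := GRing.isDivringClosed.Build K generated generated_divring.

Record gen_field := GenField { gen_val :> K; _ : gen_val \in generated }.

HB.instance Definition _ := [isSub for gen_val].
HB.instance Definition _ := [Choice of gen_field by <:].
HB.instance Definition _ := [SubChoice_isSubIntegralDomain of gen_field by <:].
HB.instance Definition _ := [SubIntegralDomain_isSubField of gen_field by <:].

Definition gen_code (x : gen_field) : GenTree.tree nat := xchoose (elimT (generatedP _) (valP x)).
Definition gen_decode t : option gen_field := insub (field_expr t).

Lemma gen_codeK : pcancel gen_code gen_decode.
Proof.
move=> x; rewrite /gen_decode /gen_code (eqP (xchooseP (elimT (generatedP _) (valP x)))).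
by rewrite valK.
Qed.

HB.instance Definition _ := PCanIsCountable gen_codeK.

Lemma gen_val_zmod : zmod_morphism gen_val. Proof. by []. Qed.
Lemma gen_val_monoid : monoid_morphism gen_val. Proof. by []. Qed.
HB.instance Definition _ := GRing.isZmodMorphism.Build gen_field K gen_val gen_val_zmod.
HB.instance Definition _ := GRing.isMonoidMorphism.Build gen_field K gen_val gen_val_monoid.

End GeneratedField.

Lemma countable_subfield (K : fieldType) (s : seq K) :
  exists (K0 : countFieldType) (i : {rmorphism K0 -> K}),
    forall x, x \in s -> exists y, x = i y.
Proof.
exists (gen_field s), (@gen_val K s).
move=> x xs; have gx : x \in generated s.
  apply/generatedP; exists (GenTree.Leaf (index x s)); by rewrite /= nth_index.
by exists (GenField gx).
Qed.

(** * Common composites of polynomials of arbitrary degrees *)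

Definition ritt_pair (K : fieldType) (f1 f2 : {poly K}) : Prop :=
  exists l1 l2 h : {poly K},
     [/\ deg l1 = 1%N, deg l2 = 1%N, deg h = gcdn (deg f1) (deg f2) &
      (exists (r n : nat) (P : {poly K}),
         [/\ (0 < r)%N, (0 < n)%N,
             f1 = l1 \Po (('X^r * (P \Po 'X^n)) \Po h) &
             f2 = l2 \Po ('X^n \Po h)])
      \/
      (exists (a : K) (m n : nat),
         [/\ (0 < m)%N, (0 < n)%N,
             f1 = l1 \Po (dickson m a \Po h) &
             f2 = l2 \Po (dickson n a \Po h)])].

Section Tame.
Variable K : fieldType.

Lemma natr_neq0_char n : (0 < n)%N -> char_ndvd K n -> n%:R != 0 :> K.
Proof.
move=> n0 h; apply/negP => e; have [p hp] := natf0_pchar n0 e.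
by have := h p hp; rewrite (dvdn_pcharf hp) e.
Qed.

Lemma char_ndvd_dvd a b : (a %| b)%N -> char_ndvd K b -> char_ndvd K a.
Proof. by move=> ab hb p /hb; apply: contra => /dvdn_trans; apply. Qed.

Lemma deg_comp (p q : {poly K}) : deg (p \Po q) = (deg p * deg q)%N.
Proof. exact: size_comp_poly. Qed.

Lemma deg_linear (a b : K) : a != 0 -> deg (a *: ('X + b%:P)) = 1%N.
Proof. by move=> a0; rewrite /deg size_scale // size_XaddC. Qed.

End Tame.

Section Forward.
Variables (K : fieldType) (k : closedFieldType) (i : {rmorphism K -> k}).
Local Notation "p ^i" := (map_poly i p) (at level 2, format "p ^i").

Lemma coprime_left_factors d m n (g1 g2 U V : {poly K}) :
  (0 < d)%N -> (0 < m)%N -> (0 < n)%N -> coprime m n -> (d * n)%:R != 0 :> K ->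
  monic_deg (d * m) g1 -> monic_deg (d * n) g2 -> monic_deg n U -> monic_deg m V ->
  U \Po g1 = V \Po g2 ->
  exists h F1 F2, [/\ monic_deg d h, monic_deg m F1 /\ monic_deg n F2,
    g1 = F1 \Po h, g2 = F2 \Po h & U \Po F1 = V \Po F2].
Proof.
move=> d0 m0 n0 co dnN0 h1 h2 hU hV e.
have nN0 : n%:R != 0 :> K by apply: contraNneq dnN0 => z; rewrite natrM z mulr0.
have nN0' : n%:R != 0 :> k by rewrite -(rmorph_nat i) fmorph_eq0.
have dnN0' : (d * n)%:R != 0 :> k by rewrite -(rmorph_nat i) fmorph_eq0.
have e' : U^i \Po g1^i = V^i \Po g2^i by rewrite -!map_comp_poly e.
have := @common_right_factor k d m n g1^i g2^i U^i V^i d0 m0 n0 co.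
rewrite !monic_deg_map => /(_ h1 h2 hU hV e' nN0' dnN0').
case=> h [F1 [F2 [[hh h00] hF1 hF2 e1 e2]]].
have [|h' hh' eh] := descend_right_factor n0 d0 nN0 _ hF2 hh h00 e2.
  by rewrite mulnC.
have sh : (1 < size h')%N by rewrite (monic_deg_size hh').
rewrite eh in e1 e2.
have [G1 eG1 eg1] := descend_left_factor sh e1; have [G2 eG2 eg2] := descend_left_factor sh e2.
rewrite eG1 monic_deg_map in hF1; rewrite eG2 monic_deg_map in hF2.
exists h', G1, G2; split=> //; apply: (comp_poly_inj sh).
by rewrite -!comp_polyA -eg1 -eg2.
Qed.

(** If the degree of [f2] divides that of [f1], both exponents can be taken to be
    [1]. *)
Lemma linear_shape (F1 F2 : {poly K}) : monic_deg 1 F2 ->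
  exists P b1 b2, F1 = 'X^1 * (P \Po 'X^1) + b1%:P /\ F2 = 'X^1 + b2%:P.
Proof.
move=> /monic_degP[/monicP l2 s2].
have hs (p : {poly K}) : p = 'X^1 * (drop_poly 1 p \Po 'X^1) + (p`_0)%:P.
  rewrite expr1 comp_polyXr -{1}(poly_take_drop 1 p) addrC expr1 mulrC; congr (_ + _).
  by apply/polyP => -[|j]; rewrite coef_take_poly coefC.
exists (drop_poly 1 F1), F1`_0, F2`_0; split; first exact: hs.
apply/polyP => -[|[|j]]; rewrite coefD coefXn coefC /= ?add0r ?addr0 //.
  by move: l2; rewrite lead_coefE s2.
by rewrite nth_default // s2.
Qed.

(** The leading coefficient [a] of [q] is moved into the left factor. *)
Lemma monic_left_factor M (a w : K) (p q g : {poly K}) : a != 0 -> w != 0 ->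
  (0 < deg p)%N -> (0 < M)%N -> monic_deg M g -> q = a *: g -> lead_coef (p \Po q) = w ->
  exists2 P, monic_deg (deg p) P & P \Po g = w^-1 *: (p \Po q).
Proof.
move=> aN0 wN0 p0 M0 hg eq lw; exists (w^-1 *: (p \Po (a *: 'X))); set P := _ *: _; last first.
  by rewrite /P comp_polyZ -comp_polyA comp_polyZ comp_polyX eq.
have ec : P \Po g = w^-1 *: (p \Po q).
  by rewrite /P comp_polyZ -comp_polyA comp_polyZ comp_polyX eq.
have sP : size P = (deg p).+1.
  rewrite /P size_scale ?invr_eq0 //.
  have : deg (p \Po (a *: 'X)) = deg p by rewrite deg_comp /deg size_scale // size_polyX muln1.
  by move: p0; rewrite /deg; case: (size (p \Po _)) => [|s] //= + es; rewrite -es.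
clearbody P; apply/monic_degP; split=> //; rewrite monicE.
have := congr1 (@lead_coef K) ec; rewrite lead_coef_comp ?(monic_deg_size hg) //.
by rewrite (monicP (monic_deg_monic hg)) expr1n mulr1 lead_coefZ lw mulVf // => ->.
Qed.

(** The hypotheses are normalised to monic polynomials and to a composite of least
    degree; then a common right factor of degree the greatest common divisor leaves a
    pair of coprime degrees, to which [coprime_shapes] applies. *)
Lemma ritt_pair_tame (f1 f2 u v : {poly K}) :
  (deg f2 <= deg f1)%N -> (1 < deg f2)%N -> (0 < deg u)%N ->
  u \Po f1 = v \Po f2 -> (deg f1 * deg f2)%:R != 0 :> K -> (deg (u \Po f1))%:R != 0 :> K ->
  ritt_pair f1 f2.
Proof.
move=> le21 f2gt1 du e N12 Ng.
have f1gt0 : (0 < deg f1)%N by apply: leq_trans le21; apply: ltnW.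
have f2gt0 : (0 < deg f2)%N by apply: ltnW.
have pN0 (p : {poly K}) : (0 < deg p)%N -> p != 0.
  by apply: contraTneq => ->; rewrite /deg size_poly0.
have edeg : (deg u * deg f1 = deg v * deg f2)%N by rewrite -!deg_comp e.
have dv : (0 < deg v)%N.
  by rewrite -(ltn_pmul2r f2gt0) mul0n -edeg muln_gt0 du.
set d := gcdn (deg f1) (deg f2); have d0 : (0 < d)%N by rewrite gcdn_gt0 f1gt0.
have [m em] := dvdnP (dvdn_gcdl (deg f1) (deg f2)); rewrite -/d mulnC in em.
have [n en] := dvdnP (dvdn_gcdr (deg f1) (deg f2)); rewrite -/d mulnC in en.
have m0 : (0 < m)%N by move: f1gt0; rewrite em muln_gt0 => /andP[].
have n0 : (0 < n)%N by move: f2gt0; rewrite en muln_gt0 => /andP[].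
have co : coprime m n by rewrite /coprime -(eqn_pmul2l d0) muln1 muln_gcdr -em -en.
have [kk ek] : exists kk, deg u = (n * kk)%N.
  have : (n %| deg u)%N.
    rewrite -(Gauss_dvdl _ (_ : coprime n m)) 1?coprime_sym //.
    have : (deg u * m = deg v * n)%N.
      by apply/eqP; rewrite -(eqn_pmul2l d0) !(mulnCA d) -em -en edeg.
    by move=> ->; apply: dvdn_mull.
  by case/dvdnP => kk ->; exists kk; rewrite mulnC.
have ndm : (n * (d * m) = m * (d * n))%N by rewrite mulnCA [RHS]mulnCA [(n * m)%N]mulnC.
have ekv : deg v = (m * kk)%N.
  apply/eqP; rewrite -(eqn_pmul2r f2gt0) -edeg ek em en.
  by rewrite [(n * kk)%N]mulnC [(m * kk)%N]mulnC -!mulnA ndm.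
have kk0 : (0 < kk)%N by move: du; rewrite ek muln_gt0 => /andP[].
have mulN0 a b : (a * b)%:R != 0 :> K -> a%:R != 0 :> K /\ b%:R != 0 :> K.
  by rewrite natrM mulf_eq0 negb_or => /andP[].
have [dmN0 dnN0] := mulN0 _ _ N12; rewrite em in dmN0; rewrite en in dnN0.
have [_ mN0] := mulN0 _ _ dmN0; have [_ nN0] := mulN0 _ _ dnN0.
have kkN0 : kk%:R != 0 :> K.
  by move: Ng; rewrite deg_comp ek => /mulN0[/mulN0[]].
pose a1 := lead_coef f1; pose a2 := lead_coef f2.
have a1N0 : a1 != 0 by rewrite lead_coef_eq0 pN0.
have a2N0 : a2 != 0 by rewrite lead_coef_eq0 pN0.
pose g1 := a1^-1 *: f1; pose g2 := a2^-1 *: f2.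
have normal (p : {poly K}) : (0 < deg p)%N -> monic_deg (deg p) ((lead_coef p)^-1 *: p).
  move=> p0; have lN0 : lead_coef p != 0 by rewrite lead_coef_eq0 pN0.
  apply/monic_degP; rewrite monicE lead_coefZ mulVf // size_scale ?invr_eq0 //.
  by rewrite prednK // size_poly_gt0 pN0.
have hg1 : monic_deg (d * m) g1 by rewrite -em; apply: normal.
have hg2 : monic_deg (d * n) g2 by rewrite -en; apply: normal.
have eg1 : f1 = a1 *: g1 by rewrite scalerA divff // scale1r.
have eg2 : f2 = a2 *: g2 by rewrite scalerA divff // scale1r.
pose w := lead_coef (u \Po f1).
have wN0 : w != 0 by rewrite lead_coef_eq0 pN0 // deg_comp muln_gt0 du.
have [u1 hu1 eu1] := monic_left_factor a1N0 wN0 du f1gt0 (normal _ f1gt0) eg1 erefl.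
have lv : lead_coef (v \Po f2) = w by rewrite -e.
have [v1 hv1 ev1] := monic_left_factor a2N0 wN0 dv f2gt0 (normal _ f2gt0) eg2 lv.
have euv : u1 \Po g1 = v1 \Po g2 by rewrite eu1 ev1 e.
rewrite ek in hu1; rewrite ekv in hv1.
have dm0 : (0 < d * m)%N by rewrite -em.
have dn0 : (0 < d * n)%N by rewrite -en.
have [U [V [hU hV eUV]]] := minimal_composite kk0 kkN0 dm0 dn0 ndm hg1 hg2 hu1 hv1 euv.
have [h [F1 [F2 [hh [hF1 hF2] ef1 ef2 eF]]]] :=
  coprime_left_factors d0 m0 n0 co dnN0 hg1 hg2 hU hV eUV.
have shape c0 (Phi1 Phi2 : {poly K}) b1 b2 :
    F1 \Po ('X + c0%:P) = Phi1 + b1%:P -> F2 \Po ('X + c0%:P) = Phi2 + b2%:P ->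
    f1 = (a1 *: ('X + b1%:P)) \Po (Phi1 \Po (h - c0%:P)) /\
    f2 = (a2 *: ('X + b2%:P)) \Po (Phi2 \Po (h - c0%:P)).
  have sub (F Phi : {poly K}) b a : F \Po ('X + c0%:P) = Phi + b%:P ->
      a *: (F \Po h) = (a *: ('X + b%:P)) \Po (Phi \Po (h - c0%:P)).
    move=> eFP; rewrite comp_polyZ rmorphD /= comp_polyX comp_polyC; congr (_ *: _).
    rewrite -(comp_polyC b (h - c0%:P)) -rmorphD /= -eFP -comp_polyA.
    by rewrite rmorphD /= comp_polyX comp_polyC subrK.
  by move=> s1 s2; split; [rewrite eg1 ef1|rewrite eg2 ef2]; apply: sub.
have dh c0 : deg (h - c0%:P) = d by rewrite /deg (monic_deg_size (monic_degB c0 d0 hh)).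
have lin (a b : K) : a != 0 -> deg (a *: ('X + b%:P)) = 1%N by exact: deg_linear.
have [n1|n1] := eqVneq n 1%N.
  have [P [b1 [b2 [s1 s2]]]] : exists P b1 b2, F1 = 'X^1 * (P \Po 'X^1) + b1%:P /\ F2 = 'X^1 + b2%:P.
    by apply: linear_shape; rewrite -n1.
  have shift0 (F : {poly K}) : F \Po ('X + 0%:P) = F by rewrite polyC0 addr0 comp_polyXr.
  rewrite -[F1]shift0 in s1; rewrite -[F2]shift0 in s2; have [q1 q2] := shape _ _ _ _ _ s1 s2.
  exists (a1 *: ('X + b1%:P)), (a2 *: ('X + b2%:P)), (h - 0%:P).
  by split; [exact: lin|exact: lin|exact: dh|left; exists 1%N, 1%N, P].
have n2 : (1 < n)%N by rewrite ltn_neqAle eq_sym n1.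
have lt_nm : (n < m)%N.
  rewrite ltn_neqAle -(leq_pmul2l d0) -em -en le21 andbT.
  apply: contra n1 => /eqP enm; move: co; rewrite -enm /coprime gcdnn.
  by [].
have [c0 [[r [P [b1 [b2 [r0 s1 s2]]]]]|[a [b1 [b2 [s1 s2]]]]]] :=
  coprime_shapes i n2 lt_nm co mN0 nN0 hF1 hF2 hU hV eF.
- have [q1 q2] := shape _ _ _ _ _ s1 s2.
  exists (a1 *: ('X + b1%:P)), (a2 *: ('X + b2%:P)), (h - c0%:P).
  by split; [exact: lin|exact: lin|exact: dh|left; exists r, n, P].
- have [q1 q2] := shape _ _ _ _ _ s1 s2.
  exists (a1 *: ('X + b1%:P)), (a2 *: ('X + b2%:P)), (h - c0%:P).
  by split; [exact: lin|exact: lin|exact: dh|right; exists a, m, n].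
Qed.

End Forward.

Section Transfer.
Variables (K0 K : fieldType) (j : {rmorphism K0 -> K}).
Local Notation "p ^j" := (map_poly j p) (at level 2, format "p ^j").

Lemma lift_poly (p : {poly K}) : {in (p : seq K), forall x, exists y, x = j y} ->
  exists p0, p = p0^j.
Proof.
move=> h; have [s es] : exists s, (p : seq K) = map j s.
  elim: (p : seq K) h => [|x s IH] h; first by exists [::].
  have [y ->] : exists y, x = j y by apply: h; rewrite inE eqxx.
  have [|s0 ->] := IH; first by move=> z zs; apply: h; rewrite inE zs orbT.
  by exists (y :: s0).
exists (Poly s); apply/polyP => n; rewrite coef_map coef_Poly es.
have [lt|ge] := ltnP n (size s); first by rewrite (nth_map 0).
have -> : s`_n = 0 by apply: nth_default.
by rewrite raddf0 nth_default ?size_map.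
Qed.

Lemma deg_map (p : {poly K0}) : deg p^j = deg p.
Proof. by rewrite /deg size_map_poly. Qed.

Lemma map_dickson n a : (0 < n)%N -> (dickson n a)^j = dickson n (j a).
Proof. by move=> n0; rewrite !dickson_lucasV // rmorph_lucasV /= map_polyX map_polyC. Qed.

Lemma ritt_pair_map f1 f2 : ritt_pair f1 f2 -> ritt_pair f1^j f2^j.
Proof.
case=> l1 [l2 [h [d1 d2 dh c]]]; exists l1^j, l2^j, h^j; rewrite !deg_map; split=> //.
case: c => [[r [n [P [r0 n0 -> ->]]]]|[a [m [n [m0 n0 -> ->]]]]].
  left; exists r, n, P^j; split=> //.
    by rewrite !map_comp_poly rmorphM /= map_comp_poly !map_polyXn.
  by rewrite !map_comp_poly map_polyXn.
by right; exists (j a), m, n; split=> //; rewrite !map_comp_poly map_dickson.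
Qed.

End Transfer.

Section Converse.
Variable K : fieldType.
Implicit Types (l h : {poly K}).

Lemma linear_inverse l : deg l = 1%N -> exists2 t, deg t = 1%N & t \Po l = 'X.
Proof.
move=> dl; have sl : size l = 2%N by move: dl; rewrite /deg; case: (size l) => [|[|[|]]].
pose a := l`_1; pose b := l`_0.
have a0 : a != 0 by have := lead_coef_eq0 l; rewrite lead_coefE sl /= => ->; rewrite -size_poly_gt0 sl.
have el : l = a *: 'X + b%:P.
  apply/polyP => -[|[|i]]; rewrite coefD coefZ coefX coefC /= ?mulr0 ?mulr1 ?add0r ?addr0 //.
  by rewrite nth_default // sl.
exists (a^-1 *: ('X - b%:P)); first by rewrite -polyCN deg_linear ?invr_eq0.
rewrite comp_polyZ rmorphB /= comp_polyX comp_polyC el addrK scalerA mulVf // scale1r.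
by [].
Qed.

(** Polynomials of degree one are invertible for composition, so it is enough that
    the middle factors [D1] and [D2] have a common composite. *)
Lemma composite_of_square (f1 f2 l1 l2 h A B D1 D2 : {poly K}) :
  deg l1 = 1%N -> deg l2 = 1%N -> (0 < deg f1)%N -> (0 < deg f2)%N ->
  f1 = l1 \Po (D1 \Po h) -> f2 = l2 \Po (D2 \Po h) -> A \Po D1 = B \Po D2 ->
  deg A = deg D2 -> (0 < deg A)%N -> char_ndvd K (deg f1 * deg f2) ->
  exists g, common_composite f1 f2 g /\ char_ndvd K (deg g).
Proof.
move=> d1 d2 f10 f20 e1 e2 e dA A0 hch.
have [t1 dt1 et1] := linear_inverse d1; have [t2 dt2 et2] := linear_inverse d2.
have c1 : (A \Po t1) \Po f1 = (A \Po D1) \Po h.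
  by rewrite e1 comp_polyA -(comp_polyA A) et1 comp_polyXr comp_polyA.
have c2 : (B \Po t2) \Po f2 = (A \Po D1) \Po h.
  by rewrite e2 comp_polyA -(comp_polyA B) et2 comp_polyXr e comp_polyA.
have ddA : deg (A \Po t1) = deg A by rewrite deg_comp dt1 muln1.
exists ((A \Po t1) \Po f1); split.
  exists (A \Po t1), (B \Po t2); split; rewrite ?ddA ?c1 ?c2 //.
  have : (0 < deg ((B \Po t2) \Po f2))%N by rewrite c2 -c1 deg_comp ddA muln_gt0 A0.
  by rewrite deg_comp muln_gt0 => /andP[].
apply: char_ndvd_dvd hch; rewrite deg_comp ddA dA mulnC dvdn_mul //.
by rewrite e2 !deg_comp d2 mul1n dvdn_mulr.
Qed.

Lemma deg_dickson n (a : K) : (0 < n)%N -> deg (dickson n a) = n.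
Proof.
case: n => // n _; rewrite dickson_lucasV // /deg.
by rewrite (monic_deg_size (monic_deg_lucasV a n)).
Qed.

(** The two identities are ['X^n \Po ('X^r * (P \Po 'X^n)) = ('X^r * P ^+ n) \Po 'X^n]
    and the commutation of Dickson polynomials. *)
Lemma composite_of_ritt_pair (f1 f2 : {poly K}) : (0 < deg f1)%N -> (0 < deg f2)%N ->
  char_ndvd K (deg f1 * deg f2) -> ritt_pair f1 f2 ->
  exists g, common_composite f1 f2 g /\ char_ndvd K (deg g).
Proof.
move=> f10 f20 hch [l1 [l2 [h [d1 d2 dh]]]].
have dXn n : deg ('X^n : {poly K}) = n by rewrite /deg size_polyXn.
case=> [[r [n [P [r0 n0 e1 e2]]]]|[a [m [n [m0 n0 e1 e2]]]]].
  apply: (composite_of_square (A := 'X^n) (B := 'X^r * P ^+ n) d1 d2 f10 f20 e1 e2) => //.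
    rewrite comp_Xn_poly exprMn rmorphM !rmorphXn /= comp_polyX.
    by rewrite -!exprM mulnC.
  by rewrite dXn.
apply: (composite_of_square (A := dickson n (a ^+ m)) (B := dickson m (a ^+ n)) d1 d2 f10 f20 e1 e2) => //.
- by rewrite !dickson_comp // mulnC.
- by rewrite !deg_dickson.
- by rewrite deg_dickson.
Qed.

End Converse.

Theorem theorem5p1 (K : fieldType) (f1 f2 : {poly K})
    (hdeg : (deg f2 <= deg f1)%N) (hdeg2 : (1 < deg f2)%N)
    (hchar : char_ndvd K (deg f1 * deg f2)) :
  (exists g : {poly K}, common_composite f1 f2 g /\ char_ndvd K (deg g)) <->
  (exists l1 l2 h : {poly K},
     [/\ deg l1 = 1%N, deg l2 = 1%N, deg h = gcdn (deg f1) (deg f2) &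
      (exists (r n : nat) (P : {poly K}),
         [/\ (0 < r)%N, (0 < n)%N,
             f1 = l1 \Po (('X^r * (P \Po 'X^n)) \Po h) &
             f2 = l2 \Po ('X^n \Po h)])
      \/
      (exists (a : K) (m n : nat),
         [/\ (0 < m)%N, (0 < n)%N,
             f1 = l1 \Po (dickson m a \Po h) &
             f2 = l2 \Po (dickson n a \Po h)])]).
Proof.
have f20 : (0 < deg f2)%N by apply: ltnW.
have f10 : (0 < deg f1)%N by apply: leq_trans hdeg.
split; last exact: composite_of_ritt_pair.
case=> g [[u [v [du dv eu ev]]] hg].
have N12 : (deg f1 * deg f2)%:R != 0 :> K by apply: natr_neq0_char; rewrite ?muln_gt0 ?f10.
have [K0 [j hj]] := countable_subfield (f1 ++ f2 ++ u ++ v : seq K).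
have lift (p : {poly K}) : {subset (p : seq K) <= f1 ++ f2 ++ u ++ v} -> exists p0, p = map_poly j p0.
  by move=> sub; apply: lift_poly => x /sub/hj.
have [q1 e1] : exists q1, f1 = map_poly j q1 by apply: lift => x; rewrite !mem_cat => ->.
have [q2 e2] : exists q2, f2 = map_poly j q2 by apply: lift => x; rewrite !mem_cat => ->; rewrite !orbT.
have [u0 eu0] : exists u0, u = map_poly j u0 by apply: lift => x; rewrite !mem_cat => ->; rewrite !orbT.
have [v0 ev0] : exists v0, v = map_poly j v0 by apply: lift => x; rewrite !mem_cat => ->; rewrite !orbT.
have [k [i _]] := countable_algebraic_closure K0.
have euv : u0 \Po q1 = v0 \Po q2.
  by apply: (map_poly_inj j); rewrite !map_comp_poly -eu0 -ev0 -e1 -e2 -eu -ev.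
rewrite e1 e2; apply: ritt_pair_map.
apply: (ritt_pair_tame i (u := u0) (v := v0)) => //.
- by move: hdeg; rewrite e1 e2 !deg_map.
- by move: hdeg2; rewrite e2 deg_map.
- by move: du; rewrite eu0 deg_map.
- by move: N12; rewrite e1 e2 !deg_map -(rmorph_nat j) fmorph_eq0.
- have := natr_neq0_char _ hg; rewrite eu deg_comp muln_gt0 du f10 => /(_ isT).
  by rewrite deg_comp eu0 e1 !deg_map -(rmorph_nat j) fmorph_eq0.
Qed.
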